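(* Let $K \subset \mathbb{R}^{2}$ be a Borel set with $\dim_{\mathrm{H}} K > 0$, and let $$\mathrm{Inv}_{1/2}(K) := \left\{x \in \mathbb{R}^{2} : \dim_{\mathrm{H}} \pi_{x}(K \setminus \{x\}) < \tfrac{1}{2}\dim_{\mathrm{H}} K\right\}.$$ Then at least one of the following holds: (1) $\dim_{\mathrm{H}} \mathrm{Inv}_{1/2}(K) = 0$; (2) $\mathrm{Inv}_{1/2}(K)$ is contained on a line. That is, if $E \subset \mathbb{R}^{2}$ is a Borel set with $\dim_{\mathrm{H}} E > 0$ which is not contained on a line, then there exists $x \in E$ such that $\dim_{\mathrm{H}} \pi_{x}(K \setminus \{x\}) \geq \tfrac{1}{2}\dim_{\mathrm{H}} K$.
   Context: For $x \in \mathbb{R}^{2}$, the radial projection $\pi_{x} \colon \mathbb{R}^{2} \setminus \{x\} \to S^{1}$ is $\pi_{x}(y) = \frac{y - x}{|y - x|}$. $\dim_{\mathrm{H}}$ denotes Hausdorff dimension. *)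

(* Defs.v *)
From HB Require Import structures.
From mathcomp Require Import all_boot all_order all_algebra.
From mathcomp Require Import all_classical all_reals all_analysis.
Set Implicit Arguments.
Unset Strict Implicit.
Unset Printing Implicit Defensive.
Import Order.TTheory GRing.Theory Num.Theory.
Import numFieldNormedType.Exports.
Local Open Scope classical_set_scope.
Local Open Scope ring_scope.

(* The library norm on 'rV[R]_n is the sup norm, hence this definition. *)
Definition enorm (R : realType) (n : nat) (x : 'rV[R]_n) : R :=
  Num.sqrt (\sum_(i < n) x 0 i ^+ 2).

(* The maximum with 0 only affects A = set0, whose supremum would be -oo. *)
Definition diam (R : realType) (n : nat) (A : set 'rV[R]_n) : \bar R :=
  maxe 0%E (ereal_sup [set (enorm (x - y))%:E | x in A & y in A]).

(* Conventions at s = 0: the empty set has weight 0, while a singleton has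
   weight 0 `^ 0 = 1, so that the 0-dimensional measure counts points. *)
Definition diam_pow (R : realType) (n : nat) (s : R) (A : set 'rV[R]_n) :
    \bar R :=
  if A == set0 then 0%E else (diam A `^ s)%E.

(* Finite covers are included, since the sets of a cover may be empty. *)
Definition hausdorff_content (R : realType) (n : nat) (s delta : R)
    (A : set 'rV[R]_n) : \bar R :=
  ereal_inf [set (\sum_(0 <= i <oo) diam_pow s (U i))%E | U in
    [set U : nat -> set 'rV[R]_n |
      A `<=` \bigcup_i U i /\ forall i, (diam (U i) <= delta%:E)%E]].

(* The limit as delta tends to 0 is a supremum, by monotonicity in delta. *)
Definition hausdorff_measure (R : realType) (n : nat) (s : R)
    (A : set 'rV[R]_n) : \bar R :=
  ereal_sup [set hausdorff_content s delta A | delta in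
    [set delta : R | 0 < delta]].

Definition hausdorff_dim (R : realType) (n : nat) (A : set 'rV[R]_n) : \bar R :=
  ereal_inf [set s%:E | s in
    [set s : R | 0 <= s /\ hausdorff_measure s A = 0%E]].

(* The sup norm and the Euclidean norm have the same open sets. *)
Definition borel_set (R : realType) (n : nat) (A : set 'rV[R]_n) : Prop :=
  <<s [set U : set 'rV[R]_n | open U] >> A.

Definition is_line (R : realType) (L : set 'rV[R]_2) : Prop :=
  exists p v : 'rV[R]_2, v != 0 /\ L = [set p + t *: v | t in [set: R]].

Definition contained_on_line (R : realType) (A : set 'rV[R]_2) : Prop :=
  exists L : set 'rV[R]_2, is_line L /\ A `<=` L.

(* Only meaningful for y != x; the junk value at y = x is 0. *)
Definition radial_proj (R : realType) (x y : 'rV[R]_2) : 'rV[R]_2 :=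
  (enorm (y - x))^-1 *: (y - x).

Definition Inv_half (R : realType) (K : set 'rV[R]_2) : set 'rV[R]_2 :=
  [set x | (hausdorff_dim (radial_proj x @` (K `\ x))
            < (2^-1)%:E * hausdorff_dim K)%E].

(* Main.v *)
Require Import Defs.
From HB Require Import structures.
From mathcomp Require Import all_boot all_order all_algebra.
From mathcomp Require Import all_classical all_reals all_analysis.
From mathcomp Require Import lra zify ring.
Import Order.TTheory GRing.Theory Num.Theory.
Import numFieldNormedType.Exports.
Set Implicit Arguments.
Unset Strict Implicit.
Unset Printing Implicit Defensive.
Local Open Scope classical_set_scope.
Local Open Scope ring_scope.

(* Suppose that the exceptional set has positive dimension and is not on a line.
   Then for some t with 2t < dim K the set of x such that the projection of K from
   x is t-null has positive eta-dimensional content for some eta > 0 and is not on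
   a line; in particular every line meets K in an s-null set, where
   2t < s < dim K.  Capacitability replaces K by a compact set P and the
   exceptional set, made G_delta by asking for finite covers by open arcs, by a
   compact set E disjoint from P.  On E and P one puts Frostman measures nu and mu;
   finitely supported ones, accurate above a tiny scale, are enough, because
   compactness bounds from below the size of all arcs that are used.

   Call (x, y) bad at scale r_k if mu and nu both give a lot of mass to the
   r_k-neighbourhood of the line x y, in the sense that the product of the two
   masses is at least t_k^2.  Heavy tubes at scale r_(k+1) that are
   r_k-separated are essentially disjoint, so there are at most 4 / t_(k+1) of
   them, and the pairs that are bad at scale r_(k+1) but not at scale r_k have
   product mass at most 4 t_k^2 / t_(k+1).  This is summable, and at the first
   scale there is no bad pair since mu vanishes on lines.

   For the other pairs, pigeonholing the arcs by size gives j such that for many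
   pairs (x, y) the point y lies in one of about exp (j t) sectors at x of
   aperture exp (- j).  By Cauchy-Schwarz there are many triples (x, x', y)
   of this kind.  Few of them have y close to the line x x', because the pairs are
   not bad; for the others the sectors at x and x' are transversal, so that y is
   confined to exp (2 j t) sets of diameter about exp (- j), of total mass
   about exp (- j (s - 2 t)): a contradiction. *)

(** * Dyadic content *)

Section dyadic.
Context {R : realType}.
Local Notation pt := 'rV[R]_2.
Implicit Types (x y z : pt) (s : R) (A B : set pt).

Definition dyadic : Type := (nat * (int * int))%type.

Definition dyof g x : dyadic :=
  (g, (Num.floor (2 ^+ g * x 0 0), Num.floor (2 ^+ g * x 0 1))).

Definition dcube (q : dyadic) : set pt := [set x | dyof q.1 x = q].

Definition dunion (S : set dyadic) : set pt := [set x | exists2 q, S q & dcube q x].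

(** The side length [2^-g] to the power [s]. *)
Definition dwt s (q : dyadic) : R := ((2^-1) `^ s) ^+ q.1.

(** Total weight at most [v], tested on finite duplicate-free lists in place of an infinite sum. *)
Definition dwle s (S : set dyadic) (v : R) :=
  forall F : seq dyadic, uniq F -> (forall q, q \in F -> S q) ->
    \sum_(q <- F) dwt s q <= v.

Definition dcover s A (v : R) := exists2 S, A `<=` dunion S & dwle s S v.

Lemma dwt_ge0 s q : 0 <= dwt s q.
Proof. by rewrite exprn_ge0 // powR_ge0. Qed.

Lemma dwt_gt0 s q : 0 < dwt s q.
Proof. by rewrite exprn_gt0 // powR_gt0. Qed.

Lemma dwle_ge0 s S v : dwle s S v -> 0 <= v.
Proof. by move=> /(_ [::]); rewrite big_nil; apply. Qed.

Lemma dwleW s S v w : v <= w -> dwle s S v -> dwle s S w.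
Proof. by move=> vw Sv F uF FS; apply: le_trans vw; apply: Sv. Qed.

Lemma dwleS s S S' v : S `<=` S' -> dwle s S' v -> dwle s S v.
Proof. by move=> SS Sv F uF FS; apply: Sv => // q /FS; apply: SS. Qed.

(** [floor a] is determined by [floor (2 a)], so a square determines its parent; this is the nesting
    of the dyadic grids. *)
Lemma floor_half (a b : R) : Num.floor (2 * a) = Num.floor (2 * b) ->
  Num.floor a = Num.floor b.
Proof.
move=> e; apply/esym/floor_def.
have h1 := floor_itv (2 * a); have h2 := floor_itv (2 * b).
have h3 := floor_itv a.
rewrite e in h1.
move: h1 h2 h3 => /andP[h1 h1'] /andP[h2 h2'] /andP[h3 h3'].
have l1 : (2 * Num.floor a <= Num.floor (2 * b)).
  have : ((2 * Num.floor a)%:~R < (Num.floor (2 * b) + 1)%:~R :> R).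
    by rewrite intrM; lra.
  by rewrite ltr_int; lia.
have l2 : (Num.floor (2 * b) + 1 <= 2 * (Num.floor a + 1)).
  have : ((Num.floor (2 * b))%:~R < (2 * (Num.floor a + 1))%:~R :> R).
    by rewrite intrM; lra.
  by rewrite ltr_int; lia.
move: l1 l2; rewrite -(ler_int R) -(ler_int R _ (2 * _)) !intrM => l1 l2.
by apply/andP; split; lra.
Qed.

Lemma dyof_nest g g' x y : (g' <= g)%N -> dyof g x = dyof g y ->
  dyof g' x = dyof g' y.
Proof.
move=> /subnKC <-; elim: (g - g')%N => [|n IH]; first by rewrite addn0.
move=> [e1 e2]; apply: IH; rewrite /dyof; congr (_, (_, _)); apply: floor_half.
  by rewrite !mulrA -exprS -addnS.
by rewrite !mulrA -exprS -addnS.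
Qed.

Lemma dcube_dyof g x : dcube (dyof g x) x.
Proof. by []. Qed.

Lemma dcube_eq q q' x : dcube q x -> dcube q' x -> q.1 = q'.1 -> q = q'.
Proof. by move=> <- <- /= ->. Qed.

Lemma dcube_sub q q' x y : (q'.1 <= q.1)%N -> dcube q x -> dcube q' x ->
  dcube q y -> dcube q' y.
Proof.
move=> qq qx <- qy; apply: (dyof_nest qq); rewrite -/(dcube q y).
by rewrite qy qx.
Qed.

(* Every point covered by W lies in exactly one square of dmax W. *)
Definition dmax (W : set dyadic) : set dyadic :=
  [set q | W q /\ forall q', W q' -> dcube q `<=` dcube q' -> (q.1 <= q'.1)%N].

Lemma dmax_min W q x : dmax W q -> dcube q x -> forall q', W q' -> dcube q' x ->
  (q.1 <= q'.1)%N.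
Proof.
move=> [Wq mq] qx q' Wq' q'x; rewrite leqNgt; apply/negP => lt.
have := mq q' Wq'; rewrite leqNgt lt; apply/not_implyP; split => //.
by move=> y; apply: dcube_sub q'x => //; exact: ltnW.
Qed.

Lemma dmax_exists W x : dunion W x -> exists2 q, dmax W q & dcube q x.
Proof.
move=> [q0 Wq0 q0x].
pose P n := `[< exists q, [/\ W q, dcube q x & q.1 = n] >].
have exP : exists n, P n by exists q0.1; apply/asboolP; exists q0.
case: (ex_minnP exP) => n /asboolP[q [Wq qx qn]] mn.
exists q => //; split=> // q' Wq' qq'; rewrite qn; apply: mn.
by apply/asboolP; exists q'; split => //; apply: qq'.
Qed.

Lemma dunion_dmax W : dunion (dmax W) = dunion W.
Proof.
apply/seteqP; split => [x [q [Wq _] qx]|x Wx]; first by exists q.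
by have [q mq qx] := dmax_exists Wx; exists q.
Qed.

(** * Dyadic content, null sets and continuity from below *)

Definition dcontent s A : R := inf [set v | dcover s A v].

(** Guards against the default value 0 that [inf] takes on the empty set. *)
Definition dfin s A := exists v, dcover s A v.

Lemma dcontent_lb s A v : dcover s A v -> dcontent s A <= v.
Proof. by move=> c; apply: ge_inf => //; exists 0 => w [S _ /dwle_ge0]. Qed.

Lemma dcontent_ge s A v : dfin s A -> (forall w, dcover s A w -> v <= w) ->
  v <= dcontent s A.
Proof. by move=> fA h; apply: lb_le_inf. Qed.

Lemma dcontent_ge0 s A : dfin s A -> 0 <= dcontent s A.
Proof. by move=> fA; apply: dcontent_ge => // w [S _ /dwle_ge0]. Qed.

Lemma dcover_sub s A B v : A `<=` B -> dcover s B v -> dcover s A v.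
Proof. by move=> AB [S BS Sv]; exists S => //; apply: subset_trans BS. Qed.

Lemma dfin_sub s A B : A `<=` B -> dfin s B -> dfin s A.
Proof. by move=> AB [v /(dcover_sub AB)]; exists v. Qed.

Lemma dcontent_le s A B : A `<=` B -> dfin s B -> dcontent s A <= dcontent s B.
Proof.
by move=> AB fB; apply: dcontent_ge => // w /(dcover_sub AB) /dcontent_lb.
Qed.

Lemma dcontent_near s A e : dfin s A -> 0 < e -> dcover s A (dcontent s A + e).
Proof.
move=> fA e0.
have /inf_adherent : has_inf [set v | dcover s A v].
  by split => //; exists 0 => w [S _ /dwle_ge0].
move=> /(_ _ e0) [v [S AS Sv] lt]; exists S => //; apply: dwleW Sv; exact: ltW.
Qed.

(* Non-maximal members and members common to both families still cover A:
   this is strong subadditivity of the content. *)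
Lemma dmax_weight s A U V u v : dfin s A -> A `<=` dunion U -> A `<=` dunion V ->
  dwle s U u -> dwle s V v -> dwle s (dmax (U `|` V)) (u + v - dcontent s A).
Proof.
move=> fA AU AV Uu Vv F1 uF1 F1m.
pose W := (U `|` V) `\` dmax (U `|` V) `|` (U `&` V).
(* A point lies in a square of [U] and in one of [V]. Equal squares are common to both families;
   otherwise the finer one is not maximal. *)
have AW : A `<=` dunion W.
  move=> x Ax; have [q Uq qx] := AU x Ax; have [q' Vq' q'x] := AV x Ax.
  have [e|/eqP ne] := pselect (q.1 = q'.1).
    by exists q => //; right; split => //; rewrite (dcube_eq qx q'x e).
  wlog : U V q q' Uq Vq' qx q'x ne {AU AV Uu Vv F1m} @W / (q.1 < q'.1)%N.
    move=> wl; have /orP[lt|lt] : (q.1 < q'.1)%N || (q'.1 < q.1)%N.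
    - by rewrite -neq_ltn.
    - exact: (wl U V q q').
    - by rewrite /W (setUC U) (setIC U); apply: (wl V U q' q) => //; rewrite eq_sym.
  move=> lt; exists q' => //; left; split; first by right.
  move=> mq'; have := dmax_min mq' q'x (or_introl Uq) qx.
  by rewrite leqNgt lt.
(* A square in both lists is maximal, so it belongs to [W] only as a member of [U] and [V]; it is
   counted twice on the right as well. *)
have key F2 : uniq F2 -> (forall q, q \in F2 -> W q) ->
    \sum_(q <- F1) dwt s q + \sum_(q <- F2) dwt s q <= u + v.
  move=> uF2 F2W; pose F := undup (F1 ++ F2).
  have sub (G : seq dyadic) : uniq G -> {subset G <= F} ->
      \sum_(q <- G) dwt s q = \sum_(q <- F) (if q \in G then dwt s q else 0).
    move=> uG GF; rewrite -big_mkcond -[in RHS]big_filter; apply: perm_big.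
    apply: uniq_perm => //; first by rewrite filter_uniq // undup_uniq.
    by move=> q; rewrite mem_filter; case: (boolP (q \in G)) => //= /GF ->.
  rewrite (sub F1) // ?(sub F2) //; last 2 first.
  - by move=> q qF; rewrite mem_undup mem_cat qF orbT.
  - by move=> q qF; rewrite mem_undup mem_cat qF.
  have fil (S : set dyadic) w : dwle s S w ->
      \sum_(q <- F) (if `[< S q >] then dwt s q else 0) <= w.
    move=> Sw; rewrite -big_mkcond -big_filter; apply: Sw.
      by rewrite filter_uniq // undup_uniq.
    by move=> q; rewrite mem_filter => /andP[/asboolP].
  apply: le_trans (lerD (fil _ _ Uu) (fil _ _ Vv)); rewrite -!big_split /=.
  apply: ler_sum => q _; have p0 := dwt_ge0 s q.
  case: (boolP (q \in F1)) => [/F1m mq|_].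
    case: (boolP (q \in F2)) => [/F2W [[_ /(_ mq)//]|[Uq Vq]]|_].
      by rewrite !asboolT.
    by case: mq => [] [Uq|Vq] _; rewrite (asboolT Uq) || rewrite (asboolT Vq);
      case: ifP => _; lra.
  case: (boolP (q \in F2)) => [/F2W [[[Uq|Vq] _]|[Uq Vq]]|_];
    rewrite ?(asboolT Uq) ?(asboolT Vq); by do ?case: ifP => _; lra.
rewrite lerBrDl -lerBrDr; apply: dcontent_lb; exists W => // F2 uF2 F2W.
by rewrite lerBrDl; exact: key.
Qed.


Lemma dcover_setU s A B a b : dcover s A a -> dcover s B b -> dcover s (A `|` B) (a + b).
Proof.
move=> [S AS Sa] [T BT Tb]; exists (S `|` T).
  by move=> x [/AS[q Sq qx]|/BT[q Tq qx]]; exists q => //; [left|right].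
move=> F uF FST; rewrite (bigID (fun q => `[< S q >])) /= -[X in X + _]big_filter -[X in _ + X]big_filter.
apply: lerD; [apply: Sa|apply: Tb]; rewrite ?filter_uniq // => q;
  rewrite mem_filter => /andP[]; first by move=> /asboolP.
by move=> /asboolP nS /FST [].
Qed.

Lemma dwle0 s : dwle s set0 0.
Proof. by move=> [|q F] _ FS; [rewrite big_nil|case: (FS q (mem_head _ _))]. Qed.

Lemma dcover_seq s (l : seq dyadic) :
  dcover s [set x | exists2 q, q \in l & dcube q x] (\sum_(q <- l) dwt s q).
Proof.
elim: l => [|q l IH].
  rewrite big_nil; exists set0 => [x [q]|]; [by rewrite in_nil|exact: dwle0].
rewrite big_cons; have : dcover s (dcube q) (dwt s q).
  exists [set q]; first by move=> x qx; exists q.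
  move=> F uF Fq; have : {subset F <= [:: q]} by move=> q' /Fq ->; rewrite mem_head.
  move=> /(uniq_leq_size uF).
  case: F uF Fq => [|q1 [|]] //= _ Fq _; first by rewrite big_nil dwt_ge0.
  by rewrite big_seq1 (Fq q1) ?mem_head.
move=> /dcover_setU /(_ IH); apply: dcover_sub => x [q' ].
by rewrite in_cons => /orP[/eqP ->|q'l] q'x; [left|right; exists q'].
Qed.

Definition dnull s A := forall e, 0 < e -> dcover s A e.

Lemma dnull_fin s A : dnull s A -> dfin s A.
Proof. by move=> /(_ 1 ltr01); exists 1. Qed.

Lemma dnullP s A : dfin s A -> dnull s A <-> dcontent s A = 0.
Proof.
move=> fA; split=> [nA|A0 e e0].
  apply/eqP; rewrite eq_le dcontent_ge0 // andbT.
  by apply/ler_addgt0Pr => e e0; rewrite add0r; apply/dcontent_lb/nA.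
by have := dcontent_near fA e0; rewrite A0 add0r.
Qed.

Lemma dnull_sub s A B : A `<=` B -> dnull s B -> dnull s A.
Proof. by move=> AB nB e /nB; apply: dcover_sub. Qed.

Lemma dnullU s A B : dnull s A -> dnull s B -> dnull s (A `|` B).
Proof.
move=> nA nB e e0; have e2 : 0 < e / 2 by lra.
by have := dcover_setU (nA _ e2) (nB _ e2); rewrite -splitr.
Qed.

(* Coarsening: passing from V_n to the maximal squares of V_n and U_(n+1), each
   point eventually lies in a fixed square. *)
Section increasing.
Variables (s e : R) (A : (set pt)^nat) (U : (set dyadic)^nat).
Hypotheses (finA : forall n, dfin s (A n)) (incA : forall n, A n `<=` A n.+1).
Hypothesis e0 : 0 < e.
Hypothesis AU : forall n, A n `<=` dunion (U n).
Hypothesis wU : forall n, dwle s (U n) (dcontent s (A n) + e * (2^-1) ^+ n.+1).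

Fixpoint coarsen n : set dyadic :=
  if n is m.+1 then dmax (coarsen m `|` U m.+1) else dmax (U 0%N).

Lemma coarsen_sub n : dunion (coarsen n) `<=` dunion (coarsen n.+1).
Proof. by rewrite /= dunion_dmax => x [q qn qx]; exists q => //; left. Qed.

Lemma coarsen_subU n : dunion (U n) `<=` dunion (coarsen n).
Proof.
by case: n => [|n] /=; rewrite dunion_dmax // => x [q qn qx]; exists q => //; right.
Qed.

(** [coarsen n] and [U n.+1] both cover [A n], so [dmax_weight] gives back one content of [A n];
    only the errors accumulate, and they sum to less than [e]. *)
Lemma coarsen_weight n :
  dwle s (coarsen n) (dcontent s (A n) + e * (1 - (2^-1) ^+ n.+1)).
Proof.
elim: n => [|n IH] /=.
  apply: (dwleS (S' := U 0%N)); first by move=> q [].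
  by have := @wU 0%N; rewrite expr1; apply: dwleW; lra.
have An : A n `<=` dunion (coarsen n) by move=> x /AU; apply: coarsen_subU.
have := dmax_weight (finA n) An (subset_trans (@incA n) (@AU n.+1)) IH (@wU n.+1).
apply: dwleW; rewrite (exprS _ n.+1); lra.
Qed.

Lemma coarsen_min n q q' x : coarsen n q -> coarsen n.+1 q' -> dcube q x ->
  dcube q' x -> (q'.1 <= q.1)%N.
Proof. by move=> qn q'n qx q'x; apply: (dmax_min q'n q'x _ qx); left. Qed.

Lemma coarsen_cover L : (forall n, dcontent s (A n) <= L) ->
  dcover s (\bigcup_n A n) (L + e).
Proof.
(* The limit family consists of the squares that belong to [coarsen m] from some stage on. *)
move=> AL; exists [set q | exists n, forall m, (n <= m)%N -> coarsen m q].
  move=> x [n0 _ An0x].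
  have cov m : (n0 <= m)%N -> exists2 q, coarsen m q & dcube q x.
    move=> /subnKC <-; elim: (m - n0)%N => [|k IH].
      by rewrite addn0; apply: coarsen_subU; apply: AU.
    by rewrite addnS; apply: coarsen_sub; apply: IH.
  (* The coarsest generation reached at [x] after stage [n0]. The square at [x] can only grow, so
     from there on it is constant. *)
  pose P g := `[< exists m q, [/\ (n0 <= m)%N, coarsen m q, dcube q x & q.1 = g] >].
  have exP : exists g, P g.
    have [q qn qx] := cov n0 (leqnn _).
    by exists q.1; apply/asboolP; exists n0, q.
  case: (ex_minnP exP) => g /asboolP[m [q [nm mq qx qg]]] ming.
  exists q => //; exists m => k /subnKC <-; elim: (k - m)%N => [|i IH].
    by rewrite addn0.
  have n0mi : (n0 <= (m + i).+1)%N by lia.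
  have [q' mq' q'x] := cov _ n0mi.
  rewrite addnS; suff -> : q = q' by [].
  apply: (dcube_eq qx q'x); apply/eqP; rewrite eqn_leq (coarsen_min IH mq' qx q'x) andbT.
  rewrite qg; apply: ming; apply/asboolP.
  by exists (m + i).+1, q'.
move=> F uF Fl.
(* Finitely many surviving squares lie together in one [coarsen n], whose weight is bounded. *)
have [n Fn] : exists n, forall m, (n <= m)%N -> forall q, q \in F -> coarsen m q.
  elim: F Fl {uF} => [|q F IH] Fl; first by exists 0%N.
  have [n1 hn1] := Fl q (mem_head _ _).
  have [q' q'F|n2 hn2] := IH; first by apply: Fl; rewrite in_cons q'F orbT.
  exists (maxn n1 n2) => m; rewrite geq_max => /andP[m1 m2] q'.
  by rewrite in_cons => /orP[/eqP ->|]; [apply: hn1|apply: hn2].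
apply: le_trans (coarsen_weight uF (Fn n (leqnn n))) _; apply: lerD => //.
by rewrite ger_pMr // gerBl exprn_ge0.
Qed.
End increasing.

(** Continuity from below for arbitrary increasing sets: covers optimal up to [e 2^-(n+1)] are
    coarsened into one limit cover. Capacitability rests on this. *)
Lemma dcontent_bigcup s (A : (set pt)^nat) L : (forall n, dfin s (A n)) ->
  (forall n, A n `<=` A n.+1) -> (forall n, dcontent s (A n) <= L) ->
  dfin s (\bigcup_n A n) /\ dcontent s (\bigcup_n A n) <= L.
Proof.
move=> finA incA AL.
have key e : 0 < e -> dcover s (\bigcup_n A n) (L + e).
  move=> e0.
  have ex n : exists S, A n `<=` dunion S /\
      dwle s S (dcontent s (A n) + e * (2^-1) ^+ n.+1).
    have e'0 : 0 < e * (2^-1) ^+ n.+1 by rewrite mulr_gt0 // exprn_gt0.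
    by have [S AS Sw] := dcontent_near (finA n) e'0; exists S.
  have [U hU] := choice ex.
  by apply: (coarsen_cover (U := U)) => // n; have [] := hU n.
split; first by exists (L + 1); apply: key.
by apply/ler_addgt0Pr => e /key /dcontent_lb.
Qed.

Lemma dnull_bigcup s (A : (set pt)^nat) : (forall n, dnull s (A n)) ->
  dnull s (\bigcup_n A n).
Proof.
move=> nA.
pose B n := \bigcup_(i in [set i | (i <= n)%N]) A i.
have nB n : dnull s (B n).
  elim: n => [|n IH].
    by apply: dnull_sub (nA 0%N) => x [i /=]; rewrite leqn0 => /eqP ->.
  apply: dnull_sub (dnullU IH (nA n.+1)) => x [i /=].
  by rewrite leq_eqVlt => /orP[/eqP -> //|in1] Ax; [right|left; exists i].
have fB n := dnull_fin (nB n).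
have [||fU U0] := @dcontent_bigcup s B 0 fB.
- by move=> n x [i /= ni Ax]; exists i => //=; apply: leqW.
- by move=> n; move/dnullP: (nB n) => ->.
have nU : dnull s (\bigcup_n B n).
  by apply/dnullP => //; apply/eqP; rewrite eq_le U0 dcontent_ge0.
by apply: dnull_sub nU => x [i _ Ax]; exists i => //; exists i => /=.
Qed.

Lemma dnull_bigcup_count (I : countType) s (A : I -> set pt) :
  (forall i, dnull s (A i)) -> dnull s (\bigcup_i A i).
Proof.
move=> nA.
have : dnull s (\bigcup_n (if unpickle n is Some i then A i else set0)).
  apply: dnull_bigcup => n; case: unpickle => [i|]; first exact: nA.
  by move=> e e0; exists set0 => //; apply: dwleW (ltW e0) (dwle0 s).
by apply: dnull_sub => x [i _ Ax]; exists (pickle i) => //; rewrite pickleK.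
Qed.

(** The 3 by 3 block around [q]; it contains every sup-norm ball of radius [2^-g] centred in [q]. *)
Definition dnbrs (q : dyadic) : seq dyadic :=
  [seq (q.1, (q.2.1 + i, q.2.2 + j)) | i <- [:: -1; 0; 1], j <- [:: -1; 0; 1]].

Lemma size_dnbrs q : size (dnbrs q) = 9%N.
Proof. by []. Qed.

Lemma floor_near (a b : R) : `|a - b| <= 1 ->
  Num.floor a - Num.floor b \in [:: -1; 0; 1].
Proof.
move=> ab; have h1 := floor_itv a; have h2 := floor_itv b.
move: h1 h2 ab => /andP[h1 h1'] /andP[h2 h2']; rewrite ler_norml => /andP[l1 l2].
have : ((Num.floor a)%:~R < (Num.floor b + 2)%:~R :> R) by rewrite intrD; lra.
have : ((Num.floor b)%:~R < (Num.floor a + 2)%:~R :> R) by rewrite intrD; lra.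
by rewrite !ltr_int !inE; lia.
Qed.

Lemma coord_le (u : pt) i : `|u 0 i| <= `|u|.
Proof.
rewrite [leRHS]mx_normrE; apply: le_trans (le_bigmax _ _ (0, i)) => //=.
Qed.

Lemma norm_coord (u : pt) r : 0 <= r -> `|u 0 0| <= r -> `|u 0 1| <= r -> `|u| <= r.
Proof.
move=> r0 u0 u1; rewrite [leLHS]mx_normrE; apply: bigmax_le => // -[i j] _ /=.
rewrite ord1; case: j => -[|[|//]] lj.
  by rewrite (_ : Ordinal lj = 0) //; apply: val_inj.
by rewrite (_ : Ordinal lj = 1) //; apply: val_inj.
Qed.

Lemma dnbrsP g x y : `|y - x| <= (2^-1) ^+ g ->
  exists2 q, q \in dnbrs (dyof g x) & dcube q y.
Proof.
move=> xy; exists (dyof g y); last exact: dcube_dyof.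
have key i : Num.floor (2 ^+ g * y 0 i) - Num.floor (2 ^+ g * x 0 i) \in [:: -1; 0; 1].
  apply: floor_near; rewrite -mulrBr normrM ger0_norm ?exprn_ge0 //.
  rewrite -ler_pdivlMl ?exprn_gt0 // mulr1 -exprVn.
  by apply: le_trans xy; have := coord_le (y - x) i; rewrite !mxE.
apply/allpairsP; exists (Num.floor (2 ^+ g * y 0 0) - Num.floor (2 ^+ g * x 0 0),
  Num.floor (2 ^+ g * y 0 1) - Num.floor (2 ^+ g * x 0 1)).
by split=> /=; rewrite ?key // !subrKC.
Qed.

Lemma dwt_nbrs s q q' : q' \in dnbrs q -> dwt s q' = dwt s q.
Proof. by move=> /allpairsP[[i j] [_ _ ->]]. Qed.

Lemma sum_dnbrs s q : \sum_(q' <- dnbrs q) dwt s q' = 9 * dwt s q.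
Proof.
rewrite (eq_big_seq (fun=> dwt s q)); last by move=> q' /(dwt_nbrs s).
by rewrite big_const_seq count_predT size_dnbrs iter_addr_0 mulr_natl.
Qed.

Lemma dcover_ball s g x : dcover s [set y | `|y - x| <= (2^-1) ^+ g] (9 * dwt s (dyof g x)).
Proof.
rewrite -sum_dnbrs; apply: dcover_sub (dcover_seq s _) => y /dnbrsP[q qn qy].
by exists q.
Qed.

End dyadic.

(** * Suslin sets and capacitability *)

Section suslin.
Context {T : topologicalType}.
Implicit Types A : set T.

(** The Souslin operation on closed sets: [x] belongs to [A] when some infinite branch [f] keeps [x]
    in the sets attached to all its initial segments. *)
Definition suslin A := exists F : seq nat -> set T, (forall u, closed (F u)) /\
  A = [set x | exists f : nat -> nat, forall n, F (mkseq f n) x].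

Lemma suslin_closed A : closed A -> suslin A.
Proof.
move=> cA; exists (fun=> A); split => //; by apply/seteqP; split=> [x Ax|x [f /(_ 0%N)]] //; exists (fun=> 0%N).
Qed.

Lemma mkseq_behead (f : nat -> nat) n :
  mkseq f n.+1 = f 0%N :: mkseq (fun i => f i.+1) n.
Proof. by rewrite /mkseq /= (iotaDl 1 0) -map_comp. Qed.

(** The first entry of a branch selects the member of the union, the remaining entries are a branch
    for that member. *)
Lemma suslin_bigcup (A : (set T)^nat) : (forall i, suslin (A i)) ->
  suslin (\bigcup_i A i).
Proof.
move=> /choice[F hF].
exists (fun u => if u is i :: v then F i v else setT); split.
  by case=> [|i v]; [exact: closedT|have [] := hF i].
apply/seteqP; split=> [x [i _]|x [f hf]].
  rewrite (hF i).2 => -[f hf]; exists (fun n => if n is m.+1 then f m else i).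
  by case=> [|n] //; rewrite mkseq_behead.
exists (f 0%N) => //; rewrite (hF _).2; exists (fun i => f i.+1) => n.
suff -> : mkseq (fun i => f i.+1) n = behead (mkseq f n.+1) by exact: (hf n.+1).
by rewrite (mkseq_behead f n).
Qed.

(* A sequence codes countably many sequences through a pairing function. *)
Lemma suslin_bigcap (A : (set T)^nat) : (forall i, suslin (A i)) ->
  suslin (\bigcap_i A i).
Proof.
move=> /choice[F hF]; pose row (u : nat -> nat) (i l : nat) : nat := u (pickle (i, l)).
(* A prefix [u] imposes exactly the conditions [(i, n)] for which all codes of the first [n] entries
   of row [i] are below [size u]. *)
pose G u := \bigcap_(p in [set p : nat * nat |
    forall l, (l < p.2)%N -> (pickle (p.1, l) < size u)%N])
  F p.1 (mkseq (row (nth 0%N u) p.1) p.2).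
exists G; split; first by move=> u; apply: closed_bigI => p _; have [] := hF p.1.
apply/seteqP; split=> [x Ax|x [f hf] i _].
  have : forall i, exists f, forall n, F i (mkseq f n) x.
    by move=> i; have := Ax i I; rewrite (hF i).2.
  move=> /choice[f hf].
  exists (fun k => if unpickle k is Some p then f p.1 p.2 else 0%N) => N [i n] /= lp.
  rewrite (_ : mkseq _ _ = mkseq (f i) n) //; apply/eq_in_map => l.
  by rewrite mem_iota /row /= add0n => ln; rewrite nth_mkseq ?pickleK //; have := lp l ln; rewrite size_mkseq.
rewrite (hF i).2; exists (row f i) => n.
have [N hN] : exists N, forall l, (l < n)%N -> (pickle (i, l) < N)%N.
  exists (\max_(l < n) pickle (i, l : nat)).+1 => l ln; rewrite ltnS.
  exact: (leq_bigmax (Ordinal ln)).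
have := hf N (i, n); rewrite /G /= => /(_ _)/= h.
rewrite (_ : mkseq _ _ = mkseq (row (nth 0%N (mkseq f N)) i) n); last first.
  by apply/eq_in_map => l; rewrite mem_iota /row add0n /= => /hN lN; rewrite nth_mkseq.
by apply: h => l /hN; rewrite size_mkseq.
Qed.

End suslin.

(** * Borel sets are Suslin, and Suslin sets are capacitable *)

Section capacity.
Context {R : realType}.
Local Notation pt := 'rV[R]_2.
Implicit Types (x y z : pt) (s : R) (A B : set pt).

(** An open set is a countable union of closed sets: the points whose ball of radius [1 / (n + 1)]
    stays in [A]. *)
Lemma suslin_open A : open A -> suslin A.
Proof.
move=> oA.
have -> : A = \bigcup_n [set x | ball x (n.+1%:R^-1) `<=` A].
  apply/seteqP; split=> [x Ax|x [n _]]; last by apply; apply: ballxx; rewrite invr_gt0.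
  have /nbhs_ballP[e /= e0 eA] := open_nbhs_nbhs (conj oA Ax).
  have [n _ q] := near_infty_natSinv_lt (PosNum e0).
  exists n => //= y xy; apply: eA; apply: le_ball xy; apply/ltW.
  exact: (q n (leqnn n)).
apply: suslin_bigcup => n; apply: suslin_closed; rewrite -openC.
rewrite openE => x /= /existsNP[y /not_implyP[xy Ay]].
rewrite /interior; have : nbhs x (ball y n.+1%:R^-1).
  apply: open_nbhs_nbhs; split; [exact: ball_open|exact: ball_sym].
apply: filterS => z zy /(_ y) h; apply: Ay; apply: h; exact: ball_sym.
Qed.

(** Suslin sets need not be stable under complement; the sets that are Suslin together with their
    complement form a sigma-algebra containing the open sets. *)
Lemma suslin_borel A : borel_set A -> suslin A.
Proof.
pose C : set (set pt) := [set B | suslin B /\ suslin (~` B)].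
suff : <<s [set U : set pt | open U] >> `<=` C by move=> h /h[].
apply: smallest_sub => [|U /= oU]; last first.
  by split; [apply: suslin_open|apply: suslin_closed; rewrite closedC].
split=> /=.
- by split; apply: suslin_closed; rewrite ?setC0; [exact: closed0|exact: closedT].
- by move=> B [sB sCB]; rewrite setTD; split; rewrite ?setCK.
- move=> B hB; split; first by apply: suslin_bigcup => n; case: (hB n).
  by rewrite setC_bigcup; apply: suslin_bigcap => n; case: (hB n).
Qed.

Definition dshift (p : int * int) (q : dyadic) : dyadic :=
  (q.1, (q.2.1 + p.1, q.2.2 + p.2)).

(** The enlarged family is covered by nine translates of [S], each of the same weight. *)
Lemma dwle_nbrs s S v : dwle s S v ->
  dwle s [set q | exists2 q', S q' & q \in dnbrs q'] (9 * v).
Proof.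
move=> Sv F uF FS.
pose l : seq (int * int) := [seq (i, j) | i <- [:: -1; 0; 1], j <- [:: -1; 0; 1]].
have key q : q \in F -> exists2 p, p \in l & S (dshift p q).
  move=> /FS[q' Sq' /allpairsP[[i j] /= [il jl ->]]].
  exists (- i, - j); last by rewrite /dshift /= !addrK -surjective_pairing; case: q' Sq' => a [].
  apply/allpairsP; exists (- i, - j); split => //=; move: il jl; rewrite !inE; lia.
apply: (@le_trans _ _ (\sum_(q <- F) \sum_(p <- l) if `[< S (dshift p q) >] then dwt s q else 0)).
  rewrite big_seq [leRHS]big_seq; apply: ler_sum => q qF; have [p pl Sp] := key q qF.
  rewrite (big_rem p) //= asboolT // lerDl sumr_ge0 // => p' _.
  by case: ifP => // _; rewrite dwt_ge0.
rewrite exchange_big /=.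
have -> : 9 * v = \sum_(p <- l) v.
  by rewrite big_const_seq count_predT iter_addr_0 mulr_natl.
apply: ler_sum => p _; rewrite -big_mkcond -big_filter.
rewrite (eq_bigr (fun q => dwt s (dshift p q))) //.
rewrite -(big_map (dshift p) predT (dwt s)); apply: Sv.
  rewrite map_inj_uniq ?filter_uniq // => -[a [b c]] [a' [b' c']].
  by rewrite /dshift /= => -[-> /addIr -> /addIr ->].
by move=> q' /mapP[q]; rewrite mem_filter => /andP[/asboolP Sq _] ->.
Qed.

Section tree.
Variables (F : seq nat -> set pt) (N : nat -> nat).
Hypothesis cF : forall u, closed (F u).

(** Points that stay in [F] along some [k] further indices, each bounded by [N] at its position.
    Only finite unions occur, which keeps the set closed. *)
Fixpoint tree k u : set pt := F u `&`
  (if k is k'.+1 then \bigcup_(i in [set i | (i <= N (size u))%N]) tree k' (rcons u i)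
   else setT).

Lemma closed_tree k u : closed (tree k u).
Proof.
elim: k u => [|k IH] u /=; first by rewrite setIT.
apply: closedI => //; apply: closed_bigcup => //; exact: (finite_II (N (size u)).+1).
Qed.

Lemma tree_anti k k' u : (k <= k')%N -> tree k' u `<=` tree k u.
Proof.
elim: k k' u => [|k IH] [|k'] u //=.
- by move=> _.
- by move=> _ x [Fx _]; exact: (conj Fx I).
- by move=> kk x [Fx [i iN tx]]; split=> //; exists i => //; exact: (IH _ _ kk _ tx).
Qed.

(** König's argument: if each of the finitely many children failed at some depth, the node would
    fail one level below the largest of these depths. *)
Lemma tree_step u x : (forall k, tree k u x) ->
  exists i, forall k, tree k (rcons u i) x.
Proof.
move=> tu; apply: contrapT => /forallNP no.
have /choice[f hf] : forall i, exists k, ~ tree k (rcons u i) x.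
  by move=> i; apply/existsNP.
pose M := (\max_(i < (N (size u)).+1) f i)%N.
have [_ [i /= iN ti]] := tu M.+1.
apply: (hf i); apply: tree_anti ti.
exact: (@leq_bigmax _ (fun i : 'I_(N (size u)).+1 => f i) (Ordinal (iN : (i < (N (size u)).+1)%N))).
Qed.

Lemma tree_branch x : (forall k, tree k [::] x) ->
  exists f, forall n, F (mkseq f n) x.
Proof.
move=> t0.
have /choice[g hg] : forall u, exists i, (forall k, tree k u x) -> forall k, tree k (rcons u i) x.
  move=> u; have [/tree_step[i hi]|no] := pselect (forall k, tree k u x); first by exists i.
  by exists 0%N.
pose fix br n := if n is m.+1 then rcons (br m) (g (br m)) else [::].
exists (fun n => g (br n)) => n.
have -> : mkseq (fun n => g (br n)) n = br n.
  by elim: n => //= n IH; rewrite mkseqS IH.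
suff : forall k, tree k (br n) x by move=> /(_ 0%N) [].
by elim: n => //= n; apply: hg.
Qed.

Lemma tree_sub f x : (forall n, F (mkseq f n) x) -> forall k j,
  (forall i, (i < j + k)%N -> (f i <= N i)%N) -> tree k (mkseq f j) x.
Proof.
move=> hf; elim=> [|k IH] j lefN /=; first by split.
split=> //; exists (f j); first by rewrite /= size_mkseq lefN //; lia.
by rewrite -mkseqS; apply: IH => i; rewrite addSnnS; apply: lefN.
Qed.
End tree.

(* Choquet's argument: the bounds N i are chosen one at a time so that the points of
   A having a branch bounded by N up to level k still have content > v; the compact
   sets B `&` tree F N k [::] containing them decrease to P. *)
Lemma suslin_compact s A B : suslin A -> A `<=` B -> compact B -> dfin s B ->
  ~ dnull s A -> exists P, [/\ compact P, P `<=` A & ~ dnull s P].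
Proof.
move=> [F [cF AE]] AB cB fB nA.
have fin D : D `<=` A -> dfin s D.
  by move=> DA; apply: dfin_sub fB; apply: subset_trans AB.
have A0 : 0 < dcontent s A.
  rewrite lt_neqAle dcontent_ge0 ?andbT; last exact: fin.
  by apply/eqP => /esym /(dnullP (fin _ (@subset_refl _ A))).
pose v := dcontent s A / 2; have vA : v < dcontent s A by rewrite /v; lra.
(* Only the entries up to [size u] are bounded; the rest of the branch is free. *)
pose D u := [set x | exists f, (forall i, (i < size u)%N -> (f i <= nth 0 u i)%N) /\
  forall n, F (mkseq f n) x].
have DA u : D u `<=` A by rewrite AE => x [f [_ hf]]; exists f.
(* [D u] is the increasing union over [i] of [D (rcons u i)], so by continuity from below some bound
   [i] keeps the content above [v]. *)
have /choice[g hg] : forall u, exists i, v < dcontent s (D u) ->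
    v < dcontent s (D (rcons u i)).
  move=> u; apply: contrapT => /forallNP no.
  have vu : v < dcontent s (D u) by have /not_implyP[] := no 0%N.
  have le i : dcontent s (D (rcons u i)) <= v.
    by have /not_implyP[_ /negP] := no i; rewrite -leNgt.
  have [||fU U] := dcontent_bigcup _ _ le.
  - by move=> i; apply: fin.
  - move=> i x [f [lef hf]]; exists f; split=> // j; rewrite size_rcons => ju.
    have := lef j; rewrite size_rcons !nth_rcons => /(_ ju).
    by case: ifP => //; case: ifP => // _ _ /leqW.
  - move: vu; rewrite ltNge => /negP; apply; apply: le_trans U.
    apply: (dcontent_le _ fU) => x [f [lef hf]]; exists (f (size u)) => //.
    exists f; split=> // j; rewrite size_rcons ltnS leq_eqVlt nth_rcons.
    by move=> /orP[/eqP ->|ju]; rewrite ?ltnn ?eqxx // ju lef.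
pose fix br n := if n is m.+1 then rcons (br m) (g (br m)) else [::].
pose N n := g (br n).
have brE n : br n = mkseq N n by elim: n => //= n IH; rewrite mkseqS -IH.
have Dbr n : v < dcontent s (D (br n)).
  elim: n => /= [|n IH]; last exact: hg.
  apply: lt_le_trans vA _; apply: dcontent_le; last exact: fin.
  by rewrite AE => x [f hf]; exists f.
pose P := B `&` \bigcap_k tree F N k [::].
have clP : closed P.
  apply: closedI; first exact: compact_closed.
  by apply: closed_bigI => k _; apply: closed_tree.
exists P; split.
- by apply: (subclosed_compact clP cB) => x [].
- rewrite AE => x [_ Tx]; apply: (@tree_branch F N) => k; exact: (Tx k I).
(* The 10 exceeds the nine neighbours of a square: a cover of [P] of weight [v / 10] will yield one
   of [D (br k0)] of weight [9 v / 10 < v]. *)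
move=> nP; have v10 : 0 < v / 10 by rewrite /v; lra.
have [S PS Sv] := nP _ v10.
pose O : set pt := \bigcup_(q in S) \bigcup_(x in dcube q) ball x ((2^-1) ^+ q.1 : R).
have oO : open O.
  by apply: bigcup_open => q _; apply: bigcup_open => x _; exact: ball_open.
(* Within [B] the closed sets [tree F N k [::]] decrease to [P], which lies in the open set [O]; by
   compactness one of them already lies in [O]. *)
have /compact_near_coveringP/(_ nat \oo (fun k x => tree F N k [::] x -> O x)) := cB.
case=> [x Bx|k0 _ hk0].
  have [Tx|/existsNP[k /not_implyP[_ Tk]]] := pselect ((\bigcap_k tree F N k [::]) x).
    have [q Sq qx] := PS x (conj Bx Tx).
    have nx : nbhs x O.
      apply: open_nbhs_nbhs; split => //; exists q => //; exists x => //.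
      by apply: ballxx; rewrite exprn_gt0.
    by near=> x' k => _; near: x'.
  have nx : nbhs x (~` tree F N k [::]).
    by apply: open_nbhs_nbhs; split => //; rewrite openC; apply: closed_tree.
  near=> x' k' => /= Tk'; exfalso.
  suff : (~` tree F N k [::]) x'.
    by apply; apply: tree_anti Tk'; near: k'; exists k.
  by near: x'.
have /dcontent_lb : dcover s (D (br k0)) (9 * (v / 10)).
  exists [set q | exists2 q', S q' & q \in dnbrs q']; last exact: dwle_nbrs.
  move=> x Dx; have : O x.
    apply: (hk0 k0) => /=; [by []|by apply: AB; apply: DA Dx|].
    have [f [lef hf]] := Dx; apply: (@tree_sub F N f x hf k0 0%N) => i; rewrite add0n => ik.
    by have := lef i; rewrite brE size_mkseq nth_mkseq // => /(_ ik).
  move=> [q Sq [z zq]]; rewrite -ball_normE /= => zx.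
  have [|q' q'n q'x] := @dnbrsP _ q.1 z x; first by rewrite distrC ltW.
  by exists q' => //; exists q => //; move: q'n; rewrite zq.
have := Dbr k0; rewrite /v; lra.
Unshelve. all: by end_near.
Qed.

End capacity.

(** * Discrete Frostman measures *)

Section weighted.
Context {R : realType}.
Local Notation pt := 'rV[R]_2.
Local Notation wpts := (seq (R * pt)).
Implicit Types (x y z : pt) (s : R) (A B : set pt) (L : wpts).

(* Finitely supported measures are lists of (mass, point). *)
Definition integ L (f : pt -> R) : R := \sum_(z <- L) z.1 * f z.2.
Definition mass L A : R := integ L (\1_A).
Definition tmass L : R := integ L (fun=> 1).
Definition wmeas A L := forall z : R * pt, z \in L -> 0 <= z.1 /\ A z.2.
(** Since point masses have no decay at small scales, the Frostman condition is imposed down to side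
    [2^-m] only. *)
Definition frost s m L := forall q : dyadic, (q.1 <= m)%N -> mass L (dcube q) <= dwt s q.

Lemma wmeasS A B L : A `<=` B -> wmeas A L -> wmeas B L.
Proof. by move=> AB wL z /wL[z0 Az]; split=> //; apply: AB. Qed.

Lemma integ_le A L f g : wmeas A L -> (forall x, A x -> f x <= g x) ->
  integ L f <= integ L g.
Proof.
move=> wL fg; rewrite /integ big_seq [leRHS]big_seq; apply: ler_sum => z /wL[z0 Az].
by rewrite ler_wpM2l // fg.
Qed.

Lemma integ_ge0 A L f : wmeas A L -> (forall x, A x -> 0 <= f x) -> 0 <= integ L f.
Proof.
move=> wL f0; rewrite /integ big_seq; apply: sumr_ge0 => z /wL[z0 Az].
by rewrite mulr_ge0 // f0.
Qed.

Lemma integD L f g : integ L (fun x => f x + g x) = integ L f + integ L g.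
Proof. by rewrite /integ -big_split; apply: eq_bigr => z _; rewrite mulrDr. Qed.

Lemma integM L c f : integ L (fun x => c * f x) = c * integ L f.
Proof. by rewrite /integ mulr_sumr; apply: eq_bigr => z _; rewrite mulrCA. Qed.

Lemma integ_sum L (I : Type) (r : seq I) (f : I -> pt -> R) :
  integ L (fun x => \sum_(i <- r) f i x) = \sum_(i <- r) integ L (f i).
Proof.
rewrite /integ exchange_big /=; apply: eq_bigr => z _; exact: mulr_sumr.
Qed.

Lemma eq_integ L f g : f =1 g -> integ L f = integ L g.
Proof. by move=> fg; apply: eq_bigr => z _; rewrite fg. Qed.

Lemma integ_swap L L' (f : pt -> pt -> R) :
  integ L (fun x => integ L' (f x)) = integ L' (fun y => integ L (fun x => f x y)).
Proof.
rewrite /integ.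
under eq_bigr do rewrite mulr_sumr.
under [RHS]eq_bigr do rewrite mulr_sumr.
by rewrite exchange_big /=; apply: eq_bigr => z _; apply: eq_bigr => z' _; rewrite mulrCA.
Qed.

(** The integral of [(f + t g)^2] is a nonnegative polynomial in [t], hence has nonpositive
    discriminant. *)
Lemma integ_cauchy_schwarz A L f g : wmeas A L -> 
  integ L (fun x => f x * g x) ^+ 2 <=
  integ L (fun x => f x ^+ 2) * integ L (fun x => g x ^+ 2).
Proof.
move=> wL; set a := integ L (fun x => f x ^+ 2); set c := integ L (fun x => g x ^+ 2).
set b := integ L _.
have q t : 0 <= a + t * (2 * b) + t ^+ 2 * c.
  rewrite -!integM -!integD; apply: (integ_ge0 wL) => x _.
  by rewrite (_ : _ + _ = (f x + t * g x) ^+ 2) ?sqr_ge0 //; ring.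
have c0 : 0 <= c by apply: (integ_ge0 wL) => x _; rewrite sqr_ge0.
have a0 : 0 <= a by apply: (integ_ge0 wL) => x _; rewrite sqr_ge0.
have [c00|cn0] := eqVneq c 0.
  have b0 : b = 0.
    (* For [c = 0] the polynomial is affine and would take the value -1 here. *)
    apply/eqP/negP => /negP bn0; have := q (- (a + 1) / (2 * b)).
    rewrite c00 mulr0 addr0 divfK; first lra.
    by rewrite mulf_neq0 // pnatr_eq0.
  by rewrite b0 c00 expr0n mulr0.
have := q (- b / c); rewrite -(ler_pM2r (x := c)) ?lt_def ?cn0 // mul0r.
rewrite [X in 0 <= X](_ : _ = a * c - b ^+ 2); first by rewrite subr_ge0.
by field.
Qed.

Lemma indic_le1 A x : \1_A x <= 1 :> R.
Proof. by rewrite indicE; case: (x \in A). Qed.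

Lemma indic_ge0 A x : 0 <= \1_A x :> R.
Proof. by rewrite indicE. Qed.

Lemma indic_in A x : A x -> \1_A x = 1 :> R.
Proof. by move=> Ax; rewrite indicE mem_set. Qed.

Lemma indic_out A x : ~ A x -> \1_A x = 0 :> R.
Proof. by move=> Ax; rewrite indicE memNset. Qed.

Lemma mass_ge0 A L B : wmeas A L -> 0 <= mass L B.
Proof. by move=> wL; apply: (integ_ge0 wL) => x _; exact: indic_ge0. Qed.

Lemma mass_le A L B C : wmeas A L -> (forall x, A x -> B x -> C x) -> mass L B <= mass L C.
Proof.
move=> wL BC; apply: (integ_le wL) => x Ax; have [Bx|Bx] := pselect (B x).
  by rewrite !indic_in //; apply: BC.
by rewrite (indic_out Bx) indic_ge0.
Qed.

Lemma mass_le_tmass A L B : wmeas A L -> mass L B <= tmass L.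
Proof. by move=> wL; apply: (integ_le wL) => x _; exact: indic_le1. Qed.

Lemma mass_bigU A L (I : eqType) (r : seq I) (F : I -> set pt) B : wmeas A L ->
  (forall x, A x -> B x -> exists2 i, i \in r & F i x) ->
  mass L B <= \sum_(i <- r) mass L (F i).
Proof.
move=> wL BF; rewrite -integ_sum; apply: (integ_le wL) => x Ax.
have [Bx|/indic_out ->] := pselect (B x); last by apply: sumr_ge0 => i _; exact: indic_ge0.
have [i ir Fix] := BF x Ax Bx.
rewrite (big_rem i) //= !indic_in // lerDl; apply: sumr_ge0 => j _; exact: indic_ge0.
Qed.

Lemma mass0 A L B : wmeas A L -> (forall x, A x -> ~ B x) -> mass L B = 0.
Proof.
move=> wL nB; apply/eqP; rewrite eq_le (mass_ge0 B wL) andbT.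
by apply: le_trans (mass_bigU (r := [::] : seq unit) (F := fun=> setT) wL _) _ => [x /nB|]; rewrite ?big_nil.
Qed.

(** * Frostman's lemma on the tree of squares *)

Definition dchildren (q : dyadic) : seq dyadic :=
  [seq (q.1.+1, (2 * q.2.1 + i, 2 * q.2.2 + j)) | i <- [:: 0; 1], j <- [:: 0; 1]].

Lemma floor_double (a : R) : exists2 i : int, i \in [:: 0; 1] &
  Num.floor (2 * a) = 2 * Num.floor a + i.
Proof.
exists (Num.floor (2 * a) - 2 * Num.floor a); last lia.
have := floor_itv (2 * a); have := floor_itv a => /andP[h1 h1'] /andP[h2 h2'].
have : ((2 * Num.floor a)%:~R < (Num.floor (2 * a) + 1)%:~R :> R).
  by rewrite intrD intrM; move: h1 h2'; rewrite intrD; lra.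
have : ((Num.floor (2 * a))%:~R < (2 * (Num.floor a) + 2)%:~R :> R).
  by rewrite intrD intrM; move: h1' h2; rewrite intrD; lra.
by rewrite !ltr_int !inE; lia.
Qed.

Lemma dchildrenP q x : dcube q x -> exists2 c, c \in dchildren q & dcube c x.
Proof.
move=> qx; exists (dyof q.1.+1 x) => //.
have [i il ei] := floor_double (2 ^+ q.1 * x 0 0).
have [j jl ej] := floor_double (2 ^+ q.1 * x 0 1).
apply/allpairsP; exists (i, j); split => //=.
rewrite /dyof !exprS -!mulrA ei ej; rewrite -{1}qx /dyof /=.
by rewrite -qx.
Qed.

Lemma dchildren_sub q c x : c \in dchildren q -> dcube c x -> dcube q x.
Proof.
move=> /allpairsP[[i j] /= [il jl ->]] [].
have [i' il' ei] := floor_double (2 ^+ q.1 * x 0 0).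
have [j' jl' ej] := floor_double (2 ^+ q.1 * x 0 1).
rewrite !exprS -!mulrA ei ej => e1 e2; rewrite /dcube /dyof /=.
case: q e1 e2 ei ej il jl il' jl' => g [a b] /= e1 e2 _ _.
rewrite !inE => h1 h2 h3 h4; congr (_, (_, _)); lia.
Qed.

Lemma dchildren_gen q c : c \in dchildren q -> c.1 = q.1.+1.
Proof. by move=> /allpairsP[[i j] [_ _ ->]]. Qed.

Lemma dchildren_uniq q : uniq (dchildren q).
Proof. by rewrite /dchildren /= !inE /= !xpair_eqE; lia. Qed.

Lemma dwt_mono s q q' : 0 <= s -> (q'.1 <= q.1)%N -> dwt s q <= dwt s q'.
Proof.
move=> s0 qq; rewrite /dwt; apply: ler_wiXn2l => //.
rewrite -[leRHS](congr1 (fun f => f s) (powR1 R)); apply: ge0_ler_powR; rewrite ?nnegrE //; lra.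
Qed.

Lemma integ_flatten (I : Type) (r : seq I) (F : I -> wpts) f :
  integ (flatten [seq F i | i <- r]) f = \sum_(i <- r) integ (F i) f.
Proof. by rewrite /integ big_flatten /= big_map. Qed.

Definition wscale (c : R) L : wpts := [seq (c * z.1, z.2) | z : R * pt <- L].

Lemma integ_scale c L f : integ (wscale c L) f = c * integ L f.
Proof. by rewrite /integ big_map mulr_sumr; apply: eq_bigr => z _; rewrite mulrA. Qed.

(* Max-flow min-cut on the tree of dyadic squares: either the masses of the
   children fit into q, or they are scaled down and q itself becomes the cover. *)
Lemma frost_tree s A h q : 0 <= s -> exists L l, [/\ wmeas (A `&` dcube q) L,
  frost s (q.1 + h) L, (forall x, A x -> dcube q x -> exists2 q', q' \in l & dcube q' x) &
  \sum_(q' <- l) dwt s q' <= tmass L].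
Proof.
move=> s0; elim: h q => [|h IH] q.
  (* At depth 0 a point mass [dwt s q] anywhere in [A] and [q] is enough; if there is no such point,
     the zero measure and the empty cover are. *)
  have [[x [Ax qx]]|/forallNP no] := pselect (exists x, A x /\ dcube q x); last first.
    exists [::], [::]; split=> //.
    - by move=> q' _; rewrite /mass /integ big_nil dwt_ge0.
    - by move=> x Ax qx; have [] := no x.
    - by rewrite big_nil /tmass /integ big_nil.
  exists [:: (dwt s q, x)], [:: q]; split.
  - by move=> z; rewrite inE => /eqP -> /=; split; [exact: dwt_ge0|].
  - move=> q'; rewrite addn0 => qq; rewrite /mass /integ big_seq1 /=.
    apply: le_trans (dwt_mono s0 qq); rewrite ler_piMr ?dwt_ge0 //; exact: indic_le1.
  - by move=> y _ qy; exists q => //; rewrite mem_head.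
  - by rewrite big_seq1 /tmass /integ big_seq1 /= mulr1.
have /choice[Lf /choice[lf hf]] := IH.
pose L := flatten [seq Lf c | c <- dchildren q].
have wL : wmeas (A `&` dcube q) L.
  move=> z /flattenP[l' /mapP[c cq ->]] zc; have [wc _ _ _] := hf c.
  have [z0 [Az cz]] := wc z zc; split=> //; split => //; exact: dchildren_sub cz.
have fL q' : (q.1 < q'.1)%N -> (q'.1 <= q.1 + h.+1)%N -> mass L (dcube q') <= dwt s q'.
  move=> qq q'h; rewrite /mass integ_flatten.
  (* A square strictly finer than [q] meets at most one child, so only one [Lf c0] contributes. *)
  have [[c0 [c0q [x [c0x q'x]]]]|no] := pselect (exists c0, c0 \in dchildren q /\
      exists x, dcube c0 x /\ dcube q' x).
    rewrite (bigD1_seq c0) ?dchildren_uniq //=.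
    rewrite [X in _ + X](_ : _ = 0) ?addr0.
      have [_ fc _ _] := hf c0; apply: fc.
      by rewrite (dchildren_gen c0q) addSnnS.
    rewrite big_seq_cond; apply: big1 => c /andP[cq cc0]; have [wc _ _ _] := hf c.
    apply: (mass0 wc) => y [_ cy] q'y; move/eqP: cc0; apply.
    have gc := dchildren_gen cq; have gc0 := dchildren_gen c0q.
    have : dyof q.1.+1 x = dyof q.1.+1 y.
      by apply: (dyof_nest qq); rewrite (q'x : dyof _ _ = _) (q'y : dyof _ _ = _).
    move: c0x cy; rewrite /dcube /= gc gc0 => -> -> //.
  rewrite big_seq big1 ?dwt_ge0 // => c cq; have [wc _ _ _] := hf c.
  by apply: (mass0 wc) => y [_ cy] q'y; apply: no; exists c; split=> //; exists y.
have tL : \sum_(q' <- flatten [seq lf c | c <- dchildren q]) dwt s q' <= tmass L.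
  rewrite big_flatten big_map /tmass integ_flatten; apply: ler_sum => c _.
  by have [] := hf c.
have [le|gt] := leP (tmass L) (dwt s q).
  exists L, (flatten [seq lf c | c <- dchildren q]); split=> //.
  - move=> q' q'h; have [qq|qq] := ltnP q.1 q'.1; first exact: fL.
    by apply: le_trans (mass_le_tmass _ wL) _; apply: le_trans le _; exact: dwt_mono.
  - move=> x Ax /dchildrenP[c cq cx]; have [_ _ cov _] := hf c.
    have [q' q'l q'x] := cov x Ax cx; exists q' => //; apply/flattenP.
    by exists (lf c) => //; apply: map_f.
have tL0 : 0 < tmass L by apply: lt_trans gt; exact: dwt_gt0.
have c0 : 0 <= dwt s q / tmass L by rewrite divr_ge0 ?dwt_ge0 // ltW.
exists (wscale (dwt s q / tmass L) L), [:: q].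
have tE : tmass (wscale (dwt s q / tmass L) L) = dwt s q.
  by rewrite /tmass integ_scale divfK // gt_eqF.
have wE : wmeas (A `&` dcube q) (wscale (dwt s q / tmass L) L).
  by move=> z /mapP[z' /wL[z'0 Az'] ->]; split=> //=; rewrite mulr_ge0.
split=> //.
- move=> q' q'h; have [qq|qq] := ltnP q.1 q'.1; last first.
    by apply: le_trans (mass_le_tmass _ wE) _; rewrite tE; exact: dwt_mono.
  rewrite /mass integ_scale; apply: le_trans (fL q' qq q'h).
  rewrite -[leRHS]mul1r ler_wpM2r ?(mass_ge0 _ wL) //.
  by rewrite ler_pdivrMr // mul1r ltW.
- by move=> x _ qx; exists q => //; rewrite mem_head.
- by rewrite big_seq1 tE.
Qed.

Lemma frostman s A q m : 0 <= s -> q.1 = 0%N ->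
  exists L, [/\ wmeas (A `&` dcube q) L, frost s m L, tmass L <= 1 &
    dcontent s (A `&` dcube q) <= tmass L].
Proof.
move=> s0 q0; have [L [l [wL fL lA lt]]] := frost_tree A m q s0.
exists L; split=> //; first by move: fL; rewrite q0.
  have -> : tmass L = mass L (dcube q).
    rewrite /mass /tmass /integ big_seq [RHS]big_seq; apply: eq_bigr => z /wL[_ [_ qz]].
    by rewrite indic_in.
  by apply: le_trans (fL q _) _; rewrite ?leq_addr // /dwt q0 expr0.
apply: le_trans lt; apply: dcontent_lb; apply: dcover_sub (dcover_seq s l).
by move=> x [Ax qx]; apply: lA.
Qed.

(** Nine squares cover a ball, and rounding its radius up to a power of 1/2 costs [2 ^ s]. *)
Definition frostc s : R := 9 * 2 `^ s.

Lemma frostc_ge1 s : 0 <= s -> 1 <= frostc s.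
Proof.
move=> s0; rewrite /frostc; have : 1 `^ s <= 2 `^ s by apply: ge0_ler_powR; rewrite ?nnegrE //; lra.
rewrite powR1; lra.
Qed.

Lemma frost_ball s A m L x (r : R) : 0 <= s -> wmeas A L -> frost s m L -> tmass L <= 1 ->
  (2^-1) ^+ m <= r -> mass L [set y | `|y - x| <= r] <= frostc s * r `^ s.
Proof.
move=> s0 wL fL tL mr.
have r0 : 0 < r by apply: lt_le_trans mr; rewrite exprn_gt0.
have [r1|r1] := ltP 1 r.
  apply: le_trans (mass_le_tmass _ wL) _; apply: le_trans tL _.
  have := frostc_ge1 s0; have : 1 `^ s <= r `^ s by apply: ge0_ler_powR; rewrite ?nnegrE //; lra.
  rewrite powR1; nra.
(* The finest admissible generation satisfies [2^-g <= 2 r]; when it is [m] itself, this comes from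
   [2^-m <= r]. *)
pose P g := (g <= m)%N && (r <= (2^-1) ^+ g).
have exP : exists g, P g by exists 0%N; rewrite /P expr0.
have [|g /andP[gm rg] gmax] := ex_maxnP exP (m := m); first by move=> g /andP[].
have rg2 : (2^-1) ^+ g <= 2 * r.
  have [e|lt] : g = m \/ (g < m)%N by move: gm; rewrite leq_eqVlt => /orP[/eqP|]; auto.
    by rewrite e; lra.
  have := contraNN (gmax g.+1); rewrite /P ltnn lt /= exprS -ltNge => /(_ isT); lra.
have -> : frostc s * r `^ s = \sum_(q <- dnbrs (dyof g x)) (2 * r) `^ s.
  rewrite big_const_seq count_predT size_dnbrs iter_addr_0 powRM //; last exact: ltW.
  by rewrite -[RHS]mulr_natl /frostc mulrA.
apply: le_trans (mass_bigU (r := dnbrs (dyof g x)) (F := dcube) wL _) _.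
  by move=> y _ /= yx; apply: dnbrsP; apply: le_trans rg.
rewrite big_seq [leRHS]big_seq; apply: ler_sum => q qn.
have qg : q.1 = g by move: qn => /allpairsP[[i j] [_ _ ->]].
apply: le_trans (fL q _) _; first by rewrite qg.
rewrite /dwt qg -powR_mulrn ?powR_ge0 // -powRrM mulrC powRrM powR_mulrn //.
by apply: ge0_ler_powR => //; rewrite nnegrE ?exprn_ge0 //; lra.
Qed.

End weighted.

(** * Tubes and sectors in the plane *)

Section plane.
Context {R : realType}.
Local Notation pt := 'rV[R]_2.
Implicit Types (x y z u v w a b c : pt).

Definition cross u v : R := u 0 0 * v 0 1 - u 0 1 * v 0 0.
(** Twice the signed area of the triangle [x y z]. *)
Definition Delta x y z : R := cross (y - x) (z - x).
(** Strip around the line [x y], of Euclidean half-width [r] divided by the length of [y - x]. Using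
    the area avoids the division and makes the roles of the points symmetric. *)
Definition tube (r : R) x y : set pt := [set z | `|Delta x y z| < r].

Lemma pt_eqP u v : u 0 0 = v 0 0 -> u 0 1 = v 0 1 -> u = v.
Proof.
move=> e0 e1; apply/rowP => -[[|[|//]] lj].
  by rewrite (_ : Ordinal lj = 0) //; apply: val_inj.
by rewrite (_ : Ordinal lj = 1) //; apply: val_inj.
Qed.

Lemma cross_le u v : `|cross u v| <= 2 * `|u| * `|v|.
Proof.
apply: le_trans (ler_normB _ _) _; rewrite !normrM.
have := coord_le u 0; have := coord_le u 1; have := coord_le v 0; have := coord_le v 1.
have := normr_ge0 (u 0 0); have := normr_ge0 (u 0 1).
have := normr_ge0 (v 0 0); have := normr_ge0 (v 0 1); nra.
Qed.

(** Cramer's rule, cleared of denominators. *)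
Lemma cross_id a b c : cross a b *: c = cross c b *: a + cross a c *: b.
Proof. by apply: pt_eqP; rewrite !mxE /cross; ring. Qed.

Lemma cross_id_le a b c :
  `|cross a b| * `|c| <= `|cross c b| * `|a| + `|cross a c| * `|b|.
Proof. by rewrite -!normrZ cross_id; exact: ler_normD. Qed.

Lemma crossC u v : cross u v = - cross v u.
Proof. by rewrite /cross; ring. Qed.

Lemma normr_crossC u v : `|cross u v| = `|cross v u|.
Proof. by rewrite crossC normrN. Qed.

Lemma crossBr u v w : cross u (v - w) = cross u v - cross u w.
Proof. by rewrite /cross !mxE; ring. Qed.

Lemma crossvv u : cross u u = 0.
Proof. by rewrite /cross; ring. Qed.

Lemma DeltaC x y z : `|Delta x y z| = `|Delta x z y|.
Proof. exact: normr_crossC. Qed.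

Lemma Delta_fst x y : Delta x y x = 0.
Proof. by rewrite /Delta subrr /cross !mxE; ring. Qed.

Lemma Delta_snd x y : Delta x y y = 0.
Proof. exact: crossvv. Qed.

Lemma tube_fst r x y : 0 < r -> tube r x y x.
Proof. by rewrite /tube /= Delta_fst normr0. Qed.

Lemma tube_snd r x y : 0 < r -> tube r x y y.
Proof. by rewrite /tube /= Delta_snd normr0. Qed.

Lemma tubeS r r' x y : r <= r' -> tube r x y `<=` tube r' x y.
Proof. by move=> rr z; rewrite /tube /= => /lt_le_trans; apply. Qed.

(** For transversal directions, [z' - z] has determinant at most [2 r] with both of them, and
    Cramer's rule bounds it. *)
Lemma tube_cap (d D r k : R) x y x' y' z z' : 0 < d -> d <= D -> 0 < k ->
  r <= k * d / (4 * D) -> `|y - x| <= D -> `|y' - x'| <= D -> d <= `|y' - x'| ->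
  `|z - x'| <= D -> ~ (tube k x y x' /\ tube k x y y') ->
  tube r x y z -> tube r x' y' z -> tube r x y z' -> tube r x' y' z' ->
  `|z' - z| <= 16 * D ^+ 2 * r / (d * k).
Proof.
move=> d0 dD k0; set k' := k * d / (4 * D) => rk yx y'x' dyx zx' nk.
rewrite /tube /= => z1 z2 z'1 z'2.
have D0 : 0 < D by lra.
have k'0 : 0 < k' by rewrite divr_gt0 ?mulr_gt0.
have kE : k = k' * (4 * (D / d)) by rewrite /k'; field; rewrite !gt_eqF.
have Dd : 1 <= D / d by rewrite ler_pdivlMr // mul1r.
have r0 : 0 < r by apply: le_lt_trans z1.
(* Nearly parallel tubes with the common point [z]: then [x'] and [y'] both fall into the [k]-tube
   of [x] and [y], which is excluded. *)
have [lt|ge] := ltP `|cross (y - x) (y' - x')| k'.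
  exfalso; apply: nk.
  have h : `|cross (y - x) (z - x')| <= (r + k') * (D / d).
    rewrite mulrA ler_pdivlMr //.
    have := cross_id_le (y - x) (z - x') (y' - x').
    have := ler_wpM2l (normr_ge0 (cross (y - x) (z - x'))) dyx.
    move: z2; rewrite /Delta => z2.
    have := normr_ge0 (cross (y' - x') (z - x')).
    have := normr_ge0 (cross (y - x) (y' - x')).
    have := normr_ge0 (y - x); have := normr_ge0 (z - x').
    nra.
  have h1 : `|Delta x y x'| <= r + (r + k') * (D / d).
    have -> : Delta x y x' = Delta x y z - cross (y - x) (z - x').
      by rewrite /Delta /cross !mxE; ring.
    by apply: le_trans (ler_normB _ _) _; rewrite lerD // ltW.
  have h2 : `|Delta x y y'| < r + (r + k') * (D / d) + k'.
    have -> : Delta x y y' = Delta x y x' + cross (y - x) (y' - x').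
      by rewrite /Delta /cross !mxE; ring.
    by apply: le_lt_trans (ler_normD _ _) _; rewrite ler_ltD.
  rewrite /tube /=; split; move: h1 h2; rewrite kE; nra.
rewrite (_ : 16 * D ^+ 2 * r / (d * k) = 4 * r * D / k'); last first.
  by rewrite /k'; field; rewrite !gt_eqF.
rewrite ler_pdivlMr //.
have e1 : `|cross (y - x) (z' - z)| <= 2 * r.
  have -> : z' - z = (z' - x) - (z - x) by rewrite opprB addrA subrK.
  by rewrite crossBr; apply: le_trans (ler_normB _ _) _; rewrite /Delta in z1 z'1; lra.
have e2 : `|cross (y' - x') (z' - z)| <= 2 * r.
  have -> : z' - z = (z' - x') - (z - x') by rewrite opprB addrA subrK.
  by rewrite crossBr; apply: le_trans (ler_normB _ _) _; rewrite /Delta in z2 z'2; lra.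
have := cross_id_le (y - x) (y' - x') (z' - z).
rewrite (normr_crossC (z' - z)).
have := normr_ge0 (z' - z); have := normr_ge0 (y - x); have := normr_ge0 (y' - x').
have := ler_wpM2r (normr_ge0 (z' - z)) ge.
nra.
Qed.

(** Seen from [x], both [y] and [y0] are close to the line through [x'], a point at distance at
    least [p]; Cramer's rule compares them with each other. *)
Lemma tube_pin (D r k p : R) x x' y y0 : 0 < k -> p <= `|x' - x| -> r * (2 * D) <= k * p ->
  0 < p -> `|y - x| <= D -> `|y0 - x| <= D -> 0 < D ->
  `|Delta x x' y0| < r -> `|Delta x x' y| < r -> tube k x y0 y.
Proof.
move=> k0 pxx rkp p0 yx y0x D0; rewrite /tube /= /Delta => h1 h2.
have := cross_id_le (y0 - x) (y - x) (x' - x).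
rewrite (normr_crossC (y0 - x) (x' - x)).
have q1 : `|cross (x' - x) (y - x)| * `|y0 - x| <= `|cross (x' - x) (y - x)| * D.
  by rewrite ler_wpM2l.
have q2 : `|cross (x' - x) (y0 - x)| * `|y - x| <= `|cross (x' - x) (y0 - x)| * D.
  by rewrite ler_wpM2l.
have q3 : `|cross (x' - x) (y - x)| * D < r * D by rewrite ltr_pM2r.
have q4 : `|cross (x' - x) (y0 - x)| * D < r * D by rewrite ltr_pM2r.
move=> H; rewrite ltNge; apply/negP => kc.
have := ler_pM (ltW k0) (ltW p0) kc pxx; lra.
Qed.

(** * Radial projections and sectors *)

Lemma enorm2 u : enorm u = Num.sqrt (u 0 0 ^+ 2 + u 0 1 ^+ 2).
Proof. by rewrite /enorm !big_ord_recl big_ord0 addr0; congr (Num.sqrt (_ + u 0 _ ^+ 2)); apply: val_inj. Qed.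

Lemma norm_enorm u : `|u| <= enorm u.
Proof.
rewrite enorm2; apply: norm_coord; rewrite ?sqrtr_ge0 // -sqrtr_sqr ler_sqrt ?addr_ge0 ?sqr_ge0 //.
  by rewrite lerDl sqr_ge0.
by rewrite lerDr sqr_ge0.
Qed.

Lemma enorm_norm u : enorm u <= 2 * `|u|.
Proof.
rewrite enorm2 -[leRHS]ger0_norm ?mulr_ge0 // -sqrtr_sqr ler_sqrt ?sqr_ge0 //.
have := coord_le u 0; have := coord_le u 1.
have := real_normK (num_real (u 0 0)); have := real_normK (num_real (u 0 1)).
have := normr_ge0 (u 0 0); have := normr_ge0 (u 0 1); nra.
Qed.

Lemma radial_projE x y : y - x = enorm (y - x) *: radial_proj x y.
Proof.
rewrite /radial_proj; have [->|nz] := eqVneq (y - x) 0; first by rewrite !scaler0.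
rewrite scalerA divff ?scale1r // gt_eqF //.
by apply: lt_le_trans (norm_enorm _); rewrite normr_gt0.
Qed.

Lemma radial_proj_le1 x y : `|radial_proj x y| <= 1.
Proof.
have [e|nz] := eqVneq (y - x) 0; first by rewrite /radial_proj e scaler0 normr0 ler01.
rewrite /radial_proj normrZ normfV.
have e0 : 0 < enorm (y - x) by apply: lt_le_trans (norm_enorm _); rewrite normr_gt0.
by rewrite gtr0_norm // mulrC ler_pdivrMr // mul1r; exact: norm_enorm.
Qed.

(** The area is the product of the two lengths, each at most [2 D], and the determinant of the
    directions, which vanishes when they agree. *)
Lemma cross_radial D x y y' : `|y - x| <= D -> `|y' - x| <= D ->
  `|Delta x y y'| <= 8 * D ^+ 2 * `|radial_proj x y' - radial_proj x y|.
Proof.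
move=> yD y'D; have D0 : 0 <= D by apply: le_trans yD.
rewrite /Delta (radial_projE x y) (radial_projE x y').
have -> (p q : R) u v : cross (p *: u) (q *: v) = p * q * cross u (v - u).
  by rewrite /cross !mxE; ring.
have := cross_le (radial_proj x y) (radial_proj x y' - radial_proj x y).
have := radial_proj_le1 x y; have := normr_ge0 (radial_proj x y).
have := normr_ge0 (radial_proj x y' - radial_proj x y).
have := enorm_norm (y - x); have := enorm_norm (y' - x).
have := le_trans (normr_ge0 _) (norm_enorm (y - x)).
have := le_trans (normr_ge0 _) (norm_enorm (y' - x)).
rewrite !normrM => e'0 e0 le' le n0 p0 p1 h.
rewrite (ger0_norm e0) (ger0_norm e'0).
have l1 : enorm (y - x) * enorm (y' - x) <= (2 * D) * (2 * D) by apply: ler_pM => //; lra.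
have l2 : `|cross (radial_proj x y) (radial_proj x y' - radial_proj x y)| <=
   2 * `|radial_proj x y' - radial_proj x y| by nra.
apply: le_trans (ler_pM _ _ l1 l2) _ => //; first by rewrite mulr_ge0.
by rewrite le_eqVlt; apply/orP; left; apply/eqP; ring.
Qed.

(** The chord [y' - y] has small determinant with [y - x] and with [y - x'], while these two have
    determinant [Delta x x' y] up to sign. *)
Lemma sector_cap (D r e : R) x x' y y' : `|y - x| <= D -> `|y' - x| <= D ->
  `|y - x'| <= D -> `|y' - x'| <= D -> 0 < r ->
  `|radial_proj x y' - radial_proj x y| <= e ->
  `|radial_proj x' y' - radial_proj x' y| <= e ->
  r <= `|Delta x x' y| -> `|y' - y| <= 16 * D ^+ 3 * e / r.
Proof.
move=> h1 h2 h3 h4 r0 e1 e2 rD.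
have D0 : 0 <= D by apply: le_trans h1.
have c1 := cross_radial h1 h2; have c2 := cross_radial h3 h4.
have := cross_id_le (y - x) (y - x') (y' - y).
have E u : cross (y - u) (y' - y) = Delta u y y'.
  by rewrite /Delta /cross !mxE; ring.
rewrite (normr_crossC (y' - y)) !E.
have -> : `|cross (y - x) (y - x')| = `|Delta x x' y|.
  by rewrite DeltaC -normrN /Delta /cross !mxE; congr `|_|; ring.
move=> H; rewrite ler_pdivlMr // mulrC.
apply: le_trans (ler_wpM2r (normr_ge0 _) rD) _; apply: le_trans H _.
have l1 : `|Delta x' y y'| <= 8 * D ^+ 2 * e.
  by apply: le_trans c2 _; rewrite ler_wpM2l // mulr_ge0 // sqr_ge0.
have l2 : `|Delta x y y'| <= 8 * D ^+ 2 * e.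
  by apply: le_trans c1 _; rewrite ler_wpM2l // mulr_ge0 // sqr_ge0.
have -> : 16 * D ^+ 3 * e = 8 * D ^+ 2 * e * D + 8 * D ^+ 2 * e * D by ring.
by apply: lerD; apply: ler_pM.
Qed.

End plane.

(** * Pairs lying in a common heavy tube *)

(** Keep the head, discard what is related to it, recurse. Since [rel] need not be symmetric,
    separation only says that one of the two directions fails. *)
Lemma greedy_separated (T : eqType) (rel : T -> T -> Prop) (s : seq T) :
  (forall p, p \in s -> rel p p) -> exists u, [/\ uniq u, {subset u <= s},
    (forall p q, p \in u -> q \in u -> p != q -> ~ rel p q \/ ~ rel q p) &
    forall p, p \in s -> exists2 q, q \in u & rel q p].
Proof.
have [n] := ubnP (size s); elim: n s => // n IH [|a s] /= lt refl.
  by exists [::]; split.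
have [||u [uu us usep ucov]] := IH [seq p <- s | ~~ `[< rel a p >]].
- by rewrite size_filter; apply: leq_ltn_trans (count_size _ _) _; exact: lt.
- by move=> p; rewrite mem_filter => /andP[_ ps]; apply: refl; rewrite inE ps orbT.
have ua p : p \in u -> ~ rel a p.
  by move/us; rewrite mem_filter => /andP[/asboolPn].
exists (a :: u); split.
- by rewrite /= uu andbT; apply/negP => /ua; apply; apply: refl; exact: mem_head.
- move=> p; rewrite !inE => /orP[->//|/us]; rewrite mem_filter => /andP[_ ->].
  by rewrite orbT.
- move=> p q; rewrite !inE => /orP[/eqP ->|pu] /orP[/eqP ->|qu] pq.
  + by rewrite eqxx in pq.
  + by left; apply: ua.
  + by right; apply: ua.
  + exact: usep.
- move=> p; rewrite inE => /orP[/eqP ->|ps].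
    by exists a; [exact: mem_head|apply: refl; exact: mem_head].
  have [ap|nap] := pselect (rel a p); first by exists a => //; exact: mem_head.
  have [|q qu qp] := ucov p; first by rewrite mem_filter ps andbT; apply/asboolPn.
  by exists q => //; rewrite inE qu orbT.
Qed.

Section combinatorics.
Context {R : realType}.
Local Notation pt := 'rV[R]_2.
Local Notation wpts := (seq (R * pt)).
Implicit Types (x y z : pt) (A B : set pt) (L : wpts).

Lemma indicM A B x : \1_A x * \1_B x = \1_(A `&` B) x :> R.
Proof.
have [a|a] := pselect (A x); last by rewrite (indic_out a) mul0r indic_out // => -[].
have [b|b] := pselect (B x); last by rewrite (indic_out b) mulr0 indic_out // => -[].
by rewrite !indic_in ?mul1r.
Qed.

Lemma wmeas_self A L : wmeas A L -> wmeas (A `&` [set x | x \in map snd L]) L.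
Proof. by move=> wL z zL; have [z0 Az] := wL z zL; split=> //; split=> //=; apply: map_f. Qed.

Lemma integ_const L c : integ L (fun=> c) = c * tmass L.
Proof. by rewrite -integM; apply: eq_integ => x; rewrite mulr1. Qed.

(* Cauchy-Schwarz for the counting function of the family T. *)
Lemma count_essentially_disjoint (I : eqType) (u : seq I) (T : I -> set pt) A L (t b : R) :
  wmeas A L -> tmass L <= 1 -> 0 < t -> 0 <= b -> 2 * b <= t ^+ 2 -> uniq u ->
  (forall p, p \in u -> t <= mass L (T p)) ->
  (forall p q, p \in u -> q \in u -> p != q -> mass L (T p `&` T q) <= b) ->
  (size u)%:R * t <= 2.
Proof.
move=> wL tL t0 b0 bt uu uT uTT.
have [->|u0] := eqVneq (size u) 0%N; first by rewrite mul0r.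
pose f x := \sum_(p <- u) \1_(T p) x : R.
pose S := \sum_(p <- u) mass L (T p).
have fS : integ L f = S by rewrite /f integ_sum.
have nS : (size u)%:R * t <= S.
  rewrite -[X in X%:R](count_predT u) -sum1_count natr_sum mulr_suml /S.
  by rewrite big_seq [leRHS]big_seq; apply: ler_sum => p pu; rewrite mul1r uT.
have n0 : 0 < (size u)%:R :> R by rewrite ltr0n lt0n.
have S0 : 0 < S by apply: lt_le_trans nS; rewrite mulr_gt0.
have CS : S ^+ 2 <= \sum_(p <- u) \sum_(q <- u) mass L (T p `&` T q).
  rewrite -fS (eq_integ _ (g := fun x => f x * 1)) => [|x]; last by rewrite mulr1.
  apply: le_trans (integ_cauchy_schwarz f (fun=> 1) wL) _.
  rewrite (eq_integ _ (f := fun=> 1 ^+ 2) (g := fun=> 1)) => [|x]; last by rewrite expr1n.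
  have f2 : 0 <= integ L (fun x => f x ^+ 2).
    by apply: (integ_ge0 wL) => x _; rewrite sqr_ge0.
  apply: le_trans (ler_wpM2l f2 tL) _; rewrite mulr1.
  rewrite (eq_integ _ (g := fun x => \sum_(p <- u) \sum_(q <- u) \1_(T p `&` T q) x)).
    by rewrite integ_sum; apply: ler_sum => p _; rewrite integ_sum.
  move=> x; rewrite expr2 {1}/f mulr_suml; apply: eq_bigr => p _.
  by rewrite /f mulr_sumr; apply: eq_bigr => q _; rewrite indicM.
have S2 : S ^+ 2 <= S + (size u)%:R ^+ 2 * b.
  apply: le_trans CS _.
  apply: (@le_trans _ _ (\sum_(p <- u) (mass L (T p) + (size u)%:R * b))).
    rewrite big_seq [leRHS]big_seq; apply: ler_sum => p pu.
    rewrite (bigD1_seq p) //= setIid lerD2l.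
    apply: (@le_trans _ _ (\sum_(q <- u | q != p) b)).
      rewrite big_seq_cond [leRHS]big_seq_cond; apply: ler_sum => q /andP[qu qp].
      by apply: uTT => //; rewrite eq_sym.
    rewrite big_const_seq iter_addr_0 -[leLHS]mulr_natl ler_wpM2r // ler_nat.
    exact: count_size.
  rewrite big_split /= lerD2l big_const_seq iter_addr_0 count_predT -[leLHS]mulr_natl.
  by rewrite expr2 mulrA.
(* [2 b <= t^2] and [size u * t <= S] make the overlaps cost at most half of [S^2], which leaves
   [S <= 2]. *)
have : (size u)%:R ^+ 2 * b <= S ^+ 2 / 2.
  have : ((size u)%:R * t) ^+ 2 <= S ^+ 2 by rewrite ler_sqr ?nnegrE ?(ltW S0) // mulr_ge0 // ltW.
  rewrite exprMn; have := sqr_ge0 ((size u)%:R : R); nra.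
move=> h; apply: le_trans nS _; rewrite -(ler_pM2r S0); nra.
Qed.


Section pairs.
Variables (d D : R) (A B : set pt) (nu mu : wpts).
Hypotheses (d0 : 0 < d) (dD : d <= D) (wnu : wmeas A nu) (wmu : wmeas B mu).
Hypotheses (tnu : tmass nu <= 1) (tmu : tmass mu <= 1).
Hypothesis sepAB : forall x y, A x -> B y -> d <= `|y - x|.
Hypothesis diamAB : forall x y, (A `|` B) x -> (A `|` B) y -> `|y - x| <= D.

Definition badpair (r h : R) x y :=
  h <= mass mu (tube r x y) * mass nu (tube r x y).

Let D0 : 0 < D. Proof. exact: lt_le_trans d0 dD. Qed.

(** Either no point of [C] is common to both tubes, or all of them lie in the ball of [tube_cap]
    around one. *)
Lemma tubes_meet_small C L (r k b : R) (p q : pt * pt) : wmeas C L -> C `<=` A `|` B ->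
  0 < k -> r <= k * d / (4 * D) -> 0 <= b ->
  (forall z, C z -> mass L [set y | `|y - z| <= 16 * D ^+ 2 * r / (d * k)] <= b) ->
  A p.1 -> B p.2 -> A q.1 -> B q.2 ->
  ~ (tube k p.1 p.2 q.1 /\ tube k p.1 p.2 q.2) ->
  mass L (tube r p.1 p.2 `&` tube r q.1 q.2) <= b.
Proof.
move=> wL CAB k0 rk b0 Lb Ap Bp Aq Bq npq.
have [[z [Cz [zp zq]]]|no] := pselect (exists z, C z /\ (tube r p.1 p.2 z /\ tube r q.1 q.2 z)).
  apply: le_trans (Lb z Cz); apply: (mass_le wL) => y Cy [yp yq] /=.
  have e1 := @diamAB p.1 p.2 (or_introl Ap) (or_intror Bp).
  have e2 := @diamAB q.1 q.2 (or_introl Aq) (or_intror Bq).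
  have e4 := @diamAB q.1 z (or_introl Aq) (CAB z Cz).
  exact: (tube_cap d0 dD k0 rk e1 e2 (sepAB Aq Bq) e4 npq zp zq yp yq).
by rewrite (mass0 wL) // => y Cy yy; apply: no; exists y.
Qed.

(* Distinct tubes with large mass for mu (resp. nu) are essentially disjoint, so
   there are few of them; each fattened tube carries little product mass. *)
Lemma new_bad_mass (r k t h b : R) : 0 < k -> r <= k * d / (4 * D) -> 0 < t ->
  0 <= h -> 0 <= b -> 2 * b <= t ^+ 2 ->
  (forall z, A z -> mass nu [set y | `|y - z| <= 16 * D ^+ 2 * r / (d * k)] <= b) ->
  (forall z, B z -> mass mu [set y | `|y - z| <= 16 * D ^+ 2 * r / (d * k)] <= b) ->
  integ nu (fun x => mass mu [set y | badpair r (t ^+ 2) x y /\ ~ badpair k h x y])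
    <= 4 / t * h.
Proof.
move=> k0 rk t0 h0 b0 bt nub mub.
pose new (p : pt * pt) := badpair r (t ^+ 2) p.1 p.2 /\ ~ badpair k h p.1 p.2.
pose s := [seq p <- [seq (x, y) | x <- map snd nu, y <- map snd mu] | `[< new p >]].
have sP p : p \in s -> [/\ A p.1, B p.2 & new p].
  rewrite mem_filter => /andP[/asboolP np /allpairsP[[x y] /= [xl yl e]]].
  split=> //; rewrite e /=.
    by move: xl => /mapP[z /wnu[_ Az] ->].
  by move: yl => /mapP[z /wmu[_ Bz] ->].
pose rel (p q : pt * pt) := tube k p.1 p.2 q.1 /\ tube k p.1 p.2 q.2.
have [|u [uu us usep ucov]] := @greedy_separated _ rel s.
  by move=> p _; split; [exact: tube_fst|exact: tube_snd].
have size_le : (size u)%:R * t <= 4.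
  (* A product of masses at least [t^2] forces one of them to be at least [t]. The [mu]-heavy and
     the [nu]-heavy tubes are counted apart, at most [2 / t] of each. *)
  pose P p := t <= mass mu (tube r p.1 p.2).
  rewrite -(count_predC P u) natrD mulrDl (_ : 4 = 2 + 2); last by rewrite -natrD.
  have sep p q : p \in u -> q \in u -> p != q -> forall C L, wmeas C L -> C `<=` A `|` B ->
      (forall z, C z -> mass L [set y | `|y - z| <= 16 * D ^+ 2 * r / (d * k)] <= b) ->
      mass L (tube r p.1 p.2 `&` tube r q.1 q.2) <= b.
    move=> pu qu pq C L wL CAB Lb.
    have [Ap Bp _] := sP p (us p pu); have [Aq Bq _] := sP q (us q qu).
    have [npq|npq] := usep p q pu qu pq.
      by apply: (tubes_meet_small wL CAB k0 rk).
    by rewrite setIC; apply: (tubes_meet_small wL CAB k0 rk).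
  rewrite -!size_filter; apply: lerD.
    apply: (count_essentially_disjoint (T := fun p => tube r p.1 p.2) wmu tmu t0 b0 bt).
    - exact: filter_uniq.
    - by move=> p; rewrite mem_filter => /andP[].
    - move=> p q; rewrite !mem_filter => /andP[_ pu] /andP[_ qu] pq.
      by apply: (sep p q pu qu pq B).
  apply: (count_essentially_disjoint (T := fun p => tube r p.1 p.2) wnu tnu t0 b0 bt).
  - exact: filter_uniq.
  - move=> p; rewrite mem_filter => /andP[/= mp pu].
    have [_ _ [bp _]] := sP p (us p pu).
    move: bp mp; rewrite /badpair /P -ltNge => bp mp; rewrite leNgt; apply/negP => np.
    have := mass_ge0 (tube r p.1 p.2) wmu; have := mass_ge0 (tube r p.1 p.2) wnu.
    move: bp mp np; set a := mass mu _; set c := mass nu _; nra.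
  - move=> p q; rewrite !mem_filter => /andP[_ pu] /andP[_ qu] pq.
    by apply: (sep p q pu qu pq A).
(* Each new pair lies in the [k]-tube of a selected pair, and that tube has product mass below [h]
   because the selected pair is not bad at [k]. *)
apply: (@le_trans _ _ (\sum_(p <- u) mass nu (tube k p.1 p.2) * mass mu (tube k p.1 p.2))).
  apply: (@le_trans _ _ (integ nu (fun x => \sum_(p <- u)
      mass mu (tube k p.1 p.2) * \1_(tube k p.1 p.2) x))).
    apply: (integ_le (wmeas_self wnu)) => x [Ax /= xl].
    apply: (@le_trans _ _ (integ mu (fun y => \sum_(p <- u)
        \1_(tube k p.1 p.2) x * \1_(tube k p.1 p.2) y))); last first.
      by rewrite integ_sum; apply: ler_sum => p _; rewrite integM mulrC.
    apply: (integ_le (wmeas_self wmu)) => y [By /= yl].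
    have [nxy|nxy] := pselect (new (x, y)); last first.
      rewrite indic_out //; apply: sumr_ge0 => p _.
      by rewrite mulr_ge0 ?indic_ge0.
    have [|q qu [/= qx qy]] := ucov (x, y).
      rewrite mem_filter; apply/andP; split; first exact/asboolP.
      by apply/allpairsP; exists (x, y).
    rewrite (big_rem q) //= !indic_in // mul1r lerDl; apply: sumr_ge0 => p _.
    by rewrite mulr_ge0 ?indic_ge0.
  by rewrite integ_sum; apply: ler_sum => p _; rewrite integM mulrC.
apply: (@le_trans _ _ (\sum_(p <- u) h)).
  rewrite big_seq [leRHS]big_seq; apply: ler_sum => p pu.
  have [_ _ [_ /negP]] := sP p (us p pu).
  by rewrite -ltNge mulrC => /ltW.
rewrite big_const_seq iter_addr_0 count_predT -[leLHS]mulr_natl ler_wpM2r //.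
by rewrite ler_pdivlMr.
Qed.

(* Either nu or mu has little mass near the line x y; in the second case the
   points y seen near a fixed line x x' lie in one such tube. *)
Lemma near_line_mass (r k p t g : R) x : A x -> 0 < k -> 0 < p -> r <= k -> 0 <= t ->
  r * (2 * D) <= k * p -> mass nu [set x' | `|x' - x| <= p] <= g ->
  integ nu (fun x' => mass mu [set y | ~ badpair k (t ^+ 2) x y /\ `|Delta x x' y| < r])
    <= 2 * t + g.
Proof.
move=> Ax k0 p0 rk t0 rkp nug.
pose H1 := [set y | mass nu (tube k x y) < t].
pose H2 := [set y | mass mu (tube k x y) < t].
pose T x' := [set y | `|Delta x x' y| < r].
apply: (@le_trans _ _ (integ nu (fun x' => mass mu (H1 `&` T x') + mass mu (H2 `&` T x')))).
  apply: (integ_le wnu) => x' Ax'; rewrite -integD.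
  apply: (integ_le wmu) => y By.
  have [[nb Ty]|no] := pselect ([set y | ~ badpair k (t ^+ 2) x y /\ `|Delta x x' y| < r] y); last first.
    by rewrite (indic_out no) addr_ge0 // indic_ge0.
  rewrite indic_in //.
  have [h1|h1] := ltP (mass nu (tube k x y)) t.
    by rewrite (indic_in (A := H1 `&` T x')) // lerDl indic_ge0.
  have [h2|h2] := ltP (mass mu (tube k x y)) t.
    by rewrite (indic_in (A := H2 `&` T x')) // lerDr indic_ge0.
  by exfalso; apply: nb; rewrite /badpair expr2; exact: ler_pM.
rewrite integD mulr_natl mulr2n -addrA; apply: lerD.
  (* [y] is near the line [x x'] exactly when [x'] is near the line [x y]; exchanging the integrals
     leaves the [nu]-mass of a tube. *)
  have -> : integ nu (fun x' => mass mu (H1 `&` T x')) =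
      integ mu (fun y => \1_H1 y * mass nu (tube r x y)).
    rewrite /mass integ_swap; apply: eq_integ => y; rewrite -integM.
    apply: eq_integ => x'; rewrite -indicM; congr (_ * _).
    have [h|h] := pselect (T x' y).
      by rewrite !indic_in // /tube /= DeltaC.
    by rewrite !indic_out // /tube /= DeltaC.
  apply: (@le_trans _ _ (integ mu (fun=> t))); last first.
    by rewrite integ_const; apply: ler_piMr.
  apply: (integ_le wmu) => y By.
  have [h|h] := pselect (H1 y); last by rewrite (indic_out h) mul0r.
  rewrite indic_in // mul1r; apply: le_trans (ltW h).
  by apply: (mass_le wnu) => z _; apply: tubeS.
(* Points [x'] within [p] of [x] are charged to [g]; for the others [tube_pin] applies. *)
apply: (@le_trans _ _ (integ nu (fun x' => t + \1_[set x' | `|x' - x| <= p] x'))); last first.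
  rewrite integD; apply: lerD => //.
  by rewrite integ_const; apply: ler_piMr.
apply: (integ_le wnu) => x' Ax'.
have [le|gt] := pselect (`|x' - x| <= p).
  rewrite (indic_in (A := [set x' | `|x' - x| <= p])) //.
  apply: le_trans (mass_le_tmass _ wmu) _; apply: le_trans tmu _; lra.
rewrite (indic_out gt) addr0.
have [[y0 [By0 [h2 Ty0]]]|no] := pselect (exists y0, B y0 /\ (H2 `&` T x') y0); last first.
  by rewrite (mass0 wmu) // => y By hy; apply: no; exists y.
apply: le_trans (ltW h2); apply: (mass_le wmu) => y By [_ Ty].
apply: (tube_pin (D := D) (x' := x') k0 _ rkp p0) => //.
- by apply: ltW; rewrite ltNge; apply/negP.
- by apply: diamAB; [left|right].
- by apply: diamAB; [left|right].
Qed.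

End pairs.

End combinatorics.

(** * The scales *)

Section scales.
Context {R : realType}.
Local Notation pt := 'rV[R]_2.
Local Notation wpts := (seq (R * pt)).
Implicit Types (x y z : pt) (A B : set pt) (L : wpts).

Definition sector x (a : pt * R) : set pt := [set y | `|radial_proj x y - a.1| < a.2].

Lemma expR_small (e c : R) : 0 < e -> - ln e <= c -> expR (- c) <= e.
Proof. by move=> e0 ec; rewrite -[leRHS]lnK ?posrE // ler_expR lerNl. Qed.

(* Scales r_k = exp (- L growth k) and thresholds t_k = exp (- l growth k).  The ratio
   3/2 is larger than 1, which makes r_(k+1) / r_k small, and smaller than 2, which
   makes t_k^2 / t_(k+1) summable. *)
Definition growth (k : nat) : R := (3 / 2) ^+ k.

Lemma growthS k : growth k.+1 = 3 / 2 * growth k.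
Proof. by rewrite /growth exprS. Qed.

Lemma growth_ge k : 1 + k%:R / 2 <= growth k.
Proof.
elim: k => [|k IH]; first by rewrite /growth expr0 mul0r addr0.
rewrite growthS -natr1; have : 0 <= k%:R :> R by []. lra.
Qed.

Lemma growth_ge1 k : 1 <= growth k.
Proof. by apply: le_trans (growth_ge k); rewrite lerDl divr_ge0. Qed.

Lemma growth_mono k k' : (k <= k')%N -> growth k <= growth k'.
Proof. by move=> kk; rewrite /growth ler_weXn2l //; lra. Qed.

Lemma growth_lt k k' : growth k < growth k' -> (k < k')%N.
Proof. by move=> h; rewrite ltnNge; apply/negP => /growth_mono; rewrite leNgt h. Qed.

Lemma growth_unbounded (c : R) : exists k, c < growth k.
Proof.
have [n hn] : exists n : nat, `|c| * 2 < n%:R.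
  exists (Num.bound (`|c| * 2)); apply: archi_boundP; rewrite mulr_ge0 //.
exists n; have := growth_ge n; have := ler_norm c; lra.
Qed.

Lemma geometric_sum_le (q : R) n m : 0 <= q -> q < 1 ->
  \sum_(m <= j < n) q ^+ j <= q ^+ m / (1 - q).
Proof.
move=> q0 q1; have q10 : 0 < 1 - q by lra.
have [nm|mn] := leqP n m.
  by rewrite big_geq // divr_ge0 ?exprn_ge0 // ltW.
rewrite ler_pdivlMr // mulr_suml.
have -> : \sum_(m <= j < n) q ^+ j * (1 - q) = q ^+ m - q ^+ n.
  have := telescope_sumr (fun j => - q ^+ j) (ltnW mn).
  rewrite opprK addrC => <-; apply: eq_bigr => j _; rewrite exprS; ring.
by rewrite gerBl exprn_ge0.
Qed.

Section fixed_scale.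
Variables (d D : R) (A B : set pt) (nu mu : wpts).
Hypotheses (d0 : 0 < d) (dD : d <= D) (wnu : wmeas A nu) (wmu : wmeas B mu).
Hypotheses (tnu : tmass nu <= 1) (tmu : tmass mu <= 1).
Hypothesis sepAB : forall x y, A x -> B y -> d <= `|y - x|.
Hypothesis diamAB : forall x y, (A `|` B) x -> (A `|` B) y -> `|y - x| <= D.

Lemma sectors_meet_small (r e g : R) x x' a a' : 0 < r -> A x -> A x' ->
  a.2 <= e -> a'.2 <= e -> 0 <= g ->
  (forall z, B z -> mass mu [set y | `|y - z| <= 32 * D ^+ 3 * e / r] <= g) ->
  mass mu (sector x a `&` sector x' a' `&` [set y | r <= `|Delta x x' y|]) <= g.
Proof.
move=> r0 Ax Ax' ae a'e g0 hg.
have [[z [Bz [[zx zx'] zr]]]|no] := pselect (exists z, B z /\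
    (sector x a `&` sector x' a' `&` [set y | r <= `|Delta x x' y|]) z); last first.
  by rewrite (mass0 wmu) // => y By yy; apply: no; exists y.
apply: le_trans (hg z Bz); apply: (mass_le wmu) => y By [[yx yx'] _] /=.
have close w b : b.2 <= e -> sector w b z -> sector w b y ->
    `|radial_proj w y - radial_proj w z| <= 2 * e.
  rewrite /sector /= => be wz wy.
  rewrite (_ : _ - _ = (radial_proj w y - b.1) - (radial_proj w z - b.1)); last first.
    by rewrite opprB addrA subrK.
  by apply: le_trans (ler_normB _ _) _; lra.
have dxz := @diamAB x z (or_introl Ax) (or_intror Bz).
have dxy := @diamAB x y (or_introl Ax) (or_intror By).
have dx'z := @diamAB x' z (or_introl Ax') (or_intror Bz).
have dx'y := @diamAB x' y (or_introl Ax') (or_intror By).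
have := sector_cap dxz dxy dx'z dx'y r0 (close _ _ ae zx yx) (close _ _ a'e zx' yx') zr.
by rewrite (_ : 16 * D ^+ 3 * (2 * e) = 32 * D ^+ 3 * e) //; ring.
Qed.

(** Cauchy-Schwarz in [y] passes to triples [(x, x', y)]. Those with [y] near the line [x x'] cost
    [2 t + g]; for the others [y] lies in one of at most [M^2] intersections of two sectors, each of
    mass at most [g']. *)
Lemma fixed_scale_square (r k p t g g' e M : R) (cl : pt -> seq (pt * R)) (G : pt -> set pt) :
  0 < r -> 0 < k -> 0 < p -> r <= k -> 0 <= t -> r * (2 * D) <= k * p -> 0 <= g ->
  (forall x, A x -> mass nu [set x' | `|x' - x| <= p] <= g) ->
  0 <= g' ->
  (forall z, B z -> mass mu [set y | `|y - z| <= 32 * D ^+ 3 * e / r] <= g') ->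
  0 <= M -> (forall x, A x -> (size (cl x))%:R <= M) ->
  (forall x a, A x -> a \in cl x -> a.2 <= e) ->
  (forall x y, A x -> B y -> G x y -> ~ badpair nu mu k (t ^+ 2) x y /\
     exists2 a, a \in cl x & sector x a y) ->
  integ nu (fun x => mass mu (G x)) ^+ 2 <= M ^+ 2 * g' + (2 * t + g).
Proof.
move=> r0 k0 p0 rk t0 rkp g0 nug g'0 mug M0 sM cle GP.
have E1 : integ nu (fun x => mass mu (G x)) =
    integ mu (fun y => integ nu (fun x => \1_(G x) y) * 1).
  rewrite /mass integ_swap; apply: eq_integ => y; by rewrite mulr1.
rewrite E1; apply: le_trans (integ_cauchy_schwarz _ _ wmu) _.
rewrite [X in _ * X](_ : _ = tmass mu); last by apply: eq_integ => y; rewrite expr1n.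
have f2 : 0 <= integ mu (fun y => integ nu (fun x => \1_(G x) y) ^+ 2).
  by apply: (integ_ge0 wmu) => y _; rewrite sqr_ge0.
apply: le_trans (ler_wpM2l f2 tmu) _; rewrite mulr1.
have -> : integ mu (fun y => integ nu (fun x => \1_(G x) y) ^+ 2) =
    integ nu (fun x => integ nu (fun x' => mass mu (G x `&` G x'))).
  have -> : integ nu (fun x => integ nu (fun x' => mass mu (G x `&` G x'))) =
      integ nu (fun x => integ mu (fun y => integ nu (fun x' => \1_(G x `&` G x') y))).
    by apply: eq_integ => x; rewrite /mass integ_swap.
  rewrite integ_swap; apply: eq_integ => y; rewrite expr2 -integM.
  apply: eq_integ => x; rewrite mulrC -integM; apply: eq_integ => x'.
  by rewrite -indicM.
have const_le c : 0 <= c -> integ nu (fun=> c) <= c.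
  by move=> c0; rewrite integ_const; apply: ler_piMr.
apply: (@le_trans _ _ (integ nu (fun=> M ^+ 2 * g' + (2 * t + g)))); last first.
  apply: const_le; rewrite !addr_ge0 ?mulr_ge0 ?sqr_ge0 //.
apply: (integ_le wnu) => x Ax.
apply: (@le_trans _ _ (integ nu (fun x' => M ^+ 2 * g' +
    mass mu [set y | ~ badpair nu mu k (t ^+ 2) x y /\ `|Delta x x' y| < r]))); last first.
  rewrite integD; apply: lerD; first by apply: const_le; rewrite mulr_ge0 ?sqr_ge0.
  by apply: (near_line_mass d0 dD wnu wmu tnu tmu diamAB Ax k0 p0) => //; exact: nug.
apply: (integ_le wnu) => x' Ax'.
pose far := [set y | r <= `|Delta x x' y|].
pose T (c : (pt * R) * (pt * R)) := sector x c.1 `&` sector x' c.2 `&` far.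
pose prs := [seq (a, a') | a <- cl x, a' <- cl x'].
apply: (@le_trans _ _ (mass mu (G x `&` G x' `&` far) +
    mass mu [set y | ~ badpair nu mu k (t ^+ 2) x y /\ `|Delta x x' y| < r])).
  rewrite -integD; apply: (integ_le wmu) => y By.
  have [[Gx Gx']|no] := pselect ((G x `&` G x') y); last first.
    by rewrite (indic_out no) addr_ge0 ?indic_ge0.
  rewrite indic_in //; have [nb _] := GP x y Ax By Gx.
  have [lt|ge] := ltP `|Delta x x' y| r.
    by rewrite (indic_in (A := [set y | ~ badpair nu mu k (t ^+ 2) x y /\ `|Delta x x' y| < r])) // lerDr indic_ge0.
  by rewrite (indic_in (A := G x `&` G x' `&` far)) // lerDl indic_ge0.
rewrite lerD2r; apply: (@le_trans _ _ (\sum_(c <- prs) mass mu (T c))).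
  apply: (mass_bigU wmu) => y By [[Gx Gx'] fy].
  have [_ [a al ya]] := GP x y Ax By Gx; have [_ [a' al' ya']] := GP x' y Ax' By Gx'.
  by exists (a, a'); first by apply/allpairsP; exists (a, a').
apply: (@le_trans _ _ (\sum_(c <- prs) g')).
  rewrite big_seq [leRHS]big_seq; apply: ler_sum => c /allpairsP[[a a'] /= [al al' ->]].
  apply: sectors_meet_small mug => //=; [exact: cle al|exact: cle al'].
rewrite big_const_seq iter_addr_0 count_predT -[leLHS]mulr_natl size_allpairs natrM.
by rewrite ler_wpM2r // expr2; apply: ler_pM => //; exact: sM.
Qed.


(** * Summing the bad pairs over the scales *)

Definition rr (l : R) k := expR (- (l * growth k)).

Lemma rr_gt0 l k : 0 < rr l k. Proof. exact: expR_gt0. Qed.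

Lemma rr_le1 l k : 0 <= l -> rr l k <= 1.
Proof.
move=> l0; rewrite /rr -[leRHS]expR0 ler_expR oppr_le0 mulr_ge0 //.
by apply: le_trans (growth_ge1 k).
Qed.

(** Here [k] stands for a value of [growth]. The radius is a multiple of [r_(k+1) / r_k] and the
    bound is [t_(k+1)^2 / 2], the value of [b] used in [new_bad_mass]. *)
Lemma frost_small (s L l k c : R) m C W : 0 < s -> wmeas C W -> frost s m W ->
  tmass W <= 1 -> 0 <= s * L / 2 - 3 * l ->
  2 * frostc s * c `^ s * expR (- (s * L / 2 - 3 * l)) <= 1 -> 1 <= k -> 0 < c ->
  (2^-1) ^+ m <= c * expR (- (L * k / 2)) ->
  forall z, mass W [set y | `|y - z| <= c * expR (- (L * k / 2))] <= expR (- (3 * l * k)) / 2.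
Proof.
move=> s0 wW fW tW h0 h1 k1 c0 mc z.
apply: le_trans (frost_ball z (ltW s0) wW fW tW mc) _.
rewrite powRM ?expR_ge0 ?(ltW c0) // -expRM.
have -> : - (L * k / 2) * s = - (3 * l * k) - (s * L / 2 - 3 * l) * k by ring.
have fc0 : 0 <= frostc s * c `^ s.
  by rewrite mulr_ge0 ?powR_ge0 // (le_trans _ (frostc_ge1 (ltW s0))).
rewrite expRD; have E0 := expR_ge0 (- (3 * l * k)).
have : expR (- ((s * L / 2 - 3 * l) * k)) <= expR (- (s * L / 2 - 3 * l)).
  by rewrite ler_expR lerN2 ler_peMr.
move: h1; rewrite -mulrA -[2 * frostc s * _]mulrA mulrA -mulrA.
set e1 := expR (- (_ * k)); set e0 := expR (- (_ - _)); set E := expR _ => h1 e10.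
have q1 : frostc s * c `^ s * e1 <= 2^-1.
  by apply: le_trans (ler_wpM2l fc0 e10) _; lra.
have -> : frostc s * (c `^ s * (E * e1)) = E * (frostc s * c `^ s * e1) by ring.
exact: ler_wpM2l.
Qed.

Let D0 : 0 < D. Proof. exact: lt_le_trans d0 dD. Qed.

Definition badset (L l : R) k x : set pt := [set y | badpair nu mu (rr L k) (rr l k ^+ 2) x y].

(** A bad pair, not being bad at scale 0, is bad for the first time at some [k + 1], and the pairs
    new there have mass at most [4 t_k^2 / t_(k+1) = 4 exp (- l growth k / 2)]. *)
Lemma bad_mass (L l s eta : R) m K : 0 < s -> 0 < eta -> 0 <= L ->
  frost eta m nu -> frost s m mu -> expR (- (L / 2)) <= d / (4 * D) ->
  0 <= s * L / 2 - 3 * l ->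
  2 * frostc s * (16 * D ^+ 2 / d) `^ s * expR (- (s * L / 2 - 3 * l)) <= 1 ->
  0 <= eta * L / 2 - 3 * l ->
  2 * frostc eta * (16 * D ^+ 2 / d) `^ eta * expR (- (eta * L / 2 - 3 * l)) <= 1 ->
  (forall k, (k < K)%N -> (2^-1) ^+ m <= 16 * D ^+ 2 / d * expR (- (L * growth k / 2))) ->
  (forall x y, A x -> B y -> ~ badset L l 0 x y) ->
  integ nu (fun x => mass mu [set y | exists2 k, (k <= K)%N & badset L l k x y]) <=
    \sum_(k < K) 4 * expR (- (l * growth k / 2)).
Proof.
move=> s0 eta0 L0 fnu fmu Ld s1 s2 e1 e2 mK nb0.
pose new k x := [set y | badset L l k.+1 x y /\ ~ badset L l k x y].
apply: (@le_trans _ _ (\sum_(k < K) integ nu (fun x => mass mu (new k x)))).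
  rewrite -integ_sum; apply: (integ_le wnu) => x Ax.
  rewrite -(big_mkord predT (fun k => mass mu (new k x))).
  apply: (mass_bigU wmu) => y By [k kK bk].
  pose P k := `[< badset L l k x y >].
  have exP : exists k, P k by exists k; apply/asboolP.
  case: (ex_minnP exP) => -[|i] /asboolP bi mini; first by case: (nb0 x y Ax By).
  exists i.
    by rewrite mem_index_iota leq0n /=; apply: leq_trans kK; apply: mini; apply/asboolP.
  by split=> // /asboolP/mini; rewrite ltnn.
apply: ler_sum => k _.
have rhoE : 16 * D ^+ 2 * rr L k.+1 / (d * rr L k) =
    16 * D ^+ 2 / d * expR (- (L * growth k / 2)).
  rewrite /rr growthS.
  have -> : - (L * (3 / 2 * growth k)) = - (L * growth k / 2) - L * growth k by field.
  by rewrite expRD; field; rewrite !gt_eqF ?expR_gt0.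
have tE : rr l k.+1 ^+ 2 = expR (- (3 * l * growth k)).
  by rewrite /rr -expRM_natl growthS; congr expR; field.
have c0 : 0 < 16 * D ^+ 2 / d by rewrite divr_gt0 // mulr_gt0 // exprn_gt0.
apply: le_trans (new_bad_mass d0 dD wnu wmu tnu tmu sepAB diamAB (b := expR (- (3 * l * growth k)) / 2)
   (rr_gt0 L k) _ (rr_gt0 l k.+1) _ _ _ _ _) _.
- rewrite -mulrA /rr growthS.
  have -> : - (L * (3 / 2 * growth k)) = - (L * growth k) - L * growth k / 2 by field.
  rewrite expRD ler_wpM2l ?expR_ge0 //; apply: le_trans Ld.
  by rewrite ler_expR lerN2 ler_pM2r // ler_peMr // growth_ge1.
- by rewrite sqr_ge0.
- by rewrite divr_ge0 // expR_ge0.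
- by rewrite tE mulrC divfK.
- move=> z _; rewrite rhoE; apply: (frost_small eta0 wnu fnu) => //; first exact: growth_ge1.
  exact: mK.
- move=> z _; rewrite rhoE; apply: (frost_small s0 wmu fmu) => //; first exact: growth_ge1.
  exact: mK.
rewrite -mulrA ler_pM2l // le_eqVlt; apply/orP; left; apply/eqP.
by rewrite -expRM_natl /rr -expRN -expRD growthS; congr expR; field.
Qed.

End fixed_scale.

Lemma bad_sum (l : R) K : 0 <= l -> expR (- (l / 4)) <= 2^-1 ->
  \sum_(k < K) 4 * expR (- (l * growth k / 2)) <= 8 * expR (- (l / 2)).
Proof.
move=> l0 h; rewrite -mulr_sumr (_ : 8 * _ = 4 * (2 * expR (- (l / 2)))) ?ler_pM2l //; last by ring.
apply: (@le_trans _ _ (\sum_(k < K) expR (- (l / 2)) * (2^-1) ^+ k)).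
  apply: ler_sum => k _; apply: (@le_trans _ _ (expR (- (l / 2)) * expR (- (l / 4)) ^+ k)).
    rewrite -expRM_natl -expRD ler_expR.
    have := growth_ge k; nra.
  by rewrite ler_wpM2l ?expR_ge0 // lerXn2r // nnegrE ?expR_ge0.
rewrite -mulr_sumr [leRHS]mulrC ler_wpM2l ?expR_ge0 //.
rewrite -(big_mkord predT (fun k => (2^-1) ^+ k)).
apply: le_trans (geometric_sum_le _ _ _ _) _; [lra|lra|].
by rewrite expr0 (_ : 1 - 2^-1 = 2^-1) ?invrK ?mul1r //; lra.
Qed.

Lemma half_small (e : R) : 0 < e -> exists m0, forall m, (m0 <= m)%N -> (2^-1) ^+ m <= e.
Proof.
move=> e0; exists (Num.bound (e^-1)) => m mm.
apply: (@le_trans _ _ (m.+1%:R^-1)).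
  rewrite exprVn lef_pV2 ?posrE ?exprn_gt0 // -natrX ler_nat; exact: ltn_expl.
rewrite -[leRHS]invrK lef_pV2 ?posrE ?invr_gt0 //.
apply: le_trans (ltW (archi_boundP _)) _; first by rewrite invr_ge0 ltW.
by rewrite ler_nat leqW.
Qed.

End scales.

(** * The finite contradiction *)

Section core.
Context {R : realType}.
Local Notation pt := 'rV[R]_2.
Local Notation wpts := (seq (R * pt)).
Implicit Types (x y z : pt) (A B : set pt).

Lemma scale_index (L c : R) : 0 < L -> L <= c ->
  exists k, L * growth k <= c /\ c < L * growth k.+1.
Proof.
move=> L0 Lc; have [k0 hk0] := @growth_unbounded R (c / L).
have exP : exists k, c < L * growth k by exists k0; rewrite mulrC -ltr_pdivrMr.
case: (ex_minnP exP) => -[|k] ck mink.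
  by move: ck; rewrite /growth expr0 mulr1 ltNge Lc.
exists k; split=> //; rewrite leNgt; apply/negP => /mink; by rewrite ltnn.
Qed.

(** Half-open classes: each radius in [(0, 1]] belongs to exactly one. *)
Definition arc_class (arcs : seq (pt * R)) (j : nat) : seq (pt * R) :=
  [seq a <- arcs | (expR (- j.+1%:R) < a.2) && (a.2 <= expR (- j%:R))].

(** Each arc of the class contributes at least [exp (- (j + 1) t)] to a sum that is at most 1. *)
Lemma arc_class_size arcs j (t : R) : 0 <= t ->
  \sum_(a <- arcs) a.2 `^ t <= 1 ->
  (size (arc_class arcs j))%:R <= expR (j.+1%:R * t).
Proof.
move=> t0 s1; rewrite -[leRHS]invrK -expRN -[leRHS]mul1r ler_pdivlMr ?expR_gt0 //.
apply: le_trans s1; rewrite -mulNr expRM.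
apply: (@le_trans _ _ (\sum_(a <- arc_class arcs j) a.2 `^ t)).
  rewrite -[X in X%:R](count_predT (arc_class arcs j)) -sum1_count natr_sum mulr_suml.
  rewrite big_seq [leRHS]big_seq; apply: ler_sum => a.
  rewrite mem_filter => /andP[/andP[h _] _]; rewrite mul1r.
  apply: ge0_ler_powR; rewrite ?nnegrE ?expR_ge0 //; last exact: ltW.
  by apply: le_trans (ltW h); exact: expR_ge0.
rewrite /arc_class big_filter big_mkcond; apply: ler_sum => a _.
by case: ifP => _ //; exact: powR_ge0.
Qed.

Lemma arc_class_mem arcs a (j0 J : nat) : a \in arcs -> expR (- J%:R) < a.2 ->
  a.2 <= expR (- j0%:R) -> exists j, [/\ (j0 <= j)%N, (j < J.+1)%N & a \in arc_class arcs j].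
Proof.
move=> al aJ aj0; have a0 : 0 < a.2 by apply: lt_trans aJ; exact: expR_gt0.
have aE : a.2 = expR (- - ln a.2) by rewrite opprK lnK.
have l1 : j0%:R <= - ln a.2 by rewrite -lerN2 -ler_expR -aE.
have l2 : - ln a.2 < J%:R by rewrite -ltrN2 -ltr_expR -aE.
have l0 : 0 <= - ln a.2 by apply: le_trans l1.
have /andP[t1 t2] := truncn_itv l0.
exists (Num.truncn (- ln a.2)); split.
- by rewrite -ltnS -(ltr_nat R); apply: le_lt_trans t2.
- by rewrite ltnW // ltnS -(ltr_nat R); apply: le_lt_trans l2.
- rewrite mem_filter al andbT; apply/andP; split.
    by rewrite [X in _ < X]aE ltr_expR ltrN2.
  by rewrite [X in X <= _]aE ler_expR lerN2.
Qed.

(** * Choice of the exponents and the final count *)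

Section numeric.
Variables (d D s eta t : R).
Hypotheses (d0 : 0 < d) (d1 : d <= 1) (D1 : 1 <= D) (s0 : 0 < s) (eta0 : 0 < eta).
Hypotheses (t0 : 0 < t) (ts : 2 * t < s).

(** The scale used for class [j] is about [exp (- eps j)]; this [eps] makes the loss from
    transversality half of the gain [(s - 2 t) j]. *)
Let eps : R := (s - 2 * t) / (4 * s).
(** Decay exponents of the three error terms: transversal sectors, the threshold [t_k], and the
    [nu]-mass of a ball of radius [r_k]. *)
Let rate (l L : R) := Num.min ((s - 2 * t) / 2) (Num.min (2 / 3 * eps * (l / L)) (2 / 3 * eps * eta)).
Let C2 : R := expR (2 * t) * frostc s * (64 * D ^+ 4) `^ s + (2 + frostc eta).

Lemma eps_gt0 : 0 < eps.
Proof. by rewrite divr_gt0 // ?mulr_gt0 // subr_gt0. Qed.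

Lemma rate_gt0 l L : 0 < l -> 0 < L -> 0 < rate l L.
Proof.
move=> l0 L0; have e0 := eps_gt0; have h23 : 0 < 2 / 3 :> R by lra.
rewrite !lt_min; apply/and3P; split.
- by rewrite divr_gt0 // subr_gt0.
- exact: mulr_gt0 (mulr_gt0 h23 e0) (divr_gt0 l0 L0).
- exact: mulr_gt0 (mulr_gt0 h23 e0) eta0.
Qed.

Lemma class_bound (l L : R) A B nu mu m (arcs : pt -> seq (pt * R)) (j K : nat) :
  0 < l -> 0 < L -> wmeas A nu -> wmeas B mu -> tmass nu <= 1 -> tmass mu <= 1 ->
  (forall x y, A x -> B y -> d <= `|y - x|) ->
  (forall x y, (A `|` B) x -> (A `|` B) y -> `|y - x| <= D) ->
  frost eta m nu -> frost s m mu ->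
  (forall x, A x -> \sum_(a <- arcs x) a.2 `^ t <= 1) ->
  L <= eps * j%:R -> eps * j%:R < L * growth K ->
  (2^-1) ^+ m <= rr L K -> (2^-1) ^+ m <= expR (- j%:R) :> R ->
  integ nu (fun x => mass mu [set y |
     ~ (exists2 k, (k <= K)%N & badset nu mu L l k x y) /\
     exists2 a, a \in arc_class (arcs x) j & sector x a y]) ^+ 2 <=
  C2 * expR (- (rate l L * j%:R)).
Proof.
move=> l0 L0 wnu wmu tnu tmu sepAB diamAB fnu fmu sarcs Lj jK mK mj.
have e0 := eps_gt0.
have [k [kj jk]] := scale_index L0 Lj.
have kK : (k < K)%N.
  by apply: (@growth_lt R); rewrite -(ltr_pM2l L0); apply: le_lt_trans kj jK.
have D0 : 0 < D := lt_le_trans ltr01 D1.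
have dD : d <= D := le_trans d1 D1.
have rk0 := rr_gt0 L k; have rk1 := rr_le1 k (ltW L0).
(* The largest [r] allowed by [r * (2 D) <= k * p] when both [k] and [p] are [r_k]. *)
pose r := rr L k ^+ 2 / (2 * D).
have r0 : 0 < r by rewrite divr_gt0 ?exprn_gt0 ?mulr_gt0.
have rrk : r <= rr L k.
  rewrite ler_pdivrMr ?mulr_gt0 //; have D1' := D1; nra.
have Kk : rr L K <= rr L k.
  by rewrite ler_expR lerN2 ler_pM2l // growth_mono // ltnW.
have r1 : r <= 1 by apply: le_trans rk1.
have ball1 : (2^-1) ^+ m <= 32 * D ^+ 3 * expR (- j%:R) / r.
  apply: le_trans mj _; rewrite ler_pdivlMr //.
  have D31 : 1 <= D ^+ 3 by apply: exprn_ege1.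
  have := expR_gt0 (- j%:R : R); nra.
have := fixed_scale_square d0 dD wnu wmu tnu tmu diamAB
  (r := r) (k := rr L k) (p := rr L k) (t := rr l k)
  (g := frostc eta * rr L k `^ eta) (e := expR (- j%:R))
  (g' := frostc s * (32 * D ^+ 3 * expR (- j%:R) / r) `^ s)
  (M := expR (j.+1%:R * t)) (cl := fun x => arc_class (arcs x) j)
  (G := fun x => [set y | ~ (exists2 k, (k <= K)%N & badset nu mu L l k x y) /\
     exists2 a, a \in arc_class (arcs x) j & sector x a y])
  r0 rk0 rk0 rrk (ltW (rr_gt0 l k)).
have frostc0 e : 0 <= e -> 0 <= frostc e :> R by move=> /frostc_ge1; apply: le_trans.
move=> /(_ _ _ _ _ _ _ _ _ _)H; apply: le_trans (H _ _ _ _ _ _ _ _ _) _ => {H}.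
- by rewrite /r divfK ?gt_eqF ?mulr_gt0 // expr2.
- by rewrite mulr_ge0 ?powR_ge0 // frostc0 // ltW.
- move=> x _; apply: (frost_ball x (ltW eta0) wnu fnu tnu); exact: le_trans Kk.
- by rewrite mulr_ge0 ?powR_ge0 // frostc0 // ltW.
- by move=> z _; apply: (frost_ball z (ltW s0) wmu fmu tmu).
- exact: expR_ge0.
- by move=> x Ax; apply: arc_class_size; [exact: ltW|exact: sarcs].
- by move=> x a _; rewrite mem_filter => /andP[/andP[]].
- move=> x y Ax By [nb ay]; split=> // bk; apply: nb; exists k => //; exact: ltnW.
set X := L * growth k.
(* [eps j] is below [L growth (k + 1) = 3/2 X], which explains the factors 2/3 in [rate]. *)
have X2 : 2 / 3 * eps * j%:R < X by move: jk; rewrite growthS /X; lra.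
have j0 : 0 <= j%:R :> R by [].
set b := rate l L.
have b1 : b <= (s - 2 * t) / 2 by rewrite /b /rate ge_min lexx.
have b2 : b <= 2 / 3 * eps * (l / L) by rewrite /b /rate !ge_min lexx /= orbT.
have b3 : b <= 2 / 3 * eps * eta by rewrite /b /rate !ge_min lexx /= !orbT.
rewrite /C2 [leRHS]mulrDl; apply: lerD.
  have -> : 32 * D ^+ 3 * expR (- j%:R) / r = 64 * D ^+ 4 * expR (- j%:R + 2 * X).
    have eX : expR (2 * X) = (expR (- X) ^+ 2)^-1.
      by rewrite -expRM_natl -expRN; congr expR; ring.
    rewrite /r /rr -/X expRD eX; field.
    by rewrite !gt_eqF ?expR_gt0 ?exprn_gt0 ?expR_gt0.
  rewrite powRM ?expR_ge0 ?mulr_ge0 ?exprn_ge0 ?(ltW D0) // -expRM.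
  have -> : expR (j.+1%:R * t) ^+ 2 = expR (2 * t) * expR (2 * j%:R * t).
    by rewrite -expRM_natl -expRD -natr1; congr expR; ring.
  rewrite (_ : _ * _ = (expR (2 * t) * frostc s * (64 * D ^+ 4) `^ s) *
    (expR (2 * j%:R * t) * expR ((- j%:R + 2 * X) * s))); last by ring.
  rewrite ler_wpM2l ?mulr_ge0 ?powR_ge0 ?expR_ge0 ?frostc0 ?(ltW s0) //.
  rewrite -expRD ler_expR.
  (* The exponent [2 j t + (2 X - j) s] with [X <= eps j] is at most [- (s - 2 t) j + 2 eps s j = -
     (s - 2 t) j / 2]. *)
  have epsE : eps * (4 * s) = s - 2 * t by rewrite /eps divfK // gt_eqF // mulr_gt0.
  have q1 : X * s <= eps * j%:R * s by rewrite ler_pM2r.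
  have q2 : b * j%:R <= (s - 2 * t) / 2 * j%:R by rewrite ler_wpM2r.
  have q3 : eps * (4 * s) * j%:R = (s - 2 * t) * j%:R by rewrite epsE.
  lra.
rewrite [leRHS]mulrDl; apply: lerD.
  rewrite ler_pM2l // ler_expR lerN2.
  apply: (@le_trans _ _ (2 / 3 * eps * j%:R * (l / L))).
    have := ler_wpM2r j0 b2; lra.
  apply: le_trans (ler_wpM2r _ (ltW X2)) _; first by rewrite divr_ge0 ?ltW.
  by rewrite /X le_eqVlt; apply/orP; left; apply/eqP; field; rewrite gt_eqF.
rewrite ler_wpM2l ?frostc0 ?(ltW eta0) // /rr -expRM ler_expR mulNr lerN2 -/X.
apply: (@le_trans _ _ (2 / 3 * eps * j%:R * eta)).
  have := ler_wpM2r j0 b3; lra.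
by rewrite ler_pM2r // ltW.
Qed.


Lemma expR_le_exists (e : R) : 0 < e -> exists2 X, 0 <= X & forall c, X <= c -> expR (- c) <= e.
Proof.
move=> e0; exists (Num.max 0 (- ln e)); first by rewrite le_max lexx.
by move=> c; rewrite ge_max => /andP[_]; apply: expR_small.
Qed.

(** The order of the quantifiers matters: [l] depends on the masses only, [L] must be large for [l],
    [j0] for [L]; [J] comes from compactness, and the resolution [m] is chosen last. *)
Lemma frostman_core (cn cm : R) : 0 < cn -> 0 < cm -> exists2 l : R, 0 < l &
  exists L0 : R, forall L, L0 <= L -> exists j0 : nat, forall J : nat, exists m0,
  forall m, (m0 <= m)%N -> forall A B nu mu, wmeas A nu -> wmeas B mu ->
  tmass nu <= 1 -> tmass mu <= 1 ->
  (forall x y, A x -> B y -> d <= `|y - x|) ->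
  (forall x y, (A `|` B) x -> (A `|` B) y -> `|y - x| <= D) ->
  frost eta m nu -> frost s m mu -> cn <= tmass nu -> cm <= tmass mu ->
  (forall x y, A x -> B y -> mass mu (tube (expR (- L)) x y) < expR (- (2 * l))) ->
  (forall x, A x -> exists arcs : seq (pt * R),
     [/\ \sum_(a <- arcs) a.2 `^ t <= 1,
        (forall a, a \in arcs -> expR (- J%:R) < a.2 <= expR (- j0%:R)) &
        (forall y, B y -> exists2 a, a \in arcs & sector x a y)]) ->
  False.
Proof.
move=> cn0 cm0; pose a := cn * cm / 2.
have a0 : 0 < a by rewrite divr_gt0 // mulr_gt0.
have D0 : 0 < D := lt_le_trans ltr01 D1.
have dD : d <= D := le_trans d1 D1.
have e0 := eps_gt0.
have [X1 X10 hX1] : exists2 X, 0 <= X & forall c, X <= c -> expR (- c) <= 2^-1 :> R.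
  exact: expR_le_exists.
have [X2 X20 hX2] : exists2 X, 0 <= X & forall c, X <= c -> expR (- c) <= a / 8 :> R.
  by apply: expR_le_exists; rewrite divr_gt0.
(* Large enough for the bad pairs of all scales to have total mass at most [a], half of
   [cn * cm]. *)
pose l := 1 + 4 * X1 + 2 * X2.
have l0 : 0 < l by rewrite /l; lra.
exists l => //.
have [X3 X30 hX3] : exists2 X, 0 <= X & forall c, X <= c -> expR (- c) <= d / (4 * D) :> R.
  by apply: expR_le_exists; rewrite divr_gt0 ?mulr_gt0.
pose c := 16 * D ^+ 2 / d.
have c1 : 1 <= c.
  rewrite ler_pdivlMr // mul1r; have := d1; have := exprn_ege1 2 D1; lra.
have fc e : 0 < e -> 0 < (2 * frostc e * c `^ e)^-1.
  move=> e1; rewrite invr_gt0 mulr_gt0 ?powR_gt0 ?(lt_le_trans ltr01 c1) //.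
  by rewrite mulr_gt0 // (lt_le_trans ltr01) // frostc_ge1 // ltW.
have [X4 X40 hX4] := expR_le_exists (fc s s0).
have [X5 X50 hX5] := expR_le_exists (fc eta eta0).
exists (1 + 2 * X3 + 2 / s * (3 * l + X4) + 2 / eta * (3 * l + X5)) => L hL.
have p4 : 0 <= 2 / s * (3 * l + X4) by rewrite mulr_ge0 ?divr_ge0 ?(ltW s0) //; lra.
have p5 : 0 <= 2 / eta * (3 * l + X5) by rewrite mulr_ge0 ?divr_ge0 ?(ltW eta0) //; lra.
have L0 : 0 < L by lra.
have L3 : expR (- (L / 2)) <= d / (4 * D) by apply: hX3; lra.
have L4 : X4 <= s * L / 2 - 3 * l.
  have : s * (2 / s * (3 * l + X4)) <= s * L by rewrite ler_pM2l //; lra.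
  rewrite (_ : s * (2 / s * (3 * l + X4)) = 2 * (3 * l + X4)); first lra.
  by field; rewrite gt_eqF.
have L5 : X5 <= eta * L / 2 - 3 * l.
  have : eta * (2 / eta * (3 * l + X5)) <= eta * L by rewrite ler_pM2l //; lra.
  rewrite (_ : eta * (2 / eta * (3 * l + X5)) = 2 * (3 * l + X5)); first lra.
  by field; rewrite gt_eqF.
have ok e u : 0 < e -> expR (- u) <= (2 * frostc e * c `^ e)^-1 ->
    2 * frostc e * c `^ e * expR (- u) <= 1.
  by move=> /fc; rewrite invr_gt0 => e1 h; rewrite mulrC -ler_pdivlMr // mul1r.
have okS := ok _ _ s0 (hX4 _ L4); have okE := ok _ _ eta0 (hX5 _ L5).
pose b := rate l L; have b0 : 0 < b by exact: rate_gt0.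
pose q := expR (- (b / 2)).
have q0 : 0 < q by exact: expR_gt0.
have q1 : q < 1 by rewrite expR_lt1 oppr_lt0 divr_gt0.
(* [C2 <= Cs^2], so the bound on the square can be extracted as [Cs * q ^+ j]. *)
pose Cs := 1 + C2.
have C20 : 0 <= C2.
  rewrite /C2; have := frostc_ge1 (ltW s0); have := frostc_ge1 (ltW eta0) => f1 f2.
  by rewrite !addr_ge0 ?mulr_ge0 ?expR_ge0 ?powR_ge0 // (le_trans ler01).
have Cs0 : 0 < Cs by rewrite /Cs; lra.
have [X6 X60 hX6] : exists2 X, 0 <= X & forall c, X <= c ->
    expR (- c) <= a * (1 - q) / (2 * Cs) :> R.
  by apply: expR_le_exists; rewrite divr_gt0 ?mulr_gt0 // subr_gt0.
(* The first term puts every class beyond scale 0, the second makes the geometric tail from [j0] at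
   most [a / 2]. *)
exists (Num.bound (L / eps + X6 / (b / 2))) => J; set j0 := Num.bound _.
have hj0 : L / eps + X6 / (b / 2) < j0%:R.
  by apply: archi_boundP; apply: addr_ge0; [exact: divr_ge0 (ltW L0) (ltW e0)|exact: divr_ge0 X60 (divr_ge0 (ltW b0) (ler0n _ 2))].
have hjL j : (j0 <= j)%N -> L <= eps * j%:R.
  rewrite -(ler_nat R) => j0j; rewrite mulrC -ler_pdivrMr //; apply: le_trans j0j.
  by apply: le_trans (ltW hj0); rewrite lerDl; exact: divr_ge0 X60 (divr_ge0 (ltW b0) (ler0n _ 2)).
have qj0 : q ^+ j0 <= a * (1 - q) / (2 * Cs).
  rewrite /q -expRM_natl mulrN; apply: hX6; rewrite -ler_pdivrMr ?divr_gt0 //.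
  by apply: le_trans (ltW hj0); rewrite lerDr; exact: divr_ge0 (ltW L0) (ltW e0).
(* Classes up to [J] use only the scales below [K], so a finite resolution [m] suffices. *)
have [K hK] := @growth_unbounded R (eps * J%:R / L).
have [m1 hm1] := half_small (rr_gt0 L K).
have [m2 hm2] := half_small (expR_gt0 (- J%:R : R)).
exists (maxn m1 m2) => m; rewrite geq_max => /andP[/hm1 mK /hm2 mJ].
move=> A B nu mu wnu wmu tnu tmu sepAB diamAB fnu fmu cnu cmu tubes arcsE.
have /choice[arcs harcs] : forall x, exists arcs : seq (pt * R), A x ->
     [/\ \sum_(a <- arcs) a.2 `^ t <= 1,
        (forall a, a \in arcs -> expR (- J%:R) < a.2 <= expR (- j0%:R)) &
        (forall y, B y -> exists2 a, a \in arcs & sector x a y)].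
  move=> x; have [/arcsE[ar h]|nA] := pselect (A x); first by exists ar.
  by exists [::].
have jK j : (j < J.+1)%N -> eps * j%:R < L * growth K.
  rewrite ltnS -(ler_nat R) => jJ; rewrite -ltr_pdivrMl // mulrC.
  by apply: le_lt_trans hK; rewrite ler_pM2r ?invr_gt0 // ler_pM2l.
pose U x := [set y | exists2 k, (k <= K)%N & badset nu mu L l k x y].
have badU : integ nu (fun x => mass mu (U x)) <= a.
  apply: (@le_trans _ _ (8 * expR (- (l / 2)))); last first.
    have : expR (- (l / 2)) <= a / 8 by apply: hX2; rewrite /l; lra.
    lra.
  apply: le_trans (bad_sum _ (ltW l0) _); last by apply: hX1; rewrite /l; lra.
  apply: (bad_mass d0 dD wnu wmu tnu tmu sepAB diamAB s0 eta0 (ltW L0) fnu fmu L3) => //.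
  - exact: le_trans L4.
  - exact: le_trans L5.
  - move=> k kK; apply: le_trans mK _.
    apply: (@le_trans _ _ (expR (- (L * growth k / 2)))); last first.
      by rewrite ler_peMl ?expR_ge0.
    rewrite ler_expR lerN2 -mulrA ler_pM2l //.
    have := @growth_mono R _ _ (ltnW kK); have := @growth_ge1 R k; lra.
  (* At scale 0 a bad pair would need [mu]-mass at least [t_0^2 = exp (- 2 l)] in its tube, as [nu]
     has mass at most 1. *)
  - move=> x y Ax By; rewrite /badset /badpair /= /rr /growth expr0 !mulr1.
    apply/negP; rewrite -ltNge -expRM_natl mulrN; apply: le_lt_trans (tubes x y Ax By).
    rewrite ler_piMr ?(mass_ge0 _ wmu) //.
    exact: le_trans (mass_le_tmass _ wnu) tnu.
pose G j x := [set y | ~ U x y /\ exists2 a, a \in arc_class (arcs x) j & sector x a y].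
have wj j : (j0 <= j < J.+1)%N -> integ nu (fun x => mass mu (G j x)) <= Cs * q ^+ j.
  move=> /andP[j0j jJ].
  have mj : (2^-1) ^+ m <= expR (- j%:R) :> R.
    by apply: le_trans mJ _; rewrite ler_expR lerN2 ler_nat -ltnS.
  have sa x : A x -> \sum_(a <- arcs x) a.2 `^ t <= 1 by move=> /harcs[].
  have h := class_bound l0 L0 wnu wmu tnu tmu sepAB diamAB fnu fmu sa
    (hjL j j0j) (jK j jJ) mK mj.
  have qE : expR (- (b * j%:R)) = (q ^+ j) ^+ 2.
    by rewrite /q -!expRM_natl; congr expR; field.
  rewrite -ler_sqr ?nnegrE ?mulr_ge0 ?exprn_ge0 ?(ltW Cs0) ?(ltW q0) //; last first.
    by apply: (integ_ge0 wnu) => x _; exact: (mass_ge0 _ wmu).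
  apply: le_trans h _; rewrite -/b qE exprMn ler_wpM2r ?sqr_ge0 // /Cs.
  have := C20; nra.
(* All pairs, of mass at least [2 a], are bad or belong to a class; together these have mass at most
   [a + a / 2]. *)
have : cn * cm <= a + \sum_(j0 <= j < J.+1) Cs * q ^+ j.
  apply: (@le_trans _ _ (integ nu (fun=> tmass mu))).
    rewrite integ_const mulrC; apply: ler_pM => //; exact: ltW.
  apply: (@le_trans _ _ (integ nu (fun x => mass mu (U x) + \sum_(j0 <= j < J.+1) mass mu (G j x)))).
    apply: (integ_le wnu) => x Ax.
    pose F (i : option nat) := if i is Some j then G j x else U x.
    have -> : mass mu (U x) + \sum_(j0 <= j < J.+1) mass mu (G j x) =
        \sum_(i <- None :: map Some (index_iota j0 J.+1)) mass mu (F i).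
      by rewrite big_cons big_map.
    have -> : tmass mu = mass mu setT.
      by apply: eq_integ => y; rewrite indic_in.
    apply: (mass_bigU wmu) => y By _.
    have [Uy|nUy] := pselect (U x y); first by exists None; rewrite ?mem_head.
    have [_ hb cov] := harcs x Ax; have [ar arl sy] := cov y By.
    have /andP[b1 b2] := hb ar arl.
    have [j [j1 j2 j3]] := arc_class_mem arl b1 b2.
    exists (Some j); last by split=> //; exists ar.
    by rewrite inE /=; apply: map_f; rewrite mem_index_iota j1.
  rewrite integD integ_sum; apply: lerD => //.
  by apply: ler_sum_nat => j hj; exact: wj.
rewrite -mulr_sumr; apply/negP; rewrite -ltNge.
have := geometric_sum_le J.+1 j0 (ltW q0) q1; set S := \sum_(_ <= _ < _) _ => hS.
have q10 : 0 < 1 - q by rewrite subr_gt0.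
have : Cs * S <= a / 2.
  apply: le_trans (ler_wpM2l (ltW Cs0) hS) _.
  have : q ^+ j0 / (1 - q) <= a / (2 * Cs).
    rewrite ler_pdivrMr //; apply: le_trans qj0 _; rewrite le_eqVlt; apply/orP; left.
    by apply/eqP; ring.
  move=> h; apply: le_trans (ler_wpM2l (ltW Cs0) h) _.
  by rewrite le_eqVlt; apply/orP; left; apply/eqP; field; rewrite gt_eqF.
have aE : cn * cm = 2 * a by rewrite /a; field.
rewrite aE; move: (Cs * S) a0 => w; lra.
Qed.

End numeric.
End core.

(** * From Hausdorff measure to arcs *)

Section continuity.
Context {R : realType}.
Local Notation pt := 'rV[R]_2.
Implicit Types (x y z u v w : pt).

Lemma cvg_coord (T : topologicalType) (f : T -> pt) (p : T) i :
  f q @[q --> p] --> f p -> f q 0 i @[q --> p] --> f p 0 i.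
Proof. move=> cf.
exact: (@continuous_comp T pt R f (fun u : pt => u 0 i) p cf (@coord_continuous _ _ _ 0 i _)). Qed.

Lemma cvg_cross (T : topologicalType) (f g : T -> pt) (p : T) :
  f q @[q --> p] --> f p -> g q @[q --> p] --> g p ->
  cross (f q) (g q) @[q --> p] --> cross (f p) (g p).
Proof.
by move=> cf cg; apply: cvgB; apply: cvgM; apply: cvg_coord.
Qed.

Lemma cvg_enorm (T : topologicalType) (f : T -> pt) (p : T) :
  f q @[q --> p] --> f p -> enorm (f q) @[q --> p] --> enorm (f p).
Proof.
move=> cf; rewrite (_ : (fun q => enorm (f q)) =
  (fun q => Num.sqrt (f q 0 0 * f q 0 0 + f q 0 1 * f q 0 1))); last first.
  by apply/funext => q; rewrite enorm2 !expr2.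
rewrite enorm2 !expr2.
apply: (@continuous_comp _ _ _ (fun q => f q 0 0 * f q 0 0 + f q 0 1 * f q 0 1) Num.sqrt).
  by apply: cvgD; apply: cvgM; apply: cvg_coord.
exact: sqrt_continuous.
Qed.

(** Joint continuity of the radial projection off the diagonal. It makes membership in a sector an
    open condition in both variables, as the compactness arguments require. *)
Lemma sector_near x y (a : pt * R) : x != y -> sector x a y ->
  \forall y' \near y & x' \near x, sector x' a y'.
Proof.
move=> xy sxy.
pose f (q : pt * pt) := radial_proj q.2 q.1.
have cf : f q @[q --> (y, x)] --> f (y, x).
  have cd : (q.1 - q.2 : pt) @[q --> (y, x)] --> (y, x).1 - (y, x).2.
    by apply: cvgB; [exact: cvg_fst|exact: cvg_snd].
  rewrite /f /radial_proj; apply: cvgZ => //; apply: cvgV; last exact: (cvg_enorm cd).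
  rewrite gt_eqF //; apply: lt_le_trans (norm_enorm _).
  by rewrite normr_gt0 subr_eq0 eq_sym.
have : \forall q \near (y, x), `|f (y, x) - f q| < a.2 - `|radial_proj x y - a.1|.
  move/cvgrPdist_lt : cf; apply; by rewrite subr_gt0.
apply: filterS => -[y' x'] /=; rewrite /f /sector /= => h.
rewrite (_ : _ - a.1 = (radial_proj x y - a.1) - (radial_proj x y - radial_proj x' y')); last first.
  by rewrite opprB [RHS]addrC addrA subrK.
by apply: le_lt_trans (ler_normB _ _) _; lra.
Qed.

Lemma Delta_near x0 y0 y (h : R) : 0 < h -> \forall y' \near y & q \near (x0, y0),
  `|Delta x0 y0 y - Delta q.1 q.2 y'| < h.
Proof.
move=> h0; pose f (p : pt * (pt * pt)) := Delta p.2.1 p.2.2 p.1.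
have cf : f p @[p --> (y, (x0, y0))] --> f (y, (x0, y0)).
  have c1 : p.1 @[p --> (y, (x0, y0))] --> y by exact: cvg_fst.
  have c2 : p.2 @[p --> (y, (x0, y0))] --> (x0, y0) by exact: cvg_snd.
  have c21 : p.2.1 @[p --> (y, (x0, y0))] --> x0 by apply: cvg_comp c2 _; exact: cvg_fst.
  have c22 : p.2.2 @[p --> (y, (x0, y0))] --> y0 by apply: cvg_comp c2 _; exact: cvg_snd.
  by rewrite /f /Delta; apply: cvg_cross; apply: cvgB.
by move/cvgrPdist_lt : cf => /(_ h h0).
Qed.

Lemma closed_Delta0 x0 y0 : closed [set y | Delta x0 y0 y = 0].
Proof.
rewrite -openC openE => y /= /eqP; rewrite -normr_gt0 => h0.
have [[U V] /= [nU nV] UV] := Delta_near x0 y0 y h0.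
rewrite /interior; apply: filterS nU => y' Uy' /= e.
have := UV (y', (x0, y0)) (conj Uy' (nbhs_singleton nV)).
by rewrite /= e subr0 ltxx.
Qed.

Lemma closed_cball x (r : R) : closed [set y | `|y - x| <= r].
Proof.
have -> : [set y | `|y - x| <= r] = closed_ball_ Num.norm x r.
  by apply/seteqP; split => y; rewrite /closed_ball_ /= distrC.
exact: closed_closed_ball_.
Qed.

Lemma compact_cball x (r : R) : compact [set y | `|y - x| <= r].
Proof.
apply: bounded_closed_compact; last exact: closed_cball.
exists (`|x| + r); split; first exact: num_real.
move=> M hM y /= yx; apply: le_trans (ltW hM).
rewrite -[y](subrK x) addrC; apply: le_trans (ler_normD _ _) _.
by rewrite lerD2l.
Qed.

End continuity.


(** * Finite families of arcs covering a projection *)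

Section arcs.
Context {R : realType}.
Local Notation pt := 'rV[R]_2.
Implicit Types (x y z u v w : pt).

Lemma le_diam (U : set pt) u v : U u -> U v -> ((enorm (u - v))%:E <= diam U)%E.
Proof.
by move=> Uu Uv; rewrite /diam le_max; apply/orP; right; apply: ereal_sup_ubound; exists u => //; exists v.
Qed.

Lemma diam_ge0 (U : set pt) : (0 <= diam U)%E.
Proof. by rewrite /diam le_max lexx. Qed.

Lemma diam_pow_ge0 (s : R) (U : set pt) : (0 <= diam_pow s U)%E.
Proof. by rewrite /diam_pow; case: ifP => // _; exact: poweR_ge0. Qed.

Lemma measure0_cover (s : R) (A : set pt) (e : R) : 0 < e -> hausdorff_measure s A = 0%E ->
  exists U : nat -> set pt, [/\ A `<=` \bigcup_i U i, (forall i, (diam (U i) <= 1%:E)%E) &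
    (\sum_(0 <= i <oo) diam_pow s (U i) < e%:E)%E].
Proof.
move=> e0 m0.
have : (hausdorff_content s 1 A <= 0)%E.
  by rewrite -m0; apply: ereal_sup_ubound; exists 1 => //=.
move=> /le_lt_trans /(_ (_ : 0 < e%:E)%E); rewrite lte_fin => /(_ e0).
by move=> /ereal_inf_lt[_ [U [AU dU] <-]] lt; exists U.
Qed.

Lemma arcs_of_measure x (K Q : set pt) (s0 t e : R) : 0 <= s0 -> s0 <= t -> 0 < t -> 0 < e ->
  hausdorff_measure s0 (radial_proj x @` (K `\ x)) = 0%E -> compact Q -> Q `<=` K `\ x ->
  exists arcs : seq (pt * R), [/\ \sum_(a <- arcs) a.2 `^ t <= e,
    (forall a, a \in arcs -> 0 < a.2) & (forall y, Q y -> exists2 a, a \in arcs & sector x a y)].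
Proof.
move=> s00 st t0 e0 m0 cQ QK.
have c0 : 0 < 2 `^ t :> R by apply: powR_gt0.
have e'0 : 0 < e / 2 / 2 `^ t by rewrite !divr_gt0.
have [U [AU dU sU]] := measure0_cover e'0 m0.
pose dd i := fine (diam (U i)).
have ddE i : (dd i)%:E = diam (U i).
  rewrite fineK // ge0_fin_numE ?diam_ge0 //; apply: le_lt_trans (dU i) _; exact: ltry.
have dd0 i : 0 <= dd i by rewrite -lee_fin ddE diam_ge0.
have dd1 i : dd i <= 1 by rewrite -lee_fin ddE.
(* Sets of diameter 0 also need an arc of positive radius; the [t]-th powers of these radii sum to
   at most [e / 2]. *)
pose tiny i : R := (e / 2 * (2^-1) ^+ i.+1) `^ (t^-1).
have tinyE i : tiny i `^ t = e / 2 * (2^-1) ^+ i.+1.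
  by rewrite /tiny -powRrM mulVf ?gt_eqF // powRr1 // mulr_ge0 ?exprn_ge0 // divr_ge0 // ltW.
have tiny0 i : 0 < tiny i by rewrite powR_gt0 // mulr_gt0 ?exprn_gt0 // divr_gt0.
pose rho i := Num.max (2 * dd i) (tiny i).
have rho0 i : 0 < rho i by rewrite lt_max tiny0 orbT.
have /choice[u hu] : forall i, exists u, U i !=set0 -> U i u.
  by move=> i; have [[u Uu]|no] := pselect (U i !=set0); [exists u|exists 0].
have cov y : Q y -> exists i, sector x (u i, rho i) y.
  move=> /QK Ky; have [i _ Ui] := AU (radial_proj x y) (ex_intro2 _ _ y Ky erefl).
  exists i; rewrite /sector /= /rho lt_max.
  have Uu : U i (u i) by apply: hu; exists (radial_proj x y).
  have : `|radial_proj x y - u i| <= dd i.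
    by apply: le_trans (norm_enorm _) _; rewrite -lee_fin ddE; exact: le_diam.
  have [d0 h|d0 h] := ltP 0 (dd i); first by apply/orP; left; lra.
  by apply/orP; right; apply: le_lt_trans (tiny0 i); apply: le_trans d0.
move/compact_near_coveringP : cQ => /(_ nat \oo (fun n y => exists2 i, (i < n)%N & sector x (u i, rho i) y) _).
case=> [y Qy|n0 _ hn0].
  have [i si] := cov y Qy.
  have xy : x != y by apply/eqP => xy; have [_] := QK y Qy; apply; rewrite xy.
  have [[V W] /= [nV nW] VW] := sector_near xy si.
  exists (V, [set n | (i < n)%N]) => /=; first by split=> //; exists i.+1.
  move=> [y' n] /= [Vy' ni]; exists i => //.
  exact: (VW (y', x) (conj Vy' (nbhs_singleton nW))).
exists [seq (u i, rho i) | i <- iota 0 n0]; split.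
- rewrite big_map.
  apply: (@le_trans _ _ (\sum_(i <- iota 0 n0) (2 `^ t * dd i `^ t + e / 2 * (2^-1) ^+ i.+1))).
    apply: ler_sum => i _ /=; rewrite -tinyE -powRM // /rho.
    have := powR_ge0 (2 * dd i) t; have := powR_ge0 (tiny i) t.
    by rewrite /Num.max; case: ifP => _; lra.
  rewrite big_split /= -mulr_sumr [leRHS]splitr; apply: lerD.
    rewrite mulrC -ler_pdivlMr // -lee_fin -sumEFin; apply: le_trans (ltW sU).
    apply: (@le_trans _ _ (\sum_(i <- iota 0 n0) diam_pow s0 (U i))%E).
      (* The bound 1 on the diameters and [s0 <= t] give the comparison of powers. An empty set has
         weight 0 and also diameter 0. *)
      apply: lee_sum => i _; rewrite /diam_pow; case: ifPn => [/eqP U0|_].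
        rewrite lee_fin /dd /diam U0.
        rewrite (_ : [set _ | _ in _ & _ in _] = set0); last first.
          by apply/seteqP; split=> // ? [].
        by rewrite ereal_sup0 max_l ?leNye //= powR0 // gt_eqF.
      rewrite -ddE poweR_EFin lee_fin.
      have [->|dn0] := eqVneq (dd i) 0; first by rewrite powR0 ?powR_ge0 // gt_eqF.
      by apply: ger_powR => //; rewrite dd1 lt_def dn0 dd0.
    rewrite (_ : iota 0 n0 = index_iota 0 n0); last by rewrite /index_iota subn0.
    by apply: nneseries_lim_ge => *; exact: diam_pow_ge0.
  rewrite -mulr_sumr ger_pMr ?divr_gt0 //.
  have := @geometric_sum_le R (2^-1) n0 0; rewrite /index_iota subn0 expr0 => h.
  have -> : \sum_(i <- iota 0 n0) (2^-1 : R) ^+ i.+1 = 2^-1 * \sum_(i <- iota 0 n0) (2^-1) ^+ i.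
    by rewrite mulr_sumr; apply: eq_bigr => i _; rewrite exprS.
  have := h _ _; rewrite (_ : 1 - 2^-1 = 2^-1 :> R); last by lra.
  rewrite invrK mul1r => /(_ _ _) h2; have : \sum_(i <- iota 0 n0) (2^-1 : R) ^+ i <= 2 by apply: h2; lra.
  lra.
- by move=> a /mapP[i _ ->] /=.
- move=> y Qy; have [i ni si] := hn0 n0 (leqnn _) y Qy.
  by exists (u i, rho i) => //; apply: map_f; rewrite mem_iota.
Qed.

End arcs.

(** * Passage to compact sets *)

Section bridge.
Context {R : realType}.
Local Notation pt := 'rV[R]_2.
Implicit Types (x y z u v w : pt) (A B K : set pt).

Lemma dcube_dist (q : dyadic) x y : dcube q x -> dcube q y -> `|x - y| <= (2^-1) ^+ q.1.
Proof.
move=> qx qy; have g0 : 0 < 2 ^+ q.1 :> R by rewrite exprn_gt0.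
have key i : Num.floor (2 ^+ q.1 * x 0 i) = Num.floor (2 ^+ q.1 * y 0 i) ->
    `|(x - y) 0 i| <= (2^-1) ^+ q.1.
  move=> e; rewrite !mxE exprVn -[leRHS]mul1r ler_pdivlMr // mulrC.
  rewrite -{1}[2 ^+ q.1]gtr0_norm // -normrM mulrBr.
  have := floor_itv (2 ^+ q.1 * x 0 i); have := floor_itv (2 ^+ q.1 * y 0 i).
  rewrite e intrD => /andP[h1 h2] /andP[h3 h4]; rewrite ler_norml; apply/andP; split; lra.
move: qx qy; rewrite /dcube /= => <- [e1 e2].
by apply: norm_coord; rewrite ?exprn_ge0 ?key.
Qed.

Lemma diam_dcube (q : dyadic) : (diam (dcube q : set pt) <= (2 * (2^-1) ^+ q.1)%:E)%E.
Proof.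
rewrite /diam ge_max lee_fin mulr_ge0 ?exprn_ge0 //=.
apply: ge_ereal_sup => _ [x qx [y qy <-]]; rewrite lee_fin.
by apply: le_trans (enorm_norm _) _; rewrite ler_pM2l //; exact: dcube_dist.
Qed.

Lemma hausdorff_measure_ge0 (s : R) A : (0 <= hausdorff_measure s A)%E.
Proof.
apply: (@le_trans _ _ (hausdorff_content s 1 A)).
  apply: le_ereal_inf_tmp => _ [U _ <-].
  by apply: nneseries_ge0 => *; exact: diam_pow_ge0.
by apply: ereal_sup_ubound; exists 1 => //=.
Qed.

(** A cover of small total weight has only small squares, so it is admissible for every [delta]. *)
Lemma dnull_measure0 (s : R) A : 0 < s -> dnull s A -> hausdorff_measure s A = 0%E.
Proof.
move=> s0 nA; apply/eqP; rewrite eq_le hausdorff_measure_ge0 andbT.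
apply: ge_ereal_sup => _ [delta /= d0 <-].
apply/lee_addgt0Pr => e e0; rewrite add0e.
have c0 : 0 < 2 `^ s :> R by apply: powR_gt0.
(* The second entry of the minimum forces each diameter below [delta], the first controls the sum;
   [2 ^ s] is the loss from side to Euclidean diameter. *)
have m0 : 0 < Num.min e (delta `^ s) / 2 `^ s by rewrite divr_gt0 // lt_min e0 powR_gt0.
have [S AS Sv] := nA _ m0; set v := _ / _ in m0 Sv.
have ve : 2 `^ s * v <= e by rewrite /v mulrC divfK ?gt_eqF // ge_min lexx.
have vd : 2 `^ s * v <= delta `^ s by rewrite /v mulrC divfK ?gt_eqF // ge_min lexx orbT.
have dwtE (q : dyadic) : (2 * (2^-1) ^+ q.1) `^ s = 2 `^ s * dwt s q :> R.
  rewrite powRM ?exprn_ge0 // /dwt; congr (_ * _).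
  by rewrite -powR_mulrn ?powR_ge0 // -powRrM mulrC powRrM powR_mulrn // invr_ge0.
pose U n : set pt := if pickle_inv n is Some q then (if `[< S q >] then dcube q else set0) else set0.
have diam0 : diam (set0 : set pt) = 0%E.
  rewrite /diam (_ : [set _ | _ in _ & _ in _] = set0); last by apply/seteqP; split=> // ? [].
  by rewrite ereal_sup0 max_l ?leNye.
apply: ge_ereal_inf; exists (\sum_(0 <= i <oo) diam_pow s (U i))%E.
  exists U => //; split.
    move=> x /AS[q Sq qx]; exists (pickle q) => //.
    by rewrite /U pickleK_inv asboolT.
  move=> i; rewrite /U; case: pickle_inv => [q|]; last by rewrite diam0 lee_fin ltW.
  case: ifP => [/asboolP Sq|_]; last by rewrite diam0 lee_fin ltW.
  apply: le_trans (diam_dcube q) _; rewrite lee_fin leNgt; apply/negP => lt.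
  have : delta `^ s < (2 * (2^-1) ^+ q.1) `^ s.
    by apply: gt0_ltr_powR; rewrite ?nnegrE ?(ltW d0) // mulr_ge0 ?exprn_ge0.
  rewrite dwtE ltNge => /negP; apply; apply: le_trans vd; rewrite ler_pM2l //.
  have := Sv [:: q]; rewrite big_seq1; apply => // q'; by rewrite inE => /eqP ->.
apply: lime_le; first by apply: is_cvg_nneseries => *; exact: diam_pow_ge0.
apply: nearW => n; apply: le_trans (_ : (2 `^ s * v)%:E <= _)%E; last by rewrite lee_fin.
pose F := [seq q <- pmap pickle_inv (iota 0 n) | `[< S q >]] : seq dyadic.
have uF : uniq F.
  rewrite filter_uniq // (pmap_uniq (@pickle_invK _)) // iota_uniq //.
have : \sum_(q <- F) dwt s q <= v.
  by apply: Sv => // q; rewrite mem_filter => /andP[/asboolP].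
rewrite -(ler_pM2l c0) -lee_fin; apply: le_trans.
rewrite mulr_sumr -sumEFin /F big_filter /index_iota subn0.
elim: (iota 0 n) => [|i l IH]; first by rewrite !big_nil.
rewrite big_cons /= {1}/U; case: (pickle_inv i) => [q|] /=; last first.
  by rewrite /diam_pow eqxx add0e.
rewrite big_cons; case: ifP => Sq; last first.
  by rewrite /diam_pow eqxx add0e.
apply: leeD => //; rewrite /diam_pow; case: ifP => _.
  by rewrite lee_fin mulr_ge0 ?dwt_ge0 // ltW.
have := diam_dcube q; have := diam_ge0 (dcube q : set pt).
case: (diam _) => [r||] //; rewrite !lee_fin => r0 rq.
rewrite -dwtE; apply: ge0_ler_powR => //; rewrite ?nnegrE ?mulr_ge0 ?exprn_ge0 //.
exact: ltW.
Qed.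

(** The traces of lines on [P] have small covers, uniformly for nearby lines by compactness. The
    measure [mu] is quantified after [r], since it depends on the resolution chosen later. *)
Lemma tube_small (E P : set pt) (s : R) : 0 <= s -> compact E -> compact P ->
  (forall x0 y0, E x0 -> P y0 -> forall e, 0 < e -> exists l : seq (pt * R),
     [/\ \sum_(a <- l) a.2 `^ s <= e, (forall a, a \in l -> 0 < a.2) &
       forall y, P y -> Delta x0 y0 y = 0 -> exists2 a, a \in l & `|y - a.1| < a.2]) ->
  forall e, 0 < e -> exists r : R, 0 < r /\ exists m0, forall m, (m0 <= m)%N ->
    forall mu, wmeas P mu -> frost s m mu -> tmass mu <= 1 ->
    forall x y, E x -> P y -> mass mu (tube r x y) < e.
Proof.
move=> s0 cE cP lines e e0.
pose Phi (i : nat) (p : pt * pt) := forall m, (i <= m)%N ->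
    forall mu, wmeas P mu -> frost s m mu -> tmass mu <= 1 ->
    mass mu (tube ((2^-1) ^+ i) p.1 p.2) < e.
have /compact_near_coveringP/(_ nat \oo Phi _) := compact_setX cE cP.
case=> [[x0 y0] [/= Ex0 Py0]|i0 _ hi0]; last first.
  exists ((2^-1) ^+ i0); split; first by rewrite exprn_gt0.
  exists i0 => m im mu wmu fmu tmu x y Ex Py.
  exact: (hi0 i0 (leqnn _) (x, y) (conj Ex Py) m im mu wmu fmu tmu).
have f0 : 0 < frostc s by apply: lt_le_trans (frostc_ge1 s0).
have e'0 : 0 < e / 2 / frostc s by rewrite !divr_gt0.
have [l [sl l0 lcov]] := lines x0 y0 Ex0 Py0 _ e'0.
pose O y := exists2 a, a \in l & `|y - a.1| < a.2.
(* Away from the cover [O] the area [Delta] does not vanish on [P], so by compactness thin tubes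
   around nearby lines meet [P] inside [O]. *)
have [[Q I1] /= [nQ [n1 _ hn1]] h1] : \forall q \near (x0, y0) & i \near \oo,
    forall y, P y -> `|Delta q.1 q.2 y| < (2^-1) ^+ i -> O y.
  have FF : Filter (filter_prod (nbhs (x0, y0)) (\oo : set_system nat)) by exact: filter_prod_filter.
  move/compact_near_coveringP : cP => /(_ _ _
     (fun (p : (pt * pt) * nat) y => `|Delta p.1.1 p.1.2 y| < (2^-1) ^+ p.2 -> O y) FF); apply.
  move=> y Py; have [D0|/eqP] := pselect (Delta x0 y0 y = 0).
    have [a al ya] := lcov y Py D0.
    exists (ball y (a.2 - `|y - a.1|), setT) => /=.
      by split; [apply: nbhsx_ballx; rewrite subr_gt0|exact: filterT].
    move=> [y' p] /= [yy' _] _; exists a => //.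
    move: yy'; rewrite -ball_normE /= => yy'.
    rewrite (_ : y' - a.1 = (y - a.1) - (y - y')); last by rewrite opprB [RHS]addrC addrA subrK.
    by apply: le_lt_trans (ler_normB _ _) _; lra.
  rewrite -normr_gt0 => h0; have h20 : 0 < `|Delta x0 y0 y| / 2 by lra.
  have [[U V] /= [nU nV] UV] := Delta_near x0 y0 y h20.
  have [m0 hm0] := half_small h20.
  exists (U, [set p | V p.1 /\ (m0 <= p.2)%N]) => /=.
    split=> //; exists (V, [set n | (m0 <= n)%N]) => //=.
    by split=> //; exists m0.
  move=> [y' [q i]] /= [Uy' [Vq mi]] lt; exfalso.
  have := UV (y', q) (conj Uy' Vq) => /= lt2; have := hm0 i mi => le3.
  have : `|Delta x0 y0 y| <= `|Delta x0 y0 y - Delta q.1 q.2 y'| + `|Delta q.1 q.2 y'|.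
    by rewrite -{1}(subrK (Delta q.1 q.2 y') (Delta x0 y0 y)); exact: ler_normD.
  lra.
(* The balls of the cover must not be smaller than the resolution of [mu]. *)
have [n2 hn2] : exists n2, forall m a, (n2 <= m)%N -> a \in l -> ((2^-1) ^+ m : R) <= a.2.
  elim: l l0 {sl lcov O h1} => [|a l IH] l0; first by exists 0%N.
  have [|k hk] := IH; first by move=> b bl; apply: l0; rewrite inE bl orbT.
  have [k' hk'] := half_small (l0 a (mem_head _ _)).
  exists (maxn k k') => m b; rewrite geq_max => /andP[km k'm].
  by rewrite inE => /orP[/eqP ->|]; [exact: hk'|exact: hk].
have : \forall q \near (x0, y0) & i \near \oo,
    (forall y, P y -> `|Delta q.1 q.2 y| < (2^-1) ^+ i -> O y) /\
    (forall m a, (i <= m)%N -> a \in l -> ((2^-1) ^+ m : R) <= a.2).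
  exists (Q, [set i | (n1 <= i)%N /\ (n2 <= i)%N]) => /=.
    by split=> //; exists (maxn n1 n2) => // i /=; rewrite geq_max => /andP[].
  move=> [q i] /= [Qq [ni n2i]]; split.
    by apply: (h1 (q, i)); split=> //; exact: hn1.
  by move=> m a im; apply: hn2; exact: leq_trans im.
apply: filterS => -[[x y] i] /= [g1 g2] m im mu wmu fmu tmu.
apply: (@le_lt_trans _ _ (\sum_(a <- l) mass mu [set z | `|z - a.1| <= a.2])).
  apply: (mass_bigU wmu) => z Pz /g1 [] // a al za; exists a => //=; exact: ltW.
apply: (@le_lt_trans _ _ (\sum_(a <- l) frostc s * a.2 `^ s)).
  rewrite big_seq [leRHS]big_seq; apply: ler_sum => a al.
  by apply: (frost_ball _ s0 wmu fmu tmu); apply: g2 im al.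
rewrite -mulr_sumr; apply: (@le_lt_trans _ _ (e / 2)); last by lra.
by rewrite mulrC -ler_pdivlMr.
Qed.


(* From x1 off the line, the radial projection is bi-Lipschitz on the line, so
   the line inherits the smallness of the projection of K. *)
Lemma line_cover K P x1 x0 y0 z (rz s0 t s : R) : compact P -> P `<=` K ->
  (forall y, P y -> `|y - z| <= rz) -> 0 <= s0 -> s0 <= t -> 0 < t -> t <= s ->
  hausdorff_measure s0 (radial_proj x1 @` (K `\ x1)) = 0%E -> Delta x0 y0 x1 != 0 ->
  forall e, 0 < e -> exists l : seq (pt * R),
     [/\ \sum_(a <- l) a.2 `^ s <= e, (forall a, a \in l -> 0 < a.2) &
       forall y, P y -> Delta x0 y0 y = 0 -> exists2 a, a \in l & `|y - a.1| < a.2].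
Proof.
move=> cP PK Pz s00 st t0 ts m0 D0 e e0.
pose Q := P `&` [set y | Delta x0 y0 y = 0].
have cQ : compact Q.
  apply: (subclosed_compact _ cP) => [|y []//].
  by apply: closedI; [exact: compact_closed|exact: closed_Delta0].
have QK : Q `<=` K `\ x1.
  move=> y [Py /= D0y]; split; first exact: PK.
  by move=> yx1; move: D0; rewrite -yx1 D0y eqxx.
pose h := `|Delta x0 y0 x1|; have h0 : 0 < h by rewrite normr_gt0.
pose D := `|rz + `|z - x1| |.
have yD y : P y -> `|y - x1| <= D.
  move=> /Pz yz; apply: le_trans (ler_norm _).
  rewrite (_ : y - x1 = (y - z) + (z - x1)); last by rewrite addrA subrK.
  by apply: le_trans (ler_normD _ _) _; rewrite lerD2r.
(* Lipschitz constant of the inverse projection on the line; the 1 makes the last inequality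
   strict. *)
pose C := 16 * D ^+ 2 * `|y0 - x0| / h + 1.
have C0 : 0 < C.
  apply: ltr_wpDl => //; apply: divr_ge0; last exact: ltW.
  exact: mulr_ge0 (mulr_ge0 (ler0n _ 16) (sqr_ge0 D)) (normr_ge0 _).
have Cs0 : 0 < C `^ s by exact: powR_gt0.
(* The bound 1 forces all radii below 1, so that their [s]-th powers are at most their [t]-th
   powers. *)
have e'0 : 0 < Num.min 1 (e / C `^ s) by rewrite lt_min ltr01 divr_gt0.
have [arcs [sa a0 cova]] := arcs_of_measure s00 st t0 e'0 m0 cQ QK.
have a1 a : a \in arcs -> a.2 <= 1.
  move=> al; rewrite leNgt; apply/negP => lt.
  have : 1 `^ t < a.2 `^ t by apply: gt0_ltr_powR; rewrite ?nnegrE // ltW // a0.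
  rewrite powR1 ltNge => /negP; apply.
  apply: (@le_trans _ _ (\sum_(a <- arcs) a.2 `^ t)).
    rewrite (big_rem a) //= lerDl; apply: sumr_ge0 => *; exact: powR_ge0.
  by apply: le_trans sa _; rewrite ge_min lexx.
have /choice[w hw] : forall a, exists w, (exists y, Q y /\ sector x1 a y) -> Q w /\ sector x1 a w.
  by move=> a; have [[y hy]|no] := pselect (exists y, Q y /\ sector x1 a y); [exists y|exists 0].
exists [seq (w a, C * a.2) | a <- arcs]; split.
- rewrite big_map.
  apply: (@le_trans _ _ (C `^ s * \sum_(a <- arcs) a.2 `^ t)).
    rewrite mulr_sumr big_seq [leRHS]big_seq; apply: ler_sum => a al /=.
    rewrite powRM ?(ltW C0) ?(ltW (a0 a al)) // ler_pM2l //.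
    by apply: ger_powR => //; rewrite a0 // a1.
  by rewrite mulrC -ler_pdivlMr //; apply: le_trans sa _; rewrite ge_min lexx orbT.
- by move=> b /mapP[a al ->] /=; rewrite mulr_gt0 // a0.
move=> y Py D0y; have [a al sy] := cova y (conj Py D0y).
exists (w a, C * a.2); first exact: map_f.
have [|[Pw /= D0w] sw] := hw a; first by exists y.
have l1 := cross_id_le (w a - x1) (y0 - x0) (y - w a).
have e1 : cross (w a - x1) (y0 - x0) = Delta x0 y0 x1 - Delta x0 y0 (w a).
  by rewrite /Delta /cross !mxE; ring.
have e2 : cross (y - w a) (y0 - x0) = Delta x0 y0 (w a) - Delta x0 y0 y.
  by rewrite /Delta /cross !mxE; ring.
have e3 : cross (w a - x1) (y - w a) = Delta x1 (w a) y.
  by rewrite /Delta /cross !mxE; ring.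
rewrite e1 e2 e3 D0w D0y subrr subr0 normr0 mul0r add0r -/h in l1.
have l2 := cross_radial (yD _ Pw) (yD _ Py).
have l3 : `|radial_proj x1 y - radial_proj x1 (w a)| <= 2 * a.2.
  rewrite (_ : _ - _ = (radial_proj x1 y - a.1) - (radial_proj x1 (w a) - a.1)); last first.
    by rewrite opprB addrA subrK.
  apply: le_trans (ler_normB _ _) _; move: sy sw; rewrite /sector /=; lra.
have l4 : `|Delta x1 (w a) y| <= 16 * D ^+ 2 * a.2.
  apply: le_trans l2 _; have := ler_wpM2l (_ : 0 <= 8 * D ^+ 2) l3.
  by rewrite mulr_ge0 ?sqr_ge0 // => /(_ isT); lra.
have l5 : h * `|y - w a| <= 16 * D ^+ 2 * a.2 * `|y0 - x0|.
  by apply: le_trans l1 _; rewrite ler_wpM2r.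
rewrite /= /C mulrDl mul1r; apply: (@le_lt_trans _ _ (16 * D ^+ 2 * `|y0 - x0| / h * a.2)).
  rewrite -(ler_pM2l h0); apply: le_trans l5 _.
  by rewrite le_eqVlt; apply/orP; left; apply/eqP; field; rewrite gt_eqF.
by rewrite ltrDl a0.
Qed.

Lemma dnull_cube (s : R) A : ~ dnull s A -> exists q : dyadic, q.1 = 0%N /\ ~ dnull s (A `&` dcube q).
Proof.
move=> nA; apply: contrapT => /forallNP no; apply: nA.
have h (p : int * int) : dnull s (A `&` dcube (0%N, p)).
  by apply: contrapT => np; apply: (no (0%N, p)).
apply: dnull_sub (dnull_bigcup_count h) => x Ax.
by exists (dyof 0 x).2 => //; split.
Qed.

(** The content of a piece in one unit square bounds the masses from below, uniformly in [m]. *)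
Lemma frostman_of_content (s : R) A : 0 <= s -> ~ dnull s A -> exists2 c : R, 0 < c &
  forall m, exists L, [/\ wmeas A L, frost s m L, tmass L <= 1 & c <= tmass L].
Proof.
move=> s0 /dnull_cube[q [q0 nq]].
have fq : dfin s (A `&` dcube q).
  exists (\sum_(q <- [:: q]) dwt s q); apply: dcover_sub (dcover_seq s [:: q]) => x [_ qx].
  by exists q => //; rewrite mem_head.
exists (dcontent s (A `&` dcube q)).
  by rewrite lt_def dcontent_ge0 // andbT; apply/eqP => /(dnullP fq).
move=> m; have [L [wL fL tL cL]] := frostman A m s0 q0; exists L; split=> //.
by apply: wmeasS wL => x [].
Qed.

(** Supplies the constants of [frostman_core] in order: [tube_small] gives [L], then [j0], then [J]
    by compactness of [E], and finally the two measures. *)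
Lemma compact_contradiction (E P : set pt) (s eta t d D : R) :
  compact E -> compact P -> ~ dnull eta E -> ~ dnull s P ->
  0 < d -> d <= 1 -> 1 <= D -> 0 < eta -> 0 < t -> 2 * t < s ->
  (forall x y, E x -> P y -> d <= `|y - x|) ->
  (forall x y, (E `|` P) x -> (E `|` P) y -> `|y - x| <= D) ->
  (forall x0 y0, E x0 -> P y0 -> forall e, 0 < e -> exists l : seq (pt * R),
     [/\ \sum_(a <- l) a.2 `^ s <= e, (forall a, a \in l -> 0 < a.2) &
       forall y, P y -> Delta x0 y0 y = 0 -> exists2 a, a \in l & `|y - a.1| < a.2]) ->
  (forall x, E x -> forall e, 0 < e -> exists arcs : seq (pt * R),
     [/\ \sum_(a <- arcs) a.2 `^ t <= e, (forall a, a \in arcs -> 0 < a.2) &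
       (forall y, P y -> exists2 a, a \in arcs & sector x a y)]) ->
  False.
Proof.
move=> cE cP nE nP d0 d1 D1 eta0 t0 ts sep dia lines arcsE.
have s0 : 0 < s by lra.
have [cn cn0 hnu] := frostman_of_content (ltW eta0) nE.
have [cm cm0 hmu] := frostman_of_content (ltW s0) nP.
have [l l0 [L0 hL0]] := frostman_core d0 d1 D1 s0 eta0 t0 ts cn0 cm0.
have [r [r0 [m1 hm1]]] := tube_small (ltW s0) cE cP lines (expR_gt0 (- (2 * l))).
have [X X0 hX] := expR_le_exists r0.
have L0X : L0 <= Num.max L0 X by rewrite le_max lexx.
have [j0 hj0] := hL0 _ L0X.
have [J hJ] : exists J : nat, forall x, E x -> exists arcs : seq (pt * R),
     [/\ \sum_(a <- arcs) a.2 `^ t <= 1,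
        (forall a, a \in arcs -> expR (- J%:R) < a.2 <= expR (- j0%:R)) &
        (forall y, P y -> exists2 a, a \in arcs & sector x a y)].
  pose Psi (J : nat) x := exists arcs : seq (pt * R),
     [/\ \sum_(a <- arcs) a.2 `^ t <= 1,
        (forall a, a \in arcs -> expR (- J%:R) < a.2 <= expR (- j0%:R)) &
        (forall y, P y -> exists2 a, a \in arcs & sector x a y)].
  move/compact_near_coveringP : cE => /(_ nat \oo Psi _) h.
  have [|J _ hJ] := h; last by exists J => x Ex; exact: (hJ J (leqnn J) x Ex).
  move=> x Ex; pose e := Num.min 1 (expR (- j0%:R) `^ t).
  have e0 : 0 < e by rewrite lt_min ltr01 powR_gt0 // expR_gt0.
  have [arcs [sa a0 cova]] := arcsE x Ex e e0.
  have ab a : a \in arcs -> a.2 <= expR (- j0%:R).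
    move=> al; rewrite leNgt; apply/negP => lt.
    have : expR (- j0%:R) `^ t < a.2 `^ t.
      by apply: gt0_ltr_powR; rewrite ?nnegrE ?expR_ge0 // ltW // a0.
    rewrite ltNge => /negP; apply; apply: (@le_trans _ _ e); last by rewrite ge_min lexx orbT.
    apply: le_trans sa; rewrite (big_rem a) //= lerDl; apply: sumr_ge0 => *; exact: powR_ge0.
  have [J1 hJ1] : exists J1 : nat, forall (J : nat) a, (J1 <= J)%N -> a \in arcs -> expR (- J%:R) < a.2.
    elim: arcs a0 {sa cova ab} => [|a arcs IH] a0; first by exists 0%N.
    have [|k hk] := IH; first by move=> b bl; apply: a0; rewrite inE bl orbT.
    have a20 := a0 a (mem_head _ _).
    have [X' X'0 hX'] : exists2 X, 0 <= X & forall c, X <= c -> expR (- c) <= a.2 / 2 :> R.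
      by apply: expR_le_exists; rewrite divr_gt0.
    exists (maxn k (Num.bound X')) => J b; rewrite geq_max => /andP[kJ bJ].
    rewrite inE => /orP[/eqP ->|]; last exact: hk.
    have : expR (- J%:R) <= a.2 / 2.
      apply: hX'; apply: le_trans (ltW (archi_boundP X'0)) _; by rewrite ler_nat.
    lra.
  have xP y : P y -> x != y.
    move=> Py; apply/eqP => xy; have := sep x y Ex Py.
    by rewrite xy subrr normr0 leNgt d0.
  have nx : \forall x' \near x, forall y, P y -> exists2 a, a \in arcs & sector x' a y.
    move/compact_near_coveringP : cP => /(_ pt (nbhs x)
      (fun x' y => exists2 a, a \in arcs & sector x' a y) _); apply.
    move=> y Py; have [a al sy] := cova y Py.
    have [[U V] /= [nU nV] UV] := sector_near (xP y Py) sy.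
    exists (U, V) => //= -[y' x'] /= [Uy' Vx']; exists a => //.
    exact: (UV (y', x') (conj Uy' Vx')).
  exists ([set x' | forall y, P y -> exists2 a, a \in arcs & sector x' a y],
    [set J | (J1 <= J)%N]) => /=; first by split=> //; exists J1.
  move=> [x' J'] /= [hx' J1J']; exists arcs; split=> //.
    by apply: le_trans sa _; rewrite ge_min lexx.
  by move=> a al; rewrite hJ1 //= ab.
have [m0 hm0] := hj0 J.
pose m := maxn m0 m1.
have [nu [wnu fnu tnu cnu]] := hnu m; have [mu [wmu fmu tmu cmu]] := hmu m.
apply: (hm0 m (leq_maxl _ _) E P nu mu wnu wmu tnu tmu sep dia fnu fmu cnu cmu _ hJ).
move=> x y Ex Py; apply: le_lt_trans (hm1 m (leq_maxr _ _) mu wmu fmu tmu x y Ex Py).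
apply: (mass_le wmu) => z _; apply: tubeS; by apply: hX; rewrite le_max lexx orbT.
Qed.

End bridge.

(** * The theorem *)

Section assembly.
Context {R : realType}.
Local Notation pt := 'rV[R]_2.
Implicit Types (x y z u v w : pt) (A B K E : set pt).

Lemma not_on_line A : ~ contained_on_line A ->
  exists x1 x2 x3, [/\ A x1, A x2, A x3 & Delta x1 x2 x3 != 0].
Proof.
move=> nA; apply: contrapT => no; apply: nA.
have D0 x1 x2 x3 : A x1 -> A x2 -> A x3 -> Delta x1 x2 x3 = 0.
  by move=> A1 A2 A3; apply/eqP; apply: contrapT => /negP D0; apply: no; exists x1, x2, x3.
have line p v : v != 0 -> A `<=` [set p + t *: v | t in [set: R]] -> contained_on_line A.
  by move=> v0 Ap; exists [set p + t *: v | t in [set: R]]; split => //; exists p, v.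
have one0 : const_mx 1 != 0 :> pt.
  by apply/eqP => /rowP/(_ 0); rewrite !mxE => /eqP; rewrite oner_eq0.
have [[x1 A1]|nA] := pselect (exists x, A x); last first.
  by apply: (line 0 _ one0) => x Ax; exfalso; apply: nA; exists x.
have [[x2 [A2 x21]]|nA] := pselect (exists x, A x /\ x != x1); last first.
  apply: (line x1 _ one0) => x Ax; exists 0 => //; rewrite scale0r addr0.
  by apply/esym/eqP; apply: contrapT => /negP xx; apply: nA; exists x.
pose v := x2 - x1; have v0 : v != 0 by rewrite subr_eq0.
apply: (line x1 v v0) => x Ax.
have := D0 x1 x2 x A1 A2 Ax; rewrite /Delta -/v; set w := x - x1 => c0.
pose n := v 0 0 ^+ 2 + v 0 1 ^+ 2.
have n0 : n != 0.
  apply: contraNneq v0 => /eqP; rewrite paddr_eq0 ?sqr_ge0 // !sqrf_eq0.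
  by move=> /andP[/eqP e0 /eqP e1]; apply/eqP/pt_eqP; rewrite [RHS]mxE.
(* The parameter of the orthogonal projection of [w] to the direction [v]. *)
exists ((v 0 0 * w 0 0 + v 0 1 * w 0 1) / n) => //.
have -> : x = x1 + w by rewrite /w addrC subrK.
congr (_ + _); apply: pt_eqP; rewrite [LHS]mxE; apply: (mulIf n0); rewrite mulrAC divfK //.
  have -> : (v 0 0 * w 0 0 + v 0 1 * w 0 1) * v 0 0 = w 0 0 * n + v 0 1 * cross v w.
    by rewrite /n /cross; ring.
  by rewrite c0 mulr0 addr0.
have -> : (v 0 0 * w 0 0 + v 0 1 * w 0 1) * v 0 1 = w 0 1 * n - v 0 0 * cross v w.
  by rewrite /n /cross; ring.
by rewrite c0 mulr0 subr0.
Qed.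

(** If [x1], [x2], [x3] were all on the line [x0 y0], Cramer's rule would force [y0 - x0 = 0]. *)
Lemma off_line x1 x2 x3 x0 y0 : Delta x1 x2 x3 != 0 -> x0 != y0 ->
  [\/ Delta x0 y0 x1 != 0, Delta x0 y0 x2 != 0 | Delta x0 y0 x3 != 0].
Proof.
move=> D0 xy; have [e1|] := eqVneq (Delta x0 y0 x1) 0; last by constructor 1.
have [e2|] := eqVneq (Delta x0 y0 x2) 0; last by constructor 2.
have [e3|] := eqVneq (Delta x0 y0 x3) 0; last by constructor 3.
exfalso; move: D0; rewrite /Delta.
have := cross_id (x2 - x1) (x3 - x1) (y0 - x0).
have -> : cross (y0 - x0) (x3 - x1) = Delta x0 y0 x3 - Delta x0 y0 x1.
  by rewrite /Delta /cross !mxE; ring.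
have -> : cross (x2 - x1) (y0 - x0) = Delta x0 y0 x1 - Delta x0 y0 x2.
  by rewrite /Delta /cross !mxE; ring.
rewrite e1 e2 e3 !subrr !scale0r addr0 => /eqP; rewrite scaler_eq0.
move=> /orP[/eqP ->|]; first by rewrite eqxx.
by rewrite subr_eq0 eq_sym (negbTE xy).
Qed.

Lemma dnull_set0 (s : R) : dnull s (set0 : set pt).
Proof. by move=> e e0; exists set0 => //; apply: dwleW (ltW e0) (dwle0 s). Qed.

(** Otherwise each point of [K] lies in a dyadic square meeting [K] in a null set, and there are
    only countably many squares. *)
Lemma localize (s : R) K : ~ dnull s K ->
  exists z, forall r, 0 < r -> ~ dnull s (K `&` [set y | `|y - z| <= r]).
Proof.
move=> nK; apply: contrapT => /forallNP no; apply: nK.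
pose N q := if `[< dnull s (K `&` dcube q) >] then K `&` dcube q else set0.
have nN q : dnull s (N q).
  by rewrite /N; case: ifP => [/asboolP//|_]; exact: dnull_set0.
apply: dnull_sub (dnull_bigcup_count nN) => x Kx.
have [r /not_implyP[r0 /contrapT nr]] : exists r, ~ (0 < r -> ~ dnull s (K `&` [set y | `|y - x| <= r])).
  by apply/existsNP; exact: no.
have [g hg] := half_small r0.
exists (dyof g x) => //; rewrite /N asboolT //.
apply: dnull_sub nr => y [Ky gy]; split=> //=.
apply: le_trans (hg g (leqnn g)); exact: (dcube_dist gy (dcube_dyof g x)).
Qed.

Lemma dnull_point (s : R) z : 0 < s -> dnull s [set z].
Proof.
move=> s0 e e0; have c0 : 0 < e / 9 by rewrite divr_gt0.
have c1 : 0 < (e / 9) `^ s^-1 by exact: powR_gt0.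
have [g hg] := half_small c1.
have : dcover s [set z] (9 * dwt s (dyof g z)).
  apply: dcover_sub (dcover_ball s g z) => y -> /=.
  by rewrite subrr normr0 exprn_ge0.
move=> [S zS Sw]; exists S => //; apply: dwleW Sw.
rewrite -ler_pdivlMl // mulrC /dwt /= -powR_mulrn ?powR_ge0 // -powRrM mulrC powRrM powR_mulrn ?invr_ge0 //.
have -> : e / 9 = ((e / 9) `^ s^-1) `^ s by rewrite -powRrM mulVf ?gt_eqF // powRr1 // ltW.
by apply: ge0_ler_powR (hg g (leqnn g)); rewrite ?nnegrE ?exprn_ge0 // ltW.
Qed.

(** Apart from the null set [{z}], [E] is a countable union of parts at positive distance from [z].
    With [localize] this puts the two compact sets at positive distance. *)
Lemma separate (s : R) E z : 0 < s -> ~ dnull s E ->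
  exists n (q : dyadic), q.1 = 0%N /\
    ~ dnull s (E `&` [set x | (2^-1) ^+ n <= `|x - z|] `&` dcube q).
Proof.
move=> s0 nE; apply: contrapT => no; apply: nE.
have nn n : dnull s (E `&` [set x | (2^-1) ^+ n <= `|x - z|]).
  apply: contrapT => /dnull_cube[q hq]; by apply: no; exists n, q.
apply: dnull_sub (dnullU (dnull_point z s0) (dnull_bigcup nn)) => x Ex.
have [->|xz] := eqVneq x z; first by left.
right; have h0 : 0 < `|x - z| by rewrite normr_gt0 subr_eq0.
have [n hn] := half_small h0.
by exists n => //; split=> //=; exact: hn.
Qed.

Lemma suslinI (T : topologicalType) (A B : set T) : suslin A -> suslin B -> suslin (A `&` B).
Proof.
move=> sA sB; have -> : A `&` B = \bigcap_n (if n is 0%N then A else B).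
  apply/seteqP; split=> [x [Ax Bx] [|n] _ //|x h].
  by split; [exact: (h 0%N I)|exact: (h 1%N I)].
by apply: suslin_bigcap => -[|n].
Qed.

Lemma hausdorff_dim_ge0 A : (0 <= hausdorff_dim A)%E.
Proof. by apply: le_ereal_inf_tmp => _ [s [s0 _] <-]; rewrite lee_fin. Qed.

Lemma dnull_dim (s : R) A : 0 < s -> dnull s A -> (hausdorff_dim A <= s%:E)%E.
Proof.
move=> s0 nA; apply: ereal_inf_lbound; exists s => //; split; first exact: ltW.
exact: dnull_measure0.
Qed.

Lemma hausdorff_measureS (s : R) A B : A `<=` B ->
  (hausdorff_measure s A <= hausdorff_measure s B)%E.
Proof.
move=> AB; apply: ge_ereal_sup => _ [delta d0 <-].
apply: le_ereal_sup_tmp; exists (hausdorff_content s delta B); first by exists delta.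
apply: ereal_inf_le_tmp => _ [U [BU dU] <-]; exists U => //; split=> //.
exact: subset_trans BU.
Qed.

Lemma hausdorff_dimS A B : A `<=` B -> (hausdorff_dim A <= hausdorff_dim B)%E.
Proof.
move=> AB; apply: ereal_inf_le_tmp => _ [s [s0 sB] <-]; exists s => //; split=> //.
by apply/eqP; rewrite eq_le hausdorff_measure_ge0 andbT -sB hausdorff_measureS.
Qed.

(** Letting the exponent [s0] vary up to [t] makes the set monotone in [t]. *)
Definition small_proj K (t : R) : set pt := [set x | exists s0 : R,
  [/\ 0 <= s0, s0 <= t & hausdorff_measure s0 (radial_proj x @` (K `\ x)) = 0%E]].

Lemma small_proj_mono K t t' : t <= t' -> small_proj K t `<=` small_proj K t'.
Proof. by move=> tt x [s0 [h1 h2 h3]]; exists s0; split=> //; apply: le_trans tt. Qed.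

Lemma small_proj_contradiction K (t s eta : R) x1 x2 x3 : borel_set K -> 0 < t ->
  2 * t < s -> ~ dnull s K -> 0 < eta -> ~ dnull eta (small_proj K t) ->
  small_proj K t x1 -> small_proj K t x2 -> small_proj K t x3 -> Delta x1 x2 x3 != 0 ->
  False.
Proof.
move=> bK t0 ts nK eta0 nE S1 S2 S3 D123.
have s0 : 0 < s by lra.
have [z hz] := localize nK.
have [n [q [q0 nEz]]] := separate z eta0 nE.
set E0 := _ `&` dcube q in nEz.
pose r0 : R := (2^-1) ^+ n.
have r00 : 0 < r0 by rewrite exprn_gt0.
have r01 : r0 <= 1 by rewrite exprn_ile1 // invf_le1 // ler1n.
have r02 : 0 < r0 / 2 by rewrite divr_gt0.
have dfin_ball e c : dfin e [set y : pt | `|y - c| <= 1].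
  by have := dcover_ball e 0 c; rewrite expr0 => h; exists (9 * dwt e (dyof 0 c)).
have ball1 c r : r <= 1 -> [set y : pt | `|y - c| <= r] `<=` [set y | `|y - c| <= 1].
  by move=> r1 y /= h; apply: le_trans r1.
have r021 : r0 / 2 <= 1 by lra.
have [P [cP PK nP]] : exists P, [/\ compact P, P `<=` K `&` [set y | `|y - z| <= r0 / 2] & ~ dnull s P].
  apply: (@suslin_compact _ _ _ [set y | `|y - z| <= r0 / 2]).
  - apply: suslinI; first exact: suslin_borel.
    by apply: suslin_closed; exact: closed_cball.
  - by move=> x [].
  - exact: compact_cball.
  - by apply: dfin_sub (dfin_ball s z); exact: ball1.
  - exact: hz.
have Pz y : P y -> `|y - z| <= r0 / 2 by move=> /PK[].
have clP : closed P by exact: compact_closed.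
have [c E0c] : exists c, E0 c.
  by apply: contrapT => no; apply: nEz; apply: dnull_sub (dnull_set0 eta) => x Ex; apply: no; exists x.
pose cov (i : nat) x := exists arcs : seq (pt * R),
  [/\ \sum_(a <- arcs) a.2 `^ t <= (2^-1) ^+ i, (forall a, a \in arcs -> 0 < a.2) &
    (forall y, P y -> exists2 a, a \in arcs & sector x a y)].
(* Off [P] the existence of a finite cover by open arcs is an open condition. The countable
   intersection [G] is thus Suslin, and it contains [E0], for which this is not known. *)
pose O i := [set x | ~ P x /\ cov i x].
have oO i : open (O i).
  rewrite openE => x [nPx [arcs [sa a0 ca]]]; rewrite /interior.
  have n1 : \forall x' \near x, ~ P x'.
    by apply: open_nbhs_nbhs; split=> //; rewrite openC.
  have n2 : \forall x' \near x, forall y, P y -> exists2 a, a \in arcs & sector x' a y.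
    have := cP; move/compact_near_coveringP => /(_ pt (nbhs x)
      (fun x' y => exists2 a, a \in arcs & sector x' a y) _); apply.
    move=> y Py; have [a al sy] := ca y Py.
    have xy : x != y by apply/eqP => xy; apply: nPx; rewrite xy.
    have [[U V] /= [nU nV] UV] := sector_near xy sy.
    exists (U, V) => //= -[y' x'] /= [Uy' Vx']; exists a => //.
    exact: (UV (y', x') (conj Uy' Vx')).
  by apply: filterS2 n1 n2 => x' h1 h2; split=> //; exists arcs.
pose F := [set x | r0 <= `|x - z|] `&` [set x | `|x - c| <= 1].
pose G := F `&` \bigcap_i O i.
have sG : suslin G.
  apply: suslinI; last by apply: suslin_bigcap => i; exact: suslin_open.
  apply: suslin_closed; apply: closedI; last exact: closed_cball.
  rewrite -openC; have -> : ~` [set x | r0 <= `|x - z|] = ball z r0.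
    by apply/seteqP; split=> x; rewrite -ball_normE /= distrC ltNge => /negP.
  exact: ball_open.
have E0G : E0 `<=` G.
  move=> x [[Sx rx] qx]; split.
    by split=> //=; have := dcube_dist qx E0c.2; rewrite q0 expr0.
  move=> i _; have nPx : ~ P x.
    by move=> /Pz; have rx' : r0 <= `|x - z| := rx; lra.
  split=> //; have [t1 [t10 t1t m0]] := Sx.
  have i0 : 0 < (2^-1) ^+ i :> R by rewrite exprn_gt0.
  apply: (arcs_of_measure t10 t1t t0 i0 m0 cP) => y Py; split; first by have [] := PK y Py.
  by move=> yx; apply: nPx; rewrite -yx.
have [E [cE EG nE']] : exists E, [/\ compact E, E `<=` G & ~ dnull eta E].
  apply: (@suslin_compact _ _ _ [set y | `|y - c| <= 1] sG).
  - by move=> x [[]].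
  - exact: compact_cball.
  - exact: dfin_ball.
  - by move=> nG; apply: nEz; apply: dnull_sub nG.
have sep x y : E x -> P y -> r0 / 2 <= `|y - x|.
  move=> /EG[[/= rx _] _] /Pz yz.
  have : `|x - z| <= `|y - z| + `|y - x|.
    rewrite (_ : x - z = (y - z) - (y - x)); first exact: ler_normB.
    by rewrite opprB [RHS]addrC addrA subrK.
  lra.
pose D : R := 2 + `|c - z|.
have near x : (E `|` P) x -> `|x - c| <= 1 \/ `|x - z| <= 1.
  by move=> [/EG[[_ h] _]|/Pz h]; [left|right; apply: le_trans r021].
have dia x y : (E `|` P) x -> (E `|` P) y -> `|y - x| <= D.
  have tri a b : `|y - a| <= 1 -> `|x - b| <= 1 -> `|y - x| <= 2 + `|a - b|.
    move=> h1 h2; rewrite (_ : y - x = (y - a) - (x - b) + (a - b)); last first.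
      by apply: pt_eqP; rewrite !mxE; ring.
    apply: le_trans (ler_normD _ _) _; rewrite lerD2r.
    by apply: le_trans (ler_normB _ _) _; lra.
  have cz0 := normr_ge0 (c - z); rewrite /D.
  move=> /near[h2|h2] /near[h1|h1]; have := tri _ _ h1 h2; rewrite ?subrr ?normr0 //.
  - lra.
  - by rewrite (distrC z c).
  - lra.
have D1 : 1 <= D by rewrite /D; have := normr_ge0 (c - z); lra.
apply: (compact_contradiction cE cP nE' nP r02 r021 D1 eta0 t0 ts sep dia).
- move=> x0 y0 Ex0 Py0; have x0y0 : x0 != y0.
    apply/eqP => xy; have := sep _ _ Ex0 Py0; rewrite xy subrr normr0; lra.
  have PK' : P `<=` K by move=> y /PK[].
  have st : t <= s by lra.
  (* One of the three non-collinear points is off the line [x0 y0], and the projection from it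
     controls the trace of [P] on that line. *)
  have go x : small_proj K t x -> Delta x0 y0 x != 0 ->
    forall e, 0 < e -> exists l : seq (pt * R),
     [/\ \sum_(a <- l) a.2 `^ s <= e, (forall a, a \in l -> 0 < a.2) &
       forall y, P y -> Delta x0 y0 y = 0 -> exists2 a, a \in l & `|y - a.1| < a.2].
    move=> [t1 [t10 t1t m0]] Dx; exact: (line_cover cP PK' Pz t10 t1t t0 st m0 Dx).
  by have [] := off_line D123 x0y0; exact: go.
- move=> x Ex e e0; have [i hi] := half_small e0.
  have [_ [arcs [sa a0 ca]]] := (EG x Ex).2 i I.
  by exists arcs; split=> //; apply: le_trans (hi i (leqnn i)).
Qed.

(** A rational exponent fits strictly below half the dimension, so the exceptional set is a
    countable union and one of its members has positive content. *)
Lemma Inv_half_small_proj K : Inv_half K `<=` \bigcup_(q : rat)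
  (if `[< 0 < ratr q :> R /\ ((ratr q)%:E < (2^-1)%:E * hausdorff_dim K)%E >]
   then small_proj K (ratr q) else set0).
Proof.
move=> x /= /ereal_inf_lt[_ [s0 [s00 ms] <-]] lt.
have [b [sb bd]] : exists b : R, s0 < b /\ (b%:E <= (2^-1)%:E * hausdorff_dim K)%E.
  move: lt; case: ((2^-1)%:E * _)%E => [b| |]//.
    by rewrite lte_fin => lt; exists b.
  by move=> _; exists (s0 + 1); rewrite ltrDl ltr01 leey.
have [q] := rat_in_itvoo sb; rewrite in_itv /= => /andP[sq qb].
exists q => //; rewrite asboolT; first by exists s0; split=> //; exact: ltW.
split; first exact: le_lt_trans sq.
by apply: lt_le_trans bd; rewrite lte_fin.
Qed.

Lemma Inv_half_dim0 K : borel_set K -> ~ contained_on_line (Inv_half K) ->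
  hausdorff_dim (Inv_half K) = 0%E.
Proof.
move=> bK /not_on_line[x1 [x2 [x3 [I1 I2 I3 D123]]]].
apply/eqP; rewrite eq_le hausdorff_dim_ge0 andbT.
apply: contrapT => /negP; rewrite -ltNge => d0.
have [eta eta0 nI] : exists2 eta : R, 0 < eta & ~ dnull eta (Inv_half K).
  apply: contrapT => no; move: d0; rewrite ltNge => /negP; apply.
  apply/lee_addgt0Pr => e e0; rewrite add0e; apply: dnull_dim => //.
  by apply: contrapT => ne; apply: no; exists e.
have cover x : Inv_half K x -> exists t : R, [/\ 0 < t,
    (t%:E < (2^-1)%:E * hausdorff_dim K)%E & small_proj K t x].
  move=> /Inv_half_small_proj[q _]; case: ifP => // /asboolP[q0 qd] h.
  by exists (ratr q).
have [t [t0 td nt]] : exists t : R, [/\ 0 < t,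
    (t%:E < (2^-1)%:E * hausdorff_dim K)%E & ~ dnull eta (small_proj K t)].
  apply: contrapT => no; apply: nI.
  apply: dnull_sub (@Inv_half_small_proj K) _; apply: dnull_bigcup_count => q.
  case: ifP => [/asboolP[q0 qd]|_]; last exact: dnull_set0.
  by apply: contrapT => nq; apply: no; exists (ratr q).
have [t1 [t10 t1d S1]] := cover x1 I1; have [t2 [t20 t2d S2]] := cover x2 I2.
have [t3 [t30 t3d S3]] := cover x3 I3.
(* A single exponent for the non-null part and for the three non-collinear points. *)
pose T := Num.max (Num.max t t1) (Num.max t2 t3).
have T0 : 0 < T by rewrite !lt_max t0.
have Td : (T%:E < (2^-1)%:E * hausdorff_dim K)%E.
  by rewrite /T !EFin_max !gt_max td t1d t2d t3d.
have tT : t <= T by rewrite !le_max lexx.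
have t1T : t1 <= T by rewrite !le_max lexx orbT.
have t2T : t2 <= T by rewrite !le_max lexx !orbT.
have t3T : t3 <= T by rewrite !le_max lexx !orbT.
have [s [Ts sd]] : exists s : R, 2 * T < s /\ (s%:E < hausdorff_dim K)%E.
  move: Td (hausdorff_dim_ge0 K); case: (hausdorff_dim K) => [b| |] //.
    rewrite -EFinM lte_fin => Tb _; exists (T + b / 2); rewrite lte_fin; lra.
  by move=> _ _; exists (2 * T + 1); rewrite ltry; split=> //; lra.
have s0 : 0 < s by lra.
have nK : ~ dnull s K.
  by move=> /(dnull_dim s0); rewrite leNgt sd.
apply: (small_proj_contradiction bK T0 Ts nK eta0 _ _ _ _ D123).
- by move=> nT; apply: nt; apply: dnull_sub nT; exact: small_proj_mono.
- exact: small_proj_mono S1.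
- exact: small_proj_mono S2.
- exact: small_proj_mono S3.
Qed.

End assembly.

Theorem theorem1p5 (R : realType) (K : set 'rV[R]_2)
    (hK : borel_set K) (hdimK : (0 < hausdorff_dim K)%E) :
  (hausdorff_dim (Inv_half K) = 0%E \/ contained_on_line (Inv_half K)) /\
  (forall E : set 'rV[R]_2,
     borel_set E -> (0 < hausdorff_dim E)%E -> ~ contained_on_line E ->
     exists x : 'rV[R]_2, E x /\
       ((2^-1)%:E * hausdorff_dim K
        <= hausdorff_dim (radial_proj x @` (K `\ x)))%E).
Proof.
have part1 : hausdorff_dim (Inv_half K) = 0%E \/ contained_on_line (Inv_half K).
  have [l|nl] := pselect (contained_on_line (Inv_half K)); first by right.
  by left; apply: Inv_half_dim0.
split=> // E _ dE nE; apply: contrapT => no.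
(* Without a good point, [E] lies in the exceptional set, and by monotonicity either alternative
   contradicts a hypothesis on [E]. *)
have EI : E `<=` Inv_half K.
  move=> x Ex; rewrite /Inv_half /= ltNge; apply/negP => le; apply: no.
  by exists x.
case: part1 => [d0|[L [lL IL]]].
  by have := hausdorff_dimS EI; rewrite d0 leNgt dE.
by apply: nE; exists L; split=> //; exact: subset_trans IL.
Qed.
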